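(* Let $P$ be a $3$-point homogeneous non-degenerate convex polyhedron in $\mathbb{R}^3$. Then $P$ is $m$-point homogeneous for all $m\geq 1$ and one of the following properties holds: 1) $P$ is a regular tetrahedron, a cube, a regular octahedron, or a regular icosahedron; 2) $P$ is a cuboctahedron; 3) $P$ is a homogeneous tetrahedron with four pairwise isometric faces that are acute triangles; 4) $P$ is a right prism over a regular $n$-gon, $n\geq 3$, such that the set of distances between vertices of $P$ from a fixed base has empty intersection with the set of distances between vertices of $P$ from distinct bases; 5) $P$ is a right antiprism over a regular $n$-gon, $n\geq 2$, such that the set of distances between vertices of $P$ from a fixed base has empty intersection with the set of distances between vertices of $P$ from distinct bases; 6) $P$ is a rectangular parallelepiped of size $a\times b\times c$, where $a\leq b\leq c$ and $a^2+b^2\neq c^2$.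
   Context: All polytopes are convex. A metric space $(M,d)$ is $m$-point homogeneous ($m\in\mathbb{N}$) if for every two $m$-tuples $(A_1,\dots,A_m)$, $(B_1,\dots,B_m)$ of elements of $M$ with $d(A_i,A_j)=d(B_i,B_j)$ for all $i,j=1,\dots,m$, there is an isometry $f$ of $(M,d)$ onto itself with $f(A_i)=B_i$ for all $i$. A convex polytope is $m$-point homogeneous if its vertex set, with the metric $d$ induced from Euclidean space, is $m$-point homogeneous; homogeneous means $1$-point homogeneous (equivalently, the symmetry group acts transitively on the vertices). A polyhedron in $\mathbb{R}^3$ is non-degenerate if it has non-empty interior. The cuboctahedron is, up to similarity, the convex hull of all points of $\mathbb{R}^3$ with exactly one coordinate equal to $0$ and the other two equal to $\pm1$. A right prism over a regular $n$-gon ($n\ge 3$) is a polyhedron isometric to $Q\times[0,c]$, where $Q\subset\mathbb{R}^2$ is a regular $n$-gon and $c>0$; its bases are the two faces corresponding to $Q\times\{0\}$ and $Q\times\{c\}$. A right antiprism over a regular $n$-gon ($n\ge 2$, where a regular $2$-gon is understood to be a segment) is the convex hull of two congruent regular $n$-gons (its bases) lying in two distinct parallel planes, whose centers lie on a common line perpendicular to these planes, and which are twisted by the angle $\pi/n$ relative to each other; its other $2n$ (lateral) faces are isosceles triangles. For $n=2$ the bases are two segments and the antiprism is a tetrahedron. *)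

(* Defs.v *)
From mathcomp Require Import all_boot all_order all_algebra.
From mathcomp Require Import all_classical all_reals all_analysis.

Set Implicit Arguments.
Unset Strict Implicit.
Unset Printing Implicit Defensive.

Import Order.TTheory GRing.Theory Num.Theory.
Import numFieldNormedType.Exports.

Local Open Scope classical_set_scope.
Local Open Scope ring_scope.

Section MetricHomogeneity.
Context {R : realType} {T : Type}.

(* (M, d) is m-point homogeneous; only the restriction of f to M matters. *)
Definition point_homogeneous (d : T -> T -> R) (M : set T) (m : nat) : Prop :=
  forall A B : 'I_m -> T,
    (forall i, M (A i)) -> (forall i, M (B i)) ->
    (forall i j, d (A i) (A j) = d (B i) (B j)) ->
    exists f : T -> T,
      [/\ set_bij M M f,
          (forall x y, M x -> M y -> d (f x) (f y) = d x y)
        & forall i, f (A i) = B i].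

End MetricHomogeneity.

Section EuclideanSpace.
Context {R : realType}.

(* The library norm on 'rV[R]_n is the sup norm, hence an explicit Euclidean
   one; the two induce the same topology. *)
Definition dot {n} (u v : 'rV[R]_n) : R := \sum_i u 0 i * v 0 i.
Definition enorm {n} (u : 'rV[R]_n) : R := Num.sqrt (dot u u).
Definition edist {n} (x y : 'rV[R]_n) : R := enorm (x - y).

(* The angle at B of the triangle A B C. *)
Definition angle {n} (A B C : 'rV[R]_n) : R :=
  acos (dot (A - B) (C - B) / (enorm (A - B) * enorm (C - B))).

Definition acute_triangle {n} (A B C : 'rV[R]_n) : Prop :=
  [/\ angle B A C < pi / 2, angle A B C < pi / 2 & angle A C B < pi / 2].

(* In finite dimension such an f is automatically a bijection of the space. *)
Definition is_similarity {n} (r : R) (f : 'rV[R]_n -> 'rV[R]_n) : Prop :=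
  0 < r /\ forall x y, edist (f x) (f y) = r * edist x y.
Definition is_isometry {n} (f : 'rV[R]_n -> 'rV[R]_n) : Prop :=
  forall x y, edist (f x) (f y) = edist x y.

Definition similar_sets {n} (X Y : set 'rV[R]_n) : Prop :=
  exists (r : R) f, is_similarity r f /\ X = f @` Y.
Definition isometric_sets {n} (X Y : set 'rV[R]_n) : Prop :=
  exists f, is_isometry f /\ X = f @` Y.

Definition chull {n} (S : set 'rV[R]_n) : set 'rV[R]_n :=
  smallest (@convex_set R 'rV[R]_n) S.

Definition convex_polytope {n} (P : set 'rV[R]_n) : Prop :=
  exists S : set 'rV[R]_n, finite_set S /\ P = chull S.

(* The vertices of a polytope are its extreme points. *)
Definition vertices {n} (P : set 'rV[R]_n) : set 'rV[R]_n :=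
  [set x | P x /\ forall y z (t : R), P y -> P z -> 0 < t < 1 ->
                    x = t *: y + (1 - t) *: z -> y = z].

Definition polytope_homogeneous {n} (P : set 'rV[R]_n) (m : nat) : Prop :=
  point_homogeneous edist (vertices P) m.

Definition distances {n} (X Y : set 'rV[R]_n) : set R :=
  [set edist x y | x in X & y in Y].

End EuclideanSpace.

Section Polyhedra.
Context {R : realType}.
Notation R2 := 'rV[R]_2.
Notation R3 := 'rV[R]_3.

Definition vec2 (x y : R) : R2 := \row_(j < 2) [:: x; y]`_j.
Definition vec3 (x y z : R) : R3 := \row_(j < 3) [:: x; y; z]`_j.

Definition regular_tetrahedron : set R3 :=
  chull [set p : R3 | (forall i, `|p 0 i| = 1) /\ \prod_i p 0 i = 1].

Definition cube : set R3 := chull [set p : R3 | forall i, `|p 0 i| = 1].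

Definition regular_octahedron : set R3 :=
  chull [set p : R3 | exists i, `|p 0 i| = 1 /\ forall j, j != i -> p 0 j = 0].

Definition golden_ratio : R := (1 + Num.sqrt 5) / 2.

(* The cyclic permutations of (0, +-1, +-golden_ratio); i + 1 and i + 2 are
   computed modulo 3 in 'I_3. *)
Definition regular_icosahedron : set R3 :=
  chull [set p : R3 | exists i : 'I_3,
    [/\ p 0 i = 0, `|p 0 (i + 1)| = 1 & `|p 0 (i + 2)| = golden_ratio]].

Definition cuboctahedron : set R3 :=
  chull [set p : R3 | exists i, p 0 i = 0 /\ forall j, j != i -> `|p 0 j| = 1].

(* The last clause says that the four points are affinely independent. *)
Definition tetrahedron_on (v : 'I_4 -> R3) (P : set R3) : Prop :=
  P = chull (range v) /\
  row_free (\matrix_(i < 3) (v (lift ord0 i) - v ord0)).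

(* The face opposite to v i. *)
Definition tetrahedron_face (v : 'I_4 -> R3) (i : 'I_4) : set R3 :=
  chull [set v j | j in [set j | j != i]].

Definition polygon_vertex (n : nat) (o : R2) (r t : R) (k : nat) : R2 :=
  let a := t + 2 * pi * k%:R / n%:R in o + r *: vec2 (cos a) (sin a).

(* Center o, circumradius r, turned by the angle t; a segment when n = 2. *)
Definition regular_polygon (n : nat) (o : R2) (r t : R) : set R2 :=
  chull [set polygon_vertex n o r t k | k in `I_n].

Definition is_regular_polygon (n : nat) (Q : set R2) : Prop :=
  exists (o : R2) (r t : R), 0 < r /\ Q = regular_polygon n o r t.

Definition at_height (h : R) (q : R2) : R3 := vec3 (q 0 0) (q 0 1) h.

(* P is a right prism over a regular n-gon, with bases B0 and B1. *)
Definition right_prism (n : nat) (P B0 B1 : set R3) : Prop :=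
  exists (Q : set R2) (c : R) (f : R3 -> R3),
    [/\ is_regular_polygon n Q, 0 < c & is_isometry f] /\
    [/\ P = f @` [set at_height h q | h in `[0, c] & q in Q],
        B0 = f @` (at_height 0 @` Q)
      & B1 = f @` (at_height c @` Q)].

(* P is a right antiprism over a regular n-gon, with bases B0 and B1. *)
Definition right_antiprism (n : nat) (P B0 B1 : set R3) : Prop :=
  exists (o : R2) (r t c : R) (f : R3 -> R3),
    [/\ 0 < r, 0 < c & is_isometry f] /\
    [/\ B0 = f @` (at_height 0 @` regular_polygon n o r t),
        B1 = f @` (at_height c @` regular_polygon n o r (t + pi / n%:R))
      & P = chull (B0 `|` B1)].

Definition base_distances_separated (P B0 B1 : set R3) : Prop :=
  let V0 := vertices P `&` B0 in
  let V1 := vertices P `&` B1 in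
  (distances V0 V0 `|` distances V1 V1) `&` distances V0 V1 = set0.

Definition box (a b c : R) : set R3 :=
  [set p : R3 | [/\ 0 <= p 0 0 <= a, 0 <= p 0 1 <= b & 0 <= p 0 2 <= c]].

End Polyhedra.

(* Main.v *)
(** Move the barycenter to the origin.  The vertices then form a finite set V on
    a sphere, and 3-point homogeneity says that every isometry between at most
    three points of V extends to an orthogonal map preserving V.  A vector is
    determined by its products with three independent ones, so the same holds
    for any number of points.

    If only scalar matrices commute with the symmetries of V, then the
    stabilizer of a vertex v fixes only the line of v, because the symmetries
    swap any two vertices.  Hence the vertices nearest to v have their sum on
    this line; they form a regular polygon or a rectangle, since the
    stabilizer exchanges any two of them.  Two of them are excluded because the
    nearest-neighbor paths would be great circles, which meet; six or more
    because they would be too close to each other.  Following nearest-neighbor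
    paths, three of them lead to the tetrahedron or the cube, four to the
    octahedron or the cuboctahedron, five to the icosahedron.

    Otherwise the symmetries preserve a line, and V lies in two parallel planes
    exchanged by a symmetry.  Each layer consists of two points or is a regular
    polygon or a rectangle, and comparing the two layers gives a tetrahedron, a
    prism, an antiprism or a box. *)

Require Import Defs.
From mathcomp Require Import all_boot all_order all_algebra.
From mathcomp Require Import all_classical all_reals all_analysis.
From mathcomp Require Import ring lra complex polyrcf.
Import Order.TTheory GRing.Theory Num.Theory.
Import numFieldNormedType.Exports.
Set Implicit Arguments.
Unset Strict Implicit.
Unset Printing Implicit Defensive.
Local Open Scope classical_set_scope.
Local Open Scope ring_scope.
(* MathComp-Analysis exports another [edist]. *)
Local Notation edist := Defs.edist.
Local Notation Re := complex.Re.
Local Notation Im := complex.Im.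
Local Ltac row_ring := apply/rowP => ?; rewrite !mxE; ring.
Local Ltac row_field := apply/rowP => ?; rewrite !mxE; field.
Local Ltac row_is t := rewrite (_ : _ + _ = t) //; row_field.

(** * Dot products and orthogonal maps *)

(** All vertices have one norm, so distances enter only as scalar products. The products with three
    independent vectors fix a vector. Those with two fix a point of the sphere up to reflection in
    their plane: the square of the triple product is a Gram determinant, and only its sign, the side
    of the plane, stays open. Known parts of a configuration are continued in this way. Continuing
    does not show that nothing else occurs. For that, each model is checked to be saturated: a
    further vertex would have product at most c, the largest product of two distinct vertices, with
    all known ones, and combining these inequalities contradicts its norm or the symmetry of the
    model. Antipodal points of a circle are exchanged by the half-turn as well as by a reflection.
    Reflections are therefore guaranteed only for pairs that are not antipodal, and this is why
    rectangles survive beside regular polygons. With four neighbors the value of c that belongs to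
    the icosidodecahedron passes all tests along a face and needs an exclusion of its own. *)

Section Dot.
Context {R : realType}.

Lemma dotC n (u v : 'rV[R]_n) : dot u v = dot v u.
Proof. by apply: eq_bigr => i _; rewrite mulrC. Qed.

Lemma dot_mx n (u v : 'rV[R]_n) : dot u v = (u *m v^T) 0 0.
Proof. by rewrite mxE; apply: eq_bigr => i _; rewrite mxE. Qed.

Lemma dotDl n (u v w : 'rV[R]_n) : dot (u + v) w = dot u w + dot v w.
Proof. by rewrite !dot_mx mulmxDl mxE. Qed.

Lemma dotZl n a (u v : 'rV[R]_n) : dot (a *: u) v = a * dot u v.
Proof. by rewrite !dot_mx -scalemxAl mxE. Qed.

Lemma dotNl n (u v : 'rV[R]_n) : dot (- u) v = - dot u v.
Proof. by rewrite !dot_mx mulNmx mxE. Qed.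

Lemma dot0l n (v : 'rV[R]_n) : dot 0 v = 0.
Proof. by rewrite dot_mx mul0mx mxE. Qed.

Lemma dotDr n (u v w : 'rV[R]_n) : dot w (u + v) = dot w u + dot w v.
Proof. by rewrite !(dotC w) dotDl. Qed.

Lemma dotZr n a (u v : 'rV[R]_n) : dot v (a *: u) = a * dot v u.
Proof. by rewrite !(dotC v) dotZl. Qed.

Lemma dotNr n (u v : 'rV[R]_n) : dot v (- u) = - dot v u.
Proof. by rewrite !(dotC v) dotNl. Qed.

Lemma dot0r n (v : 'rV[R]_n) : dot v 0 = 0.
Proof. by rewrite dotC dot0l. Qed.

Definition dotE := (dotDl, dotDr, dotNl, dotNr, dotZl, dotZr, @dot0l, @dot0r).

Lemma dot_suml n (I : Type) (s : seq I) (F : I -> 'rV[R]_n) v :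
  dot (\sum_(i <- s) F i) v = \sum_(i <- s) dot (F i) v.
Proof.
by elim/big_rec2: _ => [|i a b _ <-]; rewrite ?dot0l ?dotDl.
Qed.

Lemma dot_ge0 n (u : 'rV[R]_n) : 0 <= dot u u.
Proof. by apply: sumr_ge0 => i _; rewrite -expr2 sqr_ge0. Qed.

Lemma dot_eq0 n (u : 'rV[R]_n) : dot u u = 0 -> u = 0.
Proof.
move=> /eqP; rewrite psumr_eq0 => [|i _]; last by rewrite -expr2 sqr_ge0.
move=> /allP u0; apply/rowP => i; rewrite mxE; apply/eqP.
by have := u0 i (mem_index_enum i); rewrite /= mulf_eq0 orbb.
Qed.

Lemma dot_gt0 n (u : 'rV[R]_n) : u != 0 -> 0 < dot u u.
Proof.
move=> u0; rewrite lt_neqAle dot_ge0 andbT eq_sym.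
by apply: contraNneq u0 => /dot_eq0 ->.
Qed.

Lemma enorm_ge0 n (u : 'rV[R]_n) : 0 <= enorm u.
Proof. exact: sqrtr_ge0. Qed.

Lemma sqr_enorm n (u : 'rV[R]_n) : enorm u ^+ 2 = dot u u.
Proof. by rewrite sqr_sqrtr ?dot_ge0. Qed.

Lemma sqr_edist n (x y : 'rV[R]_n) : edist x y ^+ 2 = dot (x - y) (x - y).
Proof. exact: sqr_enorm. Qed.

Lemma edist_eqP n m (x y : 'rV[R]_n) (x' y' : 'rV[R]_m) :
  edist x y = edist x' y' <-> dot (x - y) (x - y) = dot (x' - y') (x' - y').
Proof.
split=> [e|e]; first by rewrite -!sqr_edist e.
by rewrite /edist /enorm e.
Qed.

Lemma dot_subE n (x y : 'rV[R]_n) :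
  dot (x - y) (x - y) = dot x x + dot y y - 2 * dot x y.
Proof. by rewrite !dotE (dotC y x); ring. Qed.

Lemma dot_mulmx n (g : 'M[R]_n) (x y : 'rV[R]_n) :
  g *m g^T = 1%:M -> dot (x *m g) (y *m g) = dot x y.
Proof. by move=> og; rewrite !dot_mx trmx_mul mulmxA -(mulmxA x) og mulmx1. Qed.

Lemma orth_tr n (g : 'M[R]_n) : g *m g^T = 1%:M -> g^T *m g = 1%:M.
Proof. exact: mulmx1C. Qed.

Lemma mulmx_orthK n (g : 'M[R]_n) (x : 'rV[R]_n) :
  g *m g^T = 1%:M -> x *m g *m g^T = x.
Proof. by move=> og; rewrite -mulmxA og mulmx1. Qed.

Lemma mulmx_orthVK n (g : 'M[R]_n) (x : 'rV[R]_n) :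
  g *m g^T = 1%:M -> x *m g^T *m g = x.
Proof. by move=> og; rewrite -mulmxA orth_tr // mulmx1. Qed.

Lemma orth_inj n (g : 'M[R]_n) : g *m g^T = 1%:M ->
  injective (fun x : 'rV[R]_n => x *m g).
Proof. by move=> og x y /= /(congr1 (mulmx^~ g^T)); rewrite !mulmx_orthK. Qed.

End Dot.

(** * Cross and triple products, Gram matrices *)

Section Space.
Context {R : realType}.
Implicit Types (a b c d u v w x y : 'rV[R]_3) (g : 'M[R]_3).

Lemma dot3E u v : dot u v = u 0 0 * v 0 0 + u 0 1 * v 0 1 + u 0 2 * v 0 2.
Proof.
rewrite /dot !big_ord_recl big_ord0 addr0 !addrA.
by congr (_ + _ * _ + _ * _); congr (_ 0 _); apply: val_inj.
Qed.

Lemma rV3P u v : u 0 0 = v 0 0 -> u 0 1 = v 0 1 -> u 0 2 = v 0 2 -> u = v.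
Proof.
move=> e0 e1 e2; apply/rowP => -[[|[|[|//]]] lti].
- by rewrite (_ : Ordinal lti = 0) //; apply: val_inj.
- by rewrite (_ : Ordinal lti = 1) //; apply: val_inj.
- by rewrite (_ : Ordinal lti = 2) //; apply: val_inj.
Qed.

Lemma vec3_0 (p q r : R) : vec3 p q r 0 0 = p. Proof. by rewrite mxE. Qed.
Lemma vec3_1 (p q r : R) : vec3 p q r 0 1 = q. Proof. by rewrite mxE. Qed.
Lemma vec3_2 (p q r : R) : vec3 p q r 0 2 = r. Proof. by rewrite mxE. Qed.
Definition vec3E := (vec3_0, vec3_1, vec3_2).

Lemma vec3K u : vec3 (u 0 0) (u 0 1) (u 0 2) = u.
Proof. by apply: rV3P; rewrite vec3E. Qed.

Lemma vec3_neq0 : vec3 1 0 0 != 0 :> 'rV[R]_3.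
Proof.
apply/eqP => /(congr1 (fun w : 'rV_3 => w 0 0)); rewrite vec3E mxE.
by move/eqP; rewrite oner_eq0.
Qed.

Definition cross u v :=
  vec3 (u 0 1 * v 0 2 - u 0 2 * v 0 1) (u 0 2 * v 0 0 - u 0 0 * v 0 2)
       (u 0 0 * v 0 1 - u 0 1 * v 0 0).

Definition triple u v w := dot (cross u v) w.

Lemma dot_crossl u v : dot (cross u v) u = 0.
Proof. by rewrite dot3E !vec3E; ring. Qed.

Lemma dot_crossr u v : dot (cross u v) v = 0.
Proof. by rewrite dot3E !vec3E; ring. Qed.

Lemma dot_crossn u v : dot u (cross u v) = 0.
Proof. by rewrite dotC dot_crossl. Qed.

Lemma dot_cross u v w x :
  dot (cross u v) (cross w x) = dot u w * dot v x - dot u x * dot v w.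
Proof. by rewrite !dot3E !vec3E; ring. Qed.

Lemma crossC u v : cross u v = - cross v u.
Proof. by apply: rV3P; rewrite [RHS]mxE !vec3E; ring. Qed.

(** This is det A * det B = det (A B^T) for the matrices with rows a, b, c and u, v, w. It turns a
    triple product, up to its sign, into a function of scalar products. *)
Lemma tripleM a b c u v w : triple a b c * triple u v w =
  dot a u * (dot b v * dot c w - dot b w * dot c v)
  - dot a v * (dot b u * dot c w - dot b w * dot c u)
  + dot a w * (dot b u * dot c v - dot b v * dot c u).
Proof. by rewrite /triple !dot3E !vec3E; ring. Qed.

(** Cramer's rule: the cross products form, up to the factor [triple a b c], the dual basis. *)
Lemma triple_expand a b c x : triple a b c *: x =
  dot x a *: cross b c + dot x b *: cross c a + dot x c *: cross a b.
Proof. by apply: rV3P; rewrite /triple ?dot3E !mxE /=; ring. Qed.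

Lemma triple_dot_inj a b c x y : triple a b c != 0 ->
  dot x a = dot y a -> dot x b = dot y b -> dot x c = dot y c -> x = y.
Proof.
move=> t0 ea eb ec; apply: (scalerI t0).
by rewrite !triple_expand ea eb ec.
Qed.

Definition rows3 a b c : 'M[R]_3 := \matrix_(i < 3) [:: a; b; c]`_i.

Lemma vec3_rows3 (p q r : R) a b c :
  vec3 p q r *m rows3 a b c = p *: a + q *: b + r *: c.
Proof.
apply/rowP => i; rewrite !mxE !big_ord_recl big_ord0 addr0 !addrA.
by rewrite !mxE.
Qed.

Lemma rows3_tr a b c a' b' c' : rows3 a b c *m (rows3 a' b' c')^T =
  rows3 (vec3 (dot a a') (dot a b') (dot a c'))
        (vec3 (dot b a') (dot b b') (dot b c'))
        (vec3 (dot c a') (dot c b') (dot c c')).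
Proof.
apply/matrixP => -[[|[|[|//]]] ?] -[[|[|[|//]]] ?]; rewrite !mxE /dot;
  by apply: eq_bigr => k _; rewrite !mxE.
Qed.

Lemma rows3_1 : rows3 (vec3 1 0 0) (vec3 0 1 0) (vec3 0 0 1) = 1%:M.
Proof. by apply/matrixP => -[[|[|[|//]]] ?] -[[|[|[|//]]] ?]; rewrite !mxE. Qed.

Lemma rows3_unit a b c : triple a b c != 0 -> rows3 a b c \in unitmx.
Proof.
move=> t0; suff: rows3 a b c *m ((triple a b c)^-1 *:
    (rows3 (cross b c) (cross c a) (cross a b))^T) = 1%:M.
  by move=> /mulmx1_unit[].
rewrite -scalemxAr rows3_tr -rows3_1.
apply/row_matrixP => i; rewrite linearZ /= !rowK.
have ec u v : dot u (cross u v) = 0 by rewrite dotC dot_crossl.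
have ec' u v : dot u (cross v u) = 0 by rewrite dotC dot_crossr.
have -> : dot a (cross b c) = triple a b c.
  by rewrite /triple !dot3E !vec3E; ring.
have -> : dot b (cross c a) = triple a b c.
  by rewrite /triple !dot3E !vec3E; ring.
have -> : dot c (cross a b) = triple a b c by rewrite dotC.
by case: i => -[|[|[|//]]] ? /=; apply: rV3P; rewrite !mxE /= ?ec ?ec' ?mulr0 ?mulVf.
Qed.

(** If A and B are the matrices of rows, equal Gram matrices A A^T = B B^T make A^-1 B
    orthogonal. *)
Lemma gram_orth a b c a' b' c' : triple a b c != 0 ->
  dot a a = dot a' a' -> dot a b = dot a' b' -> dot a c = dot a' c' ->
  dot b b = dot b' b' -> dot b c = dot b' c' -> dot c c = dot c' c' ->
  exists2 g, g *m g^T = 1%:M & [/\ a *m g = a', b *m g = b' & c *m g = c'].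
Proof.
move=> t0 aa ab ac bb bc cc; set A := rows3 a b c; set B := rows3 a' b' c'.
have Au : A \in unitmx by exact: rows3_unit.
have AB : A *m A^T = B *m B^T.
  by rewrite !rows3_tr (dotC b a) (dotC c a) (dotC c b) (dotC b' a') (dotC c' a')
     (dotC c' b') aa ab ac bb bc cc.
exists (invmx A *m B).
  rewrite trmx_mul mulmxA -(mulmxA (invmx A)) -AB mulmxA mulVmx // mul1mx.
  by rewrite trmx_inv mulmxV // unitmx_tr.
have e (p q r : R) : (p *: a + q *: b + r *: c) *m (invmx A *m B) =
    p *: a' + q *: b' + r *: c'.
  by rewrite -!vec3_rows3 mulmxA -[_ *m rows3 a b c *m _]mulmxA mulmxV // mulmx1.
split.
- by have := e 1 0 0; rewrite !scale1r !scale0r !addr0.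
- by have := e 0 1 0; rewrite !scale1r !scale0r !addr0 !add0r.
- by have := e 0 0 1; rewrite !scale1r !scale0r !add0r.
Qed.

Lemma triple_orth a b c g : g *m g^T = 1%:M -> triple a b c != 0 ->
  triple (a *m g) (b *m g) (c *m g) != 0.
Proof.
move=> og t0; rewrite -sqrf_eq0 expr2 tripleM !dot_mulmx // -tripleM.
by rewrite mulf_neq0.
Qed.

End Space.

(** * Homogeneous vertex sets *)

Section HomSet.
Context {R : realType}.
Implicit Types (a b c d u v w x y : 'rV[R]_3) (g : 'M[R]_3) (V : seq 'rV[R]_3).

(** One inclusion is enough: an injective map of a finite set into itself is onto, see
    [sym_perm]. *)
Definition is_sym V g := g *m g^T = 1%:M /\ {in V, forall x, x *m g \in V}.

(* The vertex set of a 3-point homogeneous polyhedron with barycenter 0. *)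
Record homset V (q : R) : Prop := HomSet {
  hs_uniq : uniq V;
  hs_norm : {in V, forall x, dot x x = q};
  hs_sum : \sum_(x <- V) x = 0;
  hs_span : forall n, {in V, forall x, dot x n = 0} -> n = 0;
  hs_hom : forall a1 a2 a3 b1 b2 b3,
    {subset [:: a1; a2; a3; b1; b2; b3] <= V} ->
    dot a1 a2 = dot b1 b2 -> dot a1 a3 = dot b1 b3 -> dot a2 a3 = dot b2 b3 ->
    exists2 g, is_sym V g & [/\ a1 *m g = b1, a2 *m g = b2 & a3 *m g = b3]
}.

Lemma sym_perm V g : uniq V -> is_sym V g -> perm_eq [seq x *m g | x <- V] V.
Proof.
move=> uV [og gV]; have uM : uniq [seq x *m g | x <- V].
  by rewrite map_inj_uniq //; exact: orth_inj.
apply: uniq_perm => //; have [] := uniq_min_size uM (s2 := V); rewrite ?size_map //.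
by move=> _ /mapP[x xV ->]; exact: gV.
Qed.

Lemma sym_tr V g : uniq V -> is_sym V g -> is_sym V g^T.
Proof.
move=> uV sg; have [og gV] := sg; split; first by rewrite trmxK orth_tr.
move=> x xV; have := perm_mem (sym_perm uV sg) x; rewrite xV => /mapP[y yV ->].
by rewrite mulmx_orthK.
Qed.

Lemma sym_mul V g h : is_sym V g -> is_sym V h -> is_sym V (g *m h).
Proof.
move=> [og gV] [oh hV]; split.
  by rewrite trmx_mul mulmxA -(mulmxA g) oh mulmx1.
by move=> x xV; rewrite mulmxA hV ?gV.
Qed.

Lemma span_out V n : (forall n, {in V, forall x, dot x n = 0} -> n = 0) -> n != 0 ->
  exists2 x, x \in V & dot x n != 0.
Proof.
move=> span n0; apply/hasP; apply: contraNT n0 => /hasPn nV; apply/eqP.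
by apply: span => x /nV; rewrite negbK => /eqP.
Qed.

(** If V lay on the line of v, every vector orthogonal to v would be orthogonal to V and hence zero;
    the cross products of v with two coordinate vectors then force v = 0. *)
Lemma span_basis V v : (forall n, {in V, forall x, dot x n = 0} -> n = 0) -> v != 0 ->
  exists w x, [/\ w \in V, x \in V & triple v w x != 0].
Proof.
move=> span v0.
have [w wV cvw] : exists2 w, w \in V & cross v w != 0.
  apply/hasP; rewrite -[has _ _]negbK; apply/negP => /hasPn par.
  have out n : dot v n = 0 -> n = 0.
    move=> vn; apply: span => x xV.
    have /eqP cvx := negbNE (par x xV); have := dot_cross v x v n.
    rewrite cvx dot0l vn mul0r subr0 => /esym/eqP.
    by rewrite mulf_eq0 (negbTE (lt0r_neq0 (dot_gt0 v0))) => /eqP.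
  have n1 := out (cross v (vec3 1 0 0)); have n2 := out (cross v (vec3 0 1 0)).
  move: n1 n2; rewrite -!(dotC (cross _ _)) !dot_crossl => /(_ erefl) n1 /(_ erefl) n2.
  move/(congr1 (fun w : 'rV_3 => w 0 1)): (n1); move/(congr1 (fun w : 'rV_3 => w 0 2)): (n1).
  move/(congr1 (fun w : 'rV_3 => w 0 2)): (n2); rewrite !mxE /= => a1 a2 a3.
  by case/eqP: v0; apply: rV3P; rewrite mxE; lra.
by have [x xV vwx] := span_out span cvw; exists w, x; rewrite /triple dotC.
Qed.

Section Theory.
Variables (V : seq 'rV[R]_3) (q : R).
Hypothesis hV : homset V q.

Lemma hs_exists_out n : n != 0 -> exists2 x, x \in V & dot x n != 0.
Proof. exact: span_out (hs_span hV). Qed.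

Lemma hs_nonempty : exists v, v \in V.
Proof. by have [x xV _] := hs_exists_out vec3_neq0; exists x. Qed.

Lemma hs_norm_gt0 : 0 < q.
Proof.
have [x xV] : exists2 x, x \in V & x != 0.
  apply/hasP; rewrite -[has _ _]negbK; apply/hasPn => V0.
  have [x /V0] := hs_exists_out vec3_neq0; rewrite negbK => /eqP ->.
  by rewrite dot0l eqxx.
by move=> /dot_gt0; rewrite (hs_norm hV xV).
Qed.

Lemma hs_neq0 v : v \in V -> v != 0.
Proof.
move=> vV; apply/eqP => v0; have := hs_norm_gt0.
by rewrite -(hs_norm hV vV) v0 dot0l ltxx.
Qed.

Lemma hs_basis v : v \in V -> exists w x, [/\ w \in V, x \in V & triple v w x != 0].
Proof. by move=> /hs_neq0; apply: span_basis; exact: hs_span hV. Qed.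

Lemma hs_pair a1 a2 b1 b2 : a1 \in V -> a2 \in V -> b1 \in V -> b2 \in V ->
  dot a1 a2 = dot b1 b2 ->
  exists2 g, is_sym V g & a1 *m g = b1 /\ a2 *m g = b2.
Proof.
move=> a1V a2V b1V b2V e.
have sV : {subset [:: a1; a2; a2; b1; b2; b2] <= V}.
  by move=> x; rewrite !inE => /or4P[|||/or3P[]] /eqP->.
have [|g sg [e1 e2 _]] := hs_hom hV sV e e; first by rewrite !(hs_norm hV).
by exists g.
Qed.

Lemma hs_swap x y : x \in V -> y \in V ->
  exists2 g, is_sym V g & x *m g = y /\ y *m g = x.
Proof. by move=> xV yV; apply: hs_pair => //; rewrite dotC. Qed.

Lemma hs_fix_swap v x y : v \in V -> x \in V -> y \in V -> dot v x = dot v y ->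
  exists2 g, is_sym V g & [/\ v *m g = v, x *m g = y & y *m g = x].
Proof.
move=> vV xV yV e; apply: (hs_hom hV) => //; last by rewrite dotC.
by move=> z; rewrite !inE => /or4P[|||/or3P[]] /eqP->.
Qed.

Lemma hs_hom3 a1 a2 a3 b1 b2 b3 :
  a1 \in V -> a2 \in V -> a3 \in V -> b1 \in V -> b2 \in V -> b3 \in V ->
  dot a1 a2 = dot b1 b2 -> dot a1 a3 = dot b1 b3 -> dot a2 a3 = dot b2 b3 ->
  exists2 g, is_sym V g & [/\ a1 *m g = b1, a2 *m g = b2 & a3 *m g = b3].
Proof.
move=> a1V a2V a3V b1V b2V b3V; apply: (hs_hom hV) => z.
by rewrite !inE => /or4P[|||/or3P[]] /eqP->.
Qed.

(** Stated through the commutant instead of invariant subspaces: the operators built below commute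
    with all symmetries and are scalar at once, and the negation still yields an invariant line. *)
Definition irreducible := forall M : 'M[R]_3,
  (forall g, is_sym V g -> M *m g = g *m M) -> exists l, M = l%:M.

(** Conjugation by g only permutes the terms of the sum, as F is equivariant under g. *)
Lemma frame_comm (F : 'rV[R]_3 -> 'rV[R]_3) g :
  is_sym V g -> {in V, forall x, F (x *m g) = F x *m g} ->
  (\sum_(x <- V) x^T *m F x) *m g = g *m (\sum_(x <- V) x^T *m F x).
Proof.
move=> sg Fg; have [og gV] := sg; set S := \sum_(x <- V) _.
have {2}-> : S = g^T *m S *m g; last by rewrite !mulmxA og mul1mx.
rewrite mulmx_sumr mulmx_suml /S -[LHS](perm_big _ (sym_perm (hs_uniq hV) sg)).
rewrite big_map /= big_seq [RHS]big_seq; apply: eq_bigr => x xV.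
by rewrite Fg // trmx_mul !mulmxA.
Qed.

Lemma dot_frame (F : 'rV[R]_3 -> 'rV[R]_3) y z :
  dot (y *m \sum_(x <- V) x^T *m F x) z = \sum_(x <- V) dot y x * dot (F x) z.
Proof.
rewrite mulmx_sumr dot_suml; apply: eq_bigr => x _.
by rewrite mulmxA [y *m _]mx11_scalar mul_scalar_mx -dot_mx dotZl.
Qed.

(* Since the symmetries swap any two vertices, an equivariant map b satisfies
   <x, b y> = <y, b x>: its frame operator recovers b. *)
Lemma irreducible_fix v b : irreducible -> v \in V ->
  (forall g, is_sym V g -> v *m g = v -> b *m g = b) -> exists l, b = l *: v.
Proof.
move=> irr vV bfix.
have /choice[h hP] : forall x, exists h, x \in V -> is_sym V h /\ v *m h = x.
  move=> x; have [xV|_] := boolP (x \in V); last by exists 0.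
  by have [h sh [e _]] := hs_swap vV xV; exists h.
(* The equivariant extension of v |-> b to V. It does not depend on the choice of [h], because b is
   fixed by the stabilizer of v. *)
pose F x := b *m h x.
have FE x g : x \in V -> is_sym V g -> v *m g = x -> b *m g = F x.
  move=> xV sg vg; have [sh vh] := hP _ xV.
  have := bfix (g *m (h x)^T) (sym_mul sg (sym_tr (hs_uniq hV) sh)).
  rewrite mulmxA vg -{1}vh mulmx_orthK; last by case: sh.
  by move=> /(_ erefl) e; rewrite /F -{2}e mulmxA mulmx_orthVK //; case: sh.
have Fg g : is_sym V g -> {in V, forall x, F (x *m g) = F x *m g}.
  move=> sg x xV; have [sh vh] := hP _ xV; rewrite /F -mulmxA.
  apply/esym/FE; [by case: sg => _ ->|exact: sym_mul|by rewrite mulmxA vh].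
have Fsym x y : x \in V -> y \in V -> dot (F x) y = dot (F y) x.
  move=> xV yV; have [g sg [xg yg]] := hs_swap xV yV.
  by rewrite -(dot_mulmx (F x) y sg.1) -Fg // xg yg.
have [l El] : exists l, \sum_(x <- V) x^T *m x = l%:M.
  by apply: irr => g sg; apply: (frame_comm (F := id)).
have [m Em] : exists m, \sum_(x <- V) x^T *m F x = m%:M.
  by apply: irr => g sg; apply: frame_comm => //; exact: Fg.
(* Otherwise the sum of the squares of the products of any vertex y with all vertices vanishes, and
   v is orthogonal to V. *)
have l0 : l != 0.
  apply/eqP => l0; have := hs_neq0 vV; apply/negP; rewrite negbK; apply/eqP.
  apply: (hs_span hV) => y yV; apply/eqP; rewrite -sqrf_eq0; apply/eqP.
  have : \sum_(x <- V) dot y x * dot x y = 0.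
    by rewrite -(dot_frame id) El l0 mul_mx_scalar scale0r dot0l.
  move/eqP; rewrite psumr_eq0 => [/allP/(_ _ vV)/eqP|x _].
    by rewrite (dotC y).
  by rewrite (dotC y) -expr2 sqr_ge0.
(* Against a vertex y both sides are sums over x with the common factor <y, x>; the other factors
   <x, F v> and <F x, v> agree by [Fsym]. *)
exists (l^-1 * m); have key : l *: F v = m *: v.
  apply/eqP; rewrite -subr_eq0; apply/eqP/(hs_span hV) => y yV.
  have e1 : dot y (l *: F v) = \sum_(x <- V) dot y x * dot x (F v).
    by rewrite dotZr -dotZl -mul_mx_scalar -El (dot_frame id).
  have e2 : dot y (m *: v) = \sum_(x <- V) dot y x * dot (F x) v.
    by rewrite dotZr -dotZl -mul_mx_scalar -Em dot_frame.
  rewrite dotDr dotNr e1 e2 -sumrB big_seq big1 // => x xV.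
  by rewrite (dotC x) Fsym // subrr.
by rewrite -scalerA -key scalerA mulVf // scale1r -(FE v 1%:M) ?mulmx1 //;
   split; rewrite ?trmx1 ?mulmx1 // => x; rewrite mulmx1.
Qed.

Lemma stable_rank1_line (K : 'M[R]_3) : \rank K = 1 ->
  (forall g, is_sym V g -> (K *m g <= K)%MS) ->
  exists2 u, dot u u = 1 & forall g, is_sym V g -> u *m g = u \/ u *m g = - u.
Proof.
move=> rK Kg; have : K != 0 by rewrite -mxrank_eq0 rK.
case/rowV0Pn => u uK u0.
have Ku : (K <= u)%MS.
  by have := mxrank_leqif_sup uK; rewrite rK rank_rV u0 => /leqifP; case: ifP.
pose s := Num.sqrt (dot u u); have s0 : s != 0 by rewrite sqrtr_eq0 -ltNge dot_gt0.
have ss : s ^+ 2 = dot u u by rewrite sqr_sqrtr // dot_ge0.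
exists (s^-1 *: u); first by rewrite dotZl dotZr -ss; field.
move=> g sg; have /sub_rVP[t ut] : (u *m g <= u)%MS.
  by apply: submx_trans Ku; apply: submx_trans (Kg g sg); apply: submxMr.
have : t ^+ 2 = 1.
  have := dot_mulmx u u sg.1; rewrite ut dotZl dotZr => e.
  by apply: (mulIf (lt0r_neq0 (dot_gt0 u0))); rewrite mul1r -{2}e; ring.
move/eqP; rewrite sqrf_eq1 -scalemxAl ut => /orP[]/eqP->.
  by left; rewrite scale1r.
by right; rewrite scaleN1r scalerN.
Qed.

(** A matrix M that commutes with the symmetries has a real eigenvalue l, the characteristic
    polynomial being of degree three. If M is not scalar, N = M - l has rank 1 or 2, so its row
    space or its kernel is a line, and both are stable since N commutes with the symmetries. *)
Lemma invariant_line : ~ irreducible ->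
  exists2 u, dot u u = 1 & forall g, is_sym V g -> u *m g = u \/ u *m g = - u.
Proof.
move=> /existsNP[M /not_implyP[MC /forallNP Mns]].
have [l /eqP] : {l | root (char_poly M) l}.
  by apply: odd_poly_root; rewrite size_char_poly.
move/eqP; rewrite -/(root _ _) -eigenvalue_root_char => /eigenvalueP[z zM z0].
pose N := M - l%:M.
have NC g : is_sym V g -> N *m g = g *m N.
  by move=> sg; rewrite mulmxBl mulmxBr MC // scalar_mxC.
have N0 : N != 0 by apply/eqP => /subr0_eq; exact: Mns.
have zN : z *m N = 0 by rewrite mulmxBr zM mul_mx_scalar subrr.
have rN : (\rank N < 3)%N.
  rewrite ltn_neqAle rank_leq_row andbT; apply: contra z0 => /eqP rN.
  have /row_free_inj Ninj : row_free N by rewrite /row_free rN.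
  by apply/eqP/(Ninj 1%N); rewrite zN mul0mx.
have := rN; rewrite ltnS leq_eqVlt => /orP[/eqP r2|].
  apply: (@stable_rank1_line (kermx N)); first by rewrite mxrank_ker r2.
  by move=> g sg; apply/sub_kermxP; rewrite -mulmxA -NC // mulmxA mulmx_ker mul0mx.
rewrite ltnS => r1; apply: (@stable_rank1_line N).
  by apply/eqP; rewrite eqn_leq r1 lt0n mxrank_eq0.
by move=> g sg; rewrite NC // submxMl.
Qed.

End Theory.
End HomSet.

(** * Points of a circle closed under reflections *)

Section Circle.
Context {R : realType}.
Implicit Types (z y : R[i]) (C : seq R[i]).

Definition cis (a : R) : R[i] := (cos a +i* sin a)%C.

Lemma cis0 : cis 0 = 1.
Proof. by rewrite /cis cos0 sin0. Qed.

Lemma cisD a b : cis (a + b) = cis a * cis b.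
Proof.
by apply/eqP; rewrite eq_complex /= cosD sinD; apply/andP; split; apply/eqP => //; ring.
Qed.

Lemma cisX a k : cis a ^+ k = cis (a * k%:R).
Proof.
elim: k => [|k IH]; first by rewrite mulr0 cis0.
by rewrite exprS IH -cisD -natr1 mulrDr mulr1 addrC.
Qed.

Lemma cos_lt1 (a : R) : 0 < a < 2 * pi -> cos a < 1.
Proof.
move=> /andP[a0 a2]; have -> : a = (a / 2) *+ 2 by rewrite mulr2n; field.
rewrite cos_mulr2n cos2sin2.
have : 0 < sin (a / 2) by apply: sin_gt0_pi; apply/andP; split; lra.
by move=> s0; have := mulr_gt0 s0 s0; rewrite !mulr2n; nra.
Qed.

Lemma cis_prim n : (0 < n)%N -> n.-primitive_root (cis (2 * pi / n%:R)).
Proof.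
move=> n0; have nR : n%:R != 0 :> R by rewrite pnatr_eq0 -lt0n.
have wn : cis (2 * pi / n%:R) ^+ n = 1.
  rewrite cisX mulfVK // /cis mulrC mulr_natr cos2pi sin2pi.
  by apply/eqP; rewrite eq_complex /= !eqxx.
rewrite /primitive_root_of_unity n0; apply/forallP => i; apply/eqP.
rewrite unity_rootE; have [->|ni] := eqVneq i.+1 n; first by rewrite wn eqxx.
apply/eqP => /eqP; rewrite cisX eq_complex /= => /andP[/eqP c1 _].
have lin : (i.+1 < n)%N by rewrite ltn_neqAle ni ltn_ord.
suff : cos (2 * pi / n%:R * i.+1%:R) < 1 :> R by rewrite c1 ltxx.
have pi0 := @pi_gt0 R; have nR0 : 0 < n%:R :> R by rewrite ltr0n.
apply: cos_lt1; apply/andP; split; first by rewrite !(mulr_gt0, invr_gt0) // ltr0n.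
rewrite -mulrA gtr_pMr ?mulr_gt0 // mulrC ltr_pdivrMr // mul1r.
by rewrite ltr_nat.
Qed.

Lemma unity_cis n z : (0 < n)%N -> z ^+ n = 1 ->
  exists2 k, (k < n)%N & z = cis (2 * pi * k%:R / n%:R).
Proof.
move=> n0 /(prim_rootP (cis_prim n0))[k ->]; exists k; first exact: ltn_ord.
by rewrite cisX mulrAC.
Qed.

Lemma cis_unity n k : (0 < n)%N -> cis (2 * pi * k%:R / n%:R) ^+ n = 1.
Proof.
move=> n0; have -> : cis (2 * pi * k%:R / n%:R) = cis (2 * pi / n%:R) ^+ k.
  by rewrite cisX mulrAC.
by rewrite -exprM mulnC exprM (prim_expr_order (cis_prim n0)) expr1n.
Qed.

(* On the unit circle, z |-> x * y / z is the reflection exchanging x and y. *)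
Lemma reflection_closed C : uniq C -> 1 \in C -> 0 \notin C -> (2 < size C)%N ->
  (forall x y z, x \in C -> y \in C -> z \in C -> y != x -> y != - x ->
     x * y / z \in C) ->
  (forall z, (z \in C) = (z ^+ size C == 1)) \/
  (exists y, [/\ y ^+ 2 != 1, y ^+ 2 != -1, size C = 4 & C =i [:: 1; -1; y; - y]]).
Proof.
move=> uC C1 C0 sC clC; have nz x : x \in C -> x != 0.
  by apply: contraTneq => ->.
have [rich|poor] := boolP (all (fun x => all (fun z =>
    has (fun y => y \notin [:: x; - x; z; - z]) C) C) C).
  (* The product comes from two reflections: the one exchanging 1 and y sends a to y / a, the one
     exchanging b and y sends y / a to a b. The richness of C supplies a y that is admissible for
     both. *)
  left; have clM a b : a \in C -> b \in C -> a * b \in C.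
    move=> aC bC; have /allP/(_ _ bC)/hasP[y yC] := allP rich 1 C1.
    rewrite !inE !negb_or => /and4P[y1 yN1 yb yNb].
    have s1 : 1 * y / a \in C by exact: clC.
    have := clC b y _ bC yC s1 yb yNb; congr (_ \in C).
    by field; rewrite (nz _ yC) (nz _ aC).
  (* Multiplication by z permutes C; compare the products of all elements. *)
  have root z : z \in C -> z ^+ size C = 1.
    move=> zC; have pz : perm_eq [seq x * z | x <- C] C.
      have uM : uniq [seq x * z | x <- C].
        by rewrite map_inj_uniq //; apply: mulIf; exact: nz.
      apply: uniq_perm => //; have [] := uniq_min_size uM (s2 := C); rewrite ?size_map //.
      by move=> _ /mapP[x xC ->]; exact: clM.
    have : \prod_(x <- [seq x * z | x <- C]) x = \prod_(x <- C) x by apply: perm_big.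
    rewrite big_map big_split /= big_const_seq count_predT iter_mulr_1 => e.
    have p0 : \prod_(x <- C) x != 0.
      by rewrite prodf_seq_neq0; apply/allP => x /nz.
    by apply: (mulfI p0); rewrite mulr1.
  move=> z; apply/idP/idP => [/root/eqP//|zn].
  (* A root of unity outside C would give more roots than the degree allows. *)
  rewrite -[_ \in _]negbK; apply/negP => zC.
  have := @max_unity_roots _ (size C) (z :: C).
  rewrite /= zC uC unity_rootE zn (ltn_trans _ sC) // ltnn => /(_ isT) h.
  suff a : all (size C).-unity_root C by have := h a isT.
  by apply/allP => x /root xn; rewrite /= unity_rootE xn.
have {poor}[x [z [xC zC sub]]] : exists x z, [/\ x \in C, z \in C &
    {subset C <= [:: x; - x; z; - z]}].
  move: poor => /allPn[x xC /allPn[z zC /hasPn h]]; exists x, z; split=> // y /h.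
  by rewrite negbK.
have zx : z != x.
  apply/eqP => zx; have : {subset C <= [:: x; - x]}.
    by move=> y /sub; rewrite zx !inE => /or4P[]->; rewrite ?orbT.
  by move/(uniq_leq_size uC); rewrite leqNgt sC.
have zNx : z != - x.
  apply/eqP => zx'; have : {subset C <= [:: x; - x]}.
    by move=> y /sub; rewrite zx' opprK !inE => /or4P[]->; rewrite ?orbT.
  by move/(uniq_leq_size uC); rewrite leqNgt sC.
(* The reflection exchanging x and z also exchanges - x and - z, and C has a third point, which is
   one of these. *)
have both : - x \in C /\ - z \in C.
  have imp1 : - x \in C -> - z \in C.
    move=> xC'; have := clC x z _ xC zC xC' zx zNx; congr (_ \in C).
    by field; exact: nz.
  have imp2 : - z \in C -> - x \in C.
    move=> zC'; have := clC x z _ xC zC zC' zx zNx; congr (_ \in C).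
    by field; exact: nz.
  have [w wC] : exists2 w, w \in C & w \notin [:: x; z].
    apply/hasP; rewrite -[has _ _]negbK; apply/negP => /hasPn h.
    have : {subset C <= [:: x; z]} by move=> y /h; rewrite negbK.
    by move/(uniq_leq_size uC); rewrite leqNgt sC.
  rewrite !inE negb_or => /andP[wx wz].
  have := sub w wC; rewrite !inE (negbTE wx) (negbTE wz) /= => /orP[]/eqP we.
    by split; [|apply: imp1]; rewrite -we.
  by split; [apply: imp2|]; rewrite -we.
case: both => xC' zC'.
have neqN a : a \in C -> a != - a.
  move=> /nz a0; rewrite -subr_eq0 opprK -mulr2n mulrn_eq0 negb_or.
  by rewrite a0.
have C4 : C =i [:: x; - x; z; - z].
  move=> y; apply/idP/idP; first exact: sub.
  by rewrite !inE => /or4P[]/eqP->.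
have s4 : size C = 4.
  have u4 : uniq [:: x; - x; z; - z].
    have e : (x == - z) = (z == - x) by rewrite -eqr_oppLR eq_sym.
    rewrite /= !inE !negb_or e eqr_opp (eq_sym x z) (eq_sym (- x) z) zx zNx.
    by rewrite !neqN.
  by have := perm_size (uniq_perm uC u4 C4).
(* As 1 belongs to one of the two antipodal pairs, y is taken from the other. For y^2 = -1 these are
   the fourth roots of unity, which fall under the first alternative. *)
suff [y [y1 yC]] : exists y, y ^+ 2 != 1 /\ C =i [:: 1; -1; y; - y].
  have [yy|yy] := eqVneq (y ^+ 2) (-1); last by right; exists y; split.
  left=> w; rewrite s4 yC.
  have -> : (w ^+ 4 == 1) = ((w - 1) * (w + 1) * (w - y) * (w + y) == 0).
    have -> : (w - 1) * (w + 1) * (w - y) * (w + y) = (w ^+ 2 - 1) * (w ^+ 2 - y ^+ 2) by ring.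
    by rewrite yy opprK -subr_eq0; congr (_ == 0); ring.
  by rewrite !mulf_eq0 !subr_eq0 !addr_eq0 !inE -!orbA.
have sqN1 a b : a \in C -> 1 \in [:: a; - a] -> b != a -> b != - a -> b ^+ 2 != 1.
  move=> aC; rewrite !inE sqrf_eq1 negb_or => /orP[]/eqP h.
    by rewrite -h => -> ->.
  have -> : a = -1 by rewrite h opprK.
  by rewrite opprK => -> ->.
have := C1; rewrite C4 !inE => h.
have [h1|h1] := boolP (1 \in [:: x; - x]).
  exists z; split; first by apply: sqN1 xC h1 zx zNx.
  move=> w; rewrite C4 !inE orbA [RHS]orbA; congr (_ || _).
  move: h1; rewrite !inE => /orP[]/eqP e; first by rewrite -e.
  have -> : x = -1 by rewrite e opprK.
  by rewrite opprK orbC.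
have h2 : 1 \in [:: z; - z] by move: h h1; rewrite !inE orbA => /orP[->|].
exists x; split; first by apply: sqN1 zC h2 _ _; rewrite eq_sym ?eqr_oppLR.
move=> w; rewrite C4 !inE orbA orbC; rewrite [RHS]orbA; congr (_ || _).
move: h2; rewrite !inE => /orP[]/eqP e; first by rewrite -e.
have -> : z = -1 by rewrite e opprK.
by rewrite opprK orbC.
Qed.

(** In complex notation the conclusion reads s z = x y. The two linear equations for s say that s
    has the products with x and y that the mirror image of z has; they are solved by Cramer's
    rule. *)
Lemma planar_reflection (r2 x1 x2 y1 y2 z1 z2 s1 s2 : R) : 0 < r2 ->
  x1 ^+ 2 + x2 ^+ 2 = r2 -> y1 ^+ 2 + y2 ^+ 2 = r2 -> z1 ^+ 2 + z2 ^+ 2 = r2 ->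
  s1 * x1 + s2 * x2 = z1 * y1 + z2 * y2 -> s1 * y1 + s2 * y2 = z1 * x1 + z2 * x2 ->
  x1 * y2 - x2 * y1 != 0 ->
  s1 * z1 - s2 * z2 = x1 * y1 - x2 * y2 /\ s1 * z2 + s2 * z1 = x1 * y2 + x2 * y1.
Proof.
move=> r0 xx yy zz sx sy; set d := x1 * y2 - x2 * y1 => d0.
pose p := x1 * y1 - x2 * y2; pose m := x1 * y2 + x2 * y1.
have rn0 : r2 != 0 by rewrite gt_eqF.
have e1 : s1 * r2 = p * z1 + m * z2.
  apply: (mulfI d0); have -> : d * (s1 * r2) =
     r2 * (y2 * (s1 * x1 + s2 * x2) - x2 * (s1 * y1 + s2 * y2)) by rewrite /d; ring.
  rewrite sx sy; have -> : r2 * (y2 * (z1 * y1 + z2 * y2) - x2 * (z1 * x1 + z2 * x2)) =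
    y2 * (z1 * y1 + z2 * y2) * r2 - x2 * (z1 * x1 + z2 * x2) * r2 by ring.
  by rewrite -{1}xx -yy /d /p /m; ring.
have e2 : s2 * r2 = m * z1 - p * z2.
  apply: (mulfI d0); have -> : d * (s2 * r2) =
     r2 * (x1 * (s1 * y1 + s2 * y2) - y1 * (s1 * x1 + s2 * x2)) by rewrite /d; ring.
  rewrite sx sy; have -> : r2 * (x1 * (z1 * x1 + z2 * x2) - y1 * (z1 * y1 + z2 * y2)) =
    x1 * (z1 * x1 + z2 * x2) * r2 - y1 * (z1 * y1 + z2 * y2) * r2 by ring.
  by rewrite -{1}yy -xx /d /p /m; ring.
split; apply: (mulIf rn0).
  have -> : (s1 * z1 - s2 * z2) * r2 = s1 * r2 * z1 - s2 * r2 * z2 by ring.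
  by rewrite e1 e2 -zz -/p; ring.
have -> : (s1 * z2 + s2 * z1) * r2 = s1 * r2 * z2 + s2 * r2 * z1 by ring.
by rewrite e1 e2 -zz -/m; ring.
Qed.

End Circle.

(** * Coordinates in a horizontal plane *)

Section Frame.
Context {R : realType}.
Implicit Types (a b c d u v w x y : 'rV[R]_3) (g : 'M[R]_3).

Definition frame (e1 e2 u : 'rV[R]_3) : Prop := [/\ dot e1 e1 = 1, dot e2 e2 = 1, dot u u = 1 &
  [/\ dot e1 e2 = 0, dot e1 u = 0 & dot e2 u = 0]].

Lemma frame_orth e1 e2 u : frame e1 e2 u ->
  rows3 e1 e2 u *m (rows3 e1 e2 u)^T = 1%:M.
Proof.
move=> [e11 e22 uu [e12 e1u e2u]]; rewrite rows3_tr (dotC e2 e1) (dotC u e1) (dotC u e2).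
by rewrite e11 e22 uu e12 e1u e2u rows3_1.
Qed.

Lemma mulmx_rows3_tr x a b c : x *m (rows3 a b c)^T = vec3 (dot x a) (dot x b) (dot x c).
Proof.
by apply/rowP => -[[|[|[|//]]] i]; rewrite !mxE; apply: eq_bigr => k _; rewrite !mxE.
Qed.

Lemma frame_expand e1 e2 u x : frame e1 e2 u ->
  x = dot x e1 *: e1 + dot x e2 *: e2 + dot x u *: u.
Proof.
move=> /frame_orth fO.
by rewrite -{1}(mulmx_orthVK x fO) mulmx_rows3_tr vec3_rows3.
Qed.

Lemma frame_dot e1 e2 u x y : frame e1 e2 u ->
  dot x y = dot x e1 * dot y e1 + dot x e2 * dot y e2 + dot x u * dot y u.
Proof.
move=> f; rewrite {1}(frame_expand y f) !dotE; ring.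
Qed.

Lemma frame_of u e : dot u u = 1 -> dot e e = 1 -> dot e u = 0 ->
  frame e (cross u e) u.
Proof.
move=> uu ee eu; have ue : dot u e = 0 by rewrite dotC.
split=> //; first by rewrite dot_cross uu ee eu ue; ring.
by rewrite (dotC e) dot_crossl dot_crossr.
Qed.

(** With e1 along the horizontal part of x, the point x gets the planar coordinate 1. *)
Lemma level_frame u x (h q r : R) : dot u u = 1 -> dot x u = h -> dot x x = q ->
  0 < r -> r ^+ 2 = q - h ^+ 2 ->
  exists e1 e2, frame e1 e2 u /\ x = h *: u + r *: e1.
Proof.
move=> uu xu xx r0 rr; have rn0 : r != 0 by rewrite gt_eqF.
set e := r^-1 *: (x - h *: u); exists e, (cross u e).
split; last by rewrite scalerA mulfV // scale1r addrC subrK.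
have xq : q = r ^+ 2 + h ^+ 2 by rewrite rr subrK.
by apply: frame_of => //; rewrite /e !dotE ?(dotC u x) ?uu ?xu ?xx ?xq; field.
Qed.

Lemma unit_inv (a b : R) : a ^+ 2 + b ^+ 2 = 1 -> (Complex a b)^-1 = Complex a (- b).
Proof.
move=> ab; have n0 : Complex a b != 0.
  by apply/eqP => -[a0 b0]; move: ab; rewrite a0 b0; lra.
apply: (mulfI n0); rewrite mulfV //; apply/eqP; rewrite eq_complex /=.
by apply/andP; split; apply/eqP; lra.
Qed.

Lemma unit_Re (z w : R[i]) : Re z ^+ 2 + Im z ^+ 2 = 1 ->
  Re w ^+ 2 + Im w ^+ 2 = 1 -> Re w = Re z ->
  w = z \/ w = z^-1.
Proof.
case: z w => [a b] [a' b'] /= ab ab' aa; rewrite unit_inv // aa.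
have /eqP : b' ^+ 2 = b ^+ 2 by move: ab ab'; rewrite aa; lra.
by rewrite eqf_sqr => /orP[]/eqP ->; [left|right].
Qed.

(** After division by r, points at distance r from the axis become units, so rotations are
    multiplications and reflections have the form z |-> w / z. *)
Definition pcoord (r : R) (e1 e2 x : 'rV[R]_3) : R[i] := Complex (dot x e1 / r) (dot x e2 / r).

Definition level_point (u e1 e2 : 'rV[R]_3) (h r : R) (z : R[i]) : 'rV[R]_3 :=
  h *: u + r *: ((Re z : R) *: e1 + (Im z : R) *: e2).

Section PlanarCoordinate.
Variables (r : R) (e1 e2 u : 'rV[R]_3).
Hypotheses (r0 : 0 < r) (f : frame e1 e2 u).
Local Notation pc := (pcoord r e1 e2).

Let rn0 : r != 0. Proof. by rewrite gt_eqF. Qed.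

Lemma pcoord_inj x y :
  dot x u = dot y u -> pc x = pc y -> x = y.
Proof.
move=> exy [] /(divIf (lt0r_neq0 r0)) h1 /(divIf (lt0r_neq0 r0)) h2.
by rewrite (frame_expand x f) (frame_expand y f) h1 h2 exy.
Qed.

Lemma pcoord_expand x :
  x = dot x u *: u + r *: ((Re (pc x) : R) *: e1 + (Im (pc x) : R) *: e2).
Proof.
rewrite {1}(frame_expand x f) /= addrC; congr (_ + _).
by rewrite scalerDr !scalerA; congr (_ *: _ + _ *: _); field.
Qed.

Lemma pcoord_neq0 x :
  dot x x = r ^+ 2 + dot x u ^+ 2 -> pc x != 0.
Proof.
rewrite (frame_dot x x f) => h; apply/eqP => -[].
have ri0 : r^-1 != 0 by rewrite invr_eq0 gt_eqF.
move=> /eqP; rewrite mulf_eq0 (negbTE ri0) orbF => /eqP x1.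
move=> /eqP; rewrite mulf_eq0 (negbTE ri0) orbF => /eqP x2.
move: h; rewrite x1 x2 mul0r !add0r -expr2 => /eqP.
rewrite -subr_eq subrr eq_sym sqrf_eq0 => /eqP r00; by move: r0; rewrite r00 ltxx.
Qed.

(** The point z may lie on a level other than that of x and y. That g acts as a reflection is not
    assumed: exchanging two points that are neither equal nor antipodal leaves no other choice. *)
Lemma pcoord_reflect x y z g :
  g *m g^T = 1%:M -> u *m g = u -> x *m g = y -> y *m g = x ->
  dot x x = r ^+ 2 + dot x u ^+ 2 -> dot z z = r ^+ 2 + dot z u ^+ 2 ->
  pc y != pc x -> pc y != - pc x ->
  pc (z *m g) = pc x * pc y / pc z.
Proof.
move=> og ug xg yg xx zz yx yNx.
have yu : dot y u = dot x u by rewrite -xg -{1}ug dot_mulmx.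
have yy : dot y y = r ^+ 2 + dot y u ^+ 2 by rewrite yu -xx -xg dot_mulmx.
have zu : dot (z *m g) u = dot z u by rewrite -{1}ug dot_mulmx.
have sx : dot (z *m g) x = dot z y by rewrite -{1}yg dot_mulmx.
have sy : dot (z *m g) y = dot z x by rewrite -{1}xg dot_mulmx.
apply: (mulIf (pcoord_neq0 zz)); rewrite mulfVK ?pcoord_neq0 //.
move: xx yy zz sx sy;
rewrite (frame_dot x x f) (frame_dot y y f) (frame_dot z z f).
rewrite (frame_dot (z *m g) x f) (frame_dot (z *m g) y f) (frame_dot z y f) (frame_dot z x f) zu yu.
set x1 := dot x e1; set x2 := dot x e2; set y1 := dot y e1; set y2 := dot y e2.
set z1 := dot z e1; set z2 := dot z e2; set s1 := dot _ e1; set s2 := dot _ e2.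
move=> xx yy zz sx sy.
have xx' : x1 ^+ 2 + x2 ^+ 2 = r ^+ 2 by move: xx; lra.
have yy' : y1 ^+ 2 + y2 ^+ 2 = r ^+ 2 by move: yy; lra.
have zz' : z1 ^+ 2 + z2 ^+ 2 = r ^+ 2 by move: zz; lra.
(* Parallel horizontal parts of equal length are equal or opposite. *)
have d0 : x1 * y2 - x2 * y1 != 0.
  apply/eqP => d0; have : (x1 * y1 + x2 * y2) ^+ 2 = (r ^+ 2) ^+ 2.
    have -> : (x1 * y1 + x2 * y2) ^+ 2 =
      (x1 ^+ 2 + x2 ^+ 2) * (y1 ^+ 2 + y2 ^+ 2) - (x1 * y2 - x2 * y1) ^+ 2 by ring.
    by rewrite d0 xx' yy' expr0n subr0 -expr2.
  move/eqP; rewrite eqf_sqr => /orP[]/eqP e.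
    have : (y1 - x1) ^+ 2 + (y2 - x2) ^+ 2 = 0 by move: e xx' yy'; lra.
    move/eqP; rewrite paddr_eq0 ?sqr_ge0 // !sqrf_eq0 !subr_eq0 => /andP[/eqP h1 /eqP h2].
    by move: yx; rewrite /pcoord -/x1 -/x2 -/y1 -/y2 h1 h2 eqxx.
  have : (y1 + x1) ^+ 2 + (y2 + x2) ^+ 2 = 0 by move: e xx' yy'; lra.
  move/eqP; rewrite paddr_eq0 ?sqr_ge0 // !sqrf_eq0 !addr_eq0 => /andP[/eqP h1 /eqP h2].
  by move: yNx; rewrite /pcoord -/x1 -/x2 -/y1 -/y2 h1 h2 eq_complex /= !mulNr !eqxx.
have sx' : s1 * x1 + s2 * x2 = z1 * y1 + z2 * y2 by move: sx; lra.
have sy' : s1 * y1 + s2 * y2 = z1 * x1 + z2 * x2 by move: sy; lra.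
have [k1 k2] := planar_reflection (exprn_gt0 2 r0) xx' yy' zz' sx' sy' d0.
apply/eqP; rewrite eq_complex /= -/x1 -/x2 -/y1 -/y2 -/z1 -/z2 -/s1 -/s2.
apply/andP; split; apply/eqP.
  transitivity ((s1 * z1 - s2 * z2) / r ^+ 2); first by field.
  by rewrite k1; field.
transitivity ((s1 * z2 + s2 * z1) / r ^+ 2); first by field.
by rewrite k2; field.
Qed.

Lemma pcoord_level (h : R) z :
  pc (level_point u e1 e2 h r z) = z.
Proof.
have [e11 e22 _ [e12 e1u e2u]] := f; apply/eqP; rewrite eq_complex /= /level_point !dotE.
rewrite (dotC u e1) (dotC u e2) (dotC e2 e1) e11 e22 e12 e1u e2u.
by apply/andP; split; apply/eqP; field.
Qed.

Lemma level_pcoord x :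
  level_point u e1 e2 (dot x u) r (pc x) = x.
Proof. by rewrite /level_point -pcoord_expand. Qed.

Lemma dot_pcoord x y :
  dot y y = r ^+ 2 + dot y u ^+ 2 ->
  dot x y = r ^+ 2 * (Re (pc x / pc y) : R) + dot x u * dot y u.
Proof.
rewrite (frame_dot y y f) (frame_dot x y f) => yy.
rewrite /pcoord unit_inv /=; first by field.
have -> : (dot y e1 / r) ^+ 2 + (dot y e2 / r) ^+ 2 = (dot y e1 ^+ 2 + dot y e2 ^+ 2) / r ^+ 2 by field.
have -> : dot y e1 ^+ 2 + dot y e2 ^+ 2 = r ^+ 2 by move: yy; lra.
by rewrite mulfV // sqrf_eq0.
Qed.

Lemma pcoord_unit y :
  dot y y = r ^+ 2 + dot y u ^+ 2 ->
  Re (pc y) ^+ 2 + Im (pc y) ^+ 2 = 1.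
Proof.
rewrite (frame_dot y y f) /= => yy.
have -> : (dot y e1 / r) ^+ 2 + (dot y e2 / r) ^+ 2 = (dot y e1 ^+ 2 + dot y e2 ^+ 2) / r ^+ 2 by field.
have -> : dot y e1 ^+ 2 + dot y e2 ^+ 2 = r ^+ 2 by move: yy; lra.
by rewrite mulfV // sqrf_eq0.
Qed.

(** Write X, Y, Z for the coordinates. The preserved product with x leaves w Z and w X^2 / Z for the
    image of z, that with y leaves w Z and w Y^2 / Z; the second values agree only if Y = X or Y = -
    X. *)
Lemma pcoord_rotate x y z g (w : R[i]) :
  g *m g^T = 1%:M -> u *m g = u ->
  dot x x = r ^+ 2 + dot x u ^+ 2 -> dot y y = r ^+ 2 + dot y u ^+ 2 ->
  dot z z = r ^+ 2 + dot z u ^+ 2 ->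
  pc (x *m g) = w * pc x ->
  pc (y *m g) = w * pc y ->
  pc y != pc x -> pc y != - pc x ->
  pc (z *m g) = w * pc z.
Proof.
move=> og ug xx yy zz xg yg yx yNx.
have inv p : dot p p = r ^+ 2 + dot p u ^+ 2 -> dot (p *m g) (p *m g) = r ^+ 2 + dot (p *m g) u ^+ 2.
  by rewrite -{2}ug !dot_mulmx.
have du p : dot (p *m g) u = dot p u by rewrite -{1}ug dot_mulmx.
have rn2 : r ^+ 2 != 0 by rewrite sqrf_eq0 gt_eqF.
have ReE p : dot p p = r ^+ 2 + dot p u ^+ 2 ->
    Re (pc (z *m g) / pc (p *m g)) =
    Re (pc z / pc p).
  move=> pp; have := dot_pcoord (z *m g) (inv _ pp).
  by rewrite dot_mulmx // (dot_pcoord z pp) !du => /addIr /(mulfI rn2) ->.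
have Xn := pcoord_neq0 xx; have Yn := pcoord_neq0 yy.
have Zn := pcoord_neq0 zz.
have wn : w != 0.
  by have := pcoord_neq0 (inv _ xx); rewrite xg mulf_eq0 negb_or => /andP[].
have h1 := ReE _ xx; have h2 := ReE _ yy; rewrite xg yg in h1 h2.
have Uu p p' : dot p p = r ^+ 2 + dot p u ^+ 2 -> dot p' p' = r ^+ 2 + dot p' u ^+ 2 ->
    Re (pc p / pc p') ^+ 2 +
    Im (pc p / pc p') ^+ 2 = 1.
  move=> /pcoord_unit h /pcoord_unit h'; rewrite /= in h h'.
  rewrite /pcoord unit_inv //=.
  set a := _ / r in h *; set b := _ / r in h *; set a' := _ / r in h' *; set b' := _ / r in h' *.
  have -> : (a * a' - b * - b') ^+ 2 + (a * - b' + b * a') ^+ 2 =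
    (a ^+ 2 + b ^+ 2) * (a' ^+ 2 + b' ^+ 2) by ring.
  by rewrite h h' mulr1.
have v1 := Uu _ _ (inv _ zz) (inv _ xx); have v2 := Uu _ _ (inv _ zz) (inv _ yy).
rewrite xg in v1; rewrite yg in v2.
set Z' := pc (z *m g) in h1 h2 v1 v2 *.
set X := pc x in h1 v1 Xn yx yNx *; set Y := pc y in h2 v2 Yn yx yNx *.
set Z := pc z in h1 h2 Zn *.
have [e|e] := unit_Re (Uu _ _ zz xx) v1 h1.
  by rewrite -[LHS](mulfVK (mulf_neq0 wn Xn)) e -/Z -/X; field.
have [e'|e'] := unit_Re (Uu _ _ zz yy) v2 h2.
  by rewrite -[LHS](mulfVK (mulf_neq0 wn Yn)) e' -/Z -/Y; field.
rewrite -/Z -/X -/Y in e e'.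
have E1 : Z' = w * X ^+ 2 / Z by rewrite -[LHS](mulfVK (mulf_neq0 wn Xn)) e; field; rewrite Xn Zn.
have E2 : Z' = w * Y ^+ 2 / Z by rewrite -[LHS](mulfVK (mulf_neq0 wn Yn)) e'; field; rewrite Yn Zn.
have /eqP : Y ^+ 2 = X ^+ 2.
  by apply: (mulfI wn); apply: (mulIf (_ : Z^-1 != 0)); rewrite ?invr_eq0 // -E1 -E2.
by rewrite eqf_sqr (negbTE yx) (negbTE yNx).
Qed.

End PlanarCoordinate.

(* The axis u is fixed, so the symmetries act on the level of D as planar isometries. *)
Lemma circle_level (D : seq 'rV[R]_3) u (h q r : R) x0 : uniq D -> x0 \in D -> (2 < size D)%N ->
  dot u u = 1 -> {in D, forall x, dot x u = h /\ dot x x = q} ->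
  0 < r -> r ^+ 2 = q - h ^+ 2 ->
  {in D &, forall x y, exists g, [/\ g *m g^T = 1%:M, u *m g = u,
     {in D, forall z, z *m g \in D}, x *m g = y & y *m g = x]} ->
  exists e1 e2, [/\ frame e1 e2 u, x0 = h *: u + r *: e1 &
    (let C := [seq pcoord r e1 e2 x | x <- D] in
      (forall z, (z \in C) = (z ^+ size D == 1)) \/
      (exists y : R[i], [/\ y ^+ 2 != 1, y ^+ 2 != -1, size D = 4 & C =i [:: 1; -1; y; - y]]))].
Proof.
move=> uD x0D sD uu lD r0 rr symD; have [x0u x00] := lD _ x0D.
have [e1 [e2 [f x0E]]] := level_frame uu x0u x00 r0 rr.
exists e1, e2; split=> // C; have rn0 : r != 0 by rewrite gt_eqF.
have lev x : x \in D -> dot x x = r ^+ 2 + dot x u ^+ 2.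
  by move=> /lD[-> ->]; rewrite rr subrK.
have sC : size C = size D by rewrite size_map.
rewrite -sC; apply: reflection_closed; rewrite ?sC //.
- rewrite map_inj_in_uniq // => x y xD yD; apply: (pcoord_inj r0 f).
  by have [-> _] := lD _ xD; have [-> _] := lD _ yD.
- apply/mapP; exists x0 => //; have [e11 e22 _ [e12 e1u e2u]] := f.
  apply/eqP; rewrite eq_complex /= x0E !dotE (dotC u e1) (dotC u e2) e11 e12 e1u e2u.
  by rewrite !mulr0 !add0r mulr1 mulfV // mul0r !eqxx.
- by apply/mapP => -[x /lev xl /esym/eqP]; rewrite (negbTE (pcoord_neq0 r0 f xl)).
move=> _ _ _ /mapP[x xD ->] /mapP[y yD ->] /mapP[z zD ->] n1 n2.
have [g [og ug gD xg yg]] := symD x y xD yD.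
rewrite -(pcoord_reflect r0 f og ug xg yg (lev _ xD) (lev _ zD) n1 n2).
by apply: map_f; apply: gD.
Qed.

End Frame.

(** * Models of the vertex sets *)

Section Copies.
Context {R : realType}.
Implicit Types (a b d u v w x y z p : 'rV[R]_3) (V : seq 'rV[R]_3).

(** The matrix M is a similarity of ratio sqrt k; recording k avoids the square root. *)
Definition similar_copy V (S : set 'rV[R]_3) : Prop :=
  exists (k : R) (M : 'M[R]_3), [/\ 0 < k, M *m M^T = k%:M
    & [set` V] = [set p *m M | p in S]].

Lemma seq_argmax (T : eqType) (f : T -> R) (s : seq T) (x0 : T) : x0 \in s ->
  exists2 x : T, x \in s & {in s, forall y : T, f y <= f x}.
Proof.
elim: s x0 => // a s IH x0 _; case: s IH => [|b s] IH.
  by exists a; rewrite ?mem_head // => y; rewrite inE => /eqP ->.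
have [x xs xmax] := IH b (mem_head _ _).
have [ax|xa] := leP (f a) (f x).
  exists x; first by rewrite inE xs orbT.
  by move=> y; rewrite inE => /orP[/eqP ->//|/xmax].
exists a; first exact: mem_head.
move=> y; rewrite inE => /orP[/eqP ->//|/xmax yx].
by rewrite (le_trans yx) // ltW.
Qed.

Lemma norm_eq1 (a : R) : `|a| = 1 -> a = 1 \/ a = -1.
Proof. by move=> /eqP; rewrite eqr_norml ler01 andbT => /orP[]/eqP; [left|right]. Qed.

(** The norm and the products with v and w determine the square of the triple product, and its sign
    then determines the point. So at most two points are possible, and p and p' are both of them. *)
Lemma mirror_two v w p p' t : cross v w != 0 -> p != p' ->
  dot p p = dot t t -> dot p' p' = dot t t ->
  dot p v = dot t v -> dot p' v = dot t v -> dot p w = dot t w -> dot p' w = dot t w ->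
  t = p \/ t = p'.
Proof.
move=> n0 pp' ppt p't pv p'v pw p'w.
have sq z : dot z z = dot t t -> dot z v = dot t v -> dot z w = dot t w ->
    triple v w z = triple v w t \/ triple v w z = - triple v w t.
  move=> zz zv zw; have : triple v w z ^+ 2 = triple v w t ^+ 2.
    by rewrite !expr2 !tripleM (dotC v z) (dotC w z) (dotC v t) (dotC w t) zz zv zw.
  by move=> /eqP; rewrite eqf_sqr => /orP[]/eqP; [left|right].
have inj z z' : dot z v = dot z' v -> dot z w = dot z' w ->
    triple v w z = triple v w z' -> z = z'.
  move=> zv zw e; apply: (triple_dot_inj (a := v) (b := w) (c := cross v w)) => //.
    by rewrite /triple gt_eqF // dot_gt0.
  by rewrite !(dotC _ (cross v w)).
case: (sq p ppt pv pw) => e; first by left; apply: inj.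
case: (sq p' p't p'v p'w) => e'; first by right; apply: inj.
by case/eqP: pp'; apply: inj; rewrite ?pv ?pw // e e'.
Qed.

Lemma perp_plane u v n : dot n u = 0 -> dot n v = 0 ->
  dot (cross u v) (cross u v) *: n = dot n (cross u v) *: cross u v.
Proof.
move=> nu nv; have := triple_expand u v (cross u v) n.
by rewrite nu nv !scale0r !add0r.
Qed.

Lemma coplanar_triple a b d n : n != 0 -> dot n a = 0 -> dot n b = 0 -> dot n d = 0 ->
  triple a b d = 0.
Proof.
move=> n0 na nb nd; have := triple_expand a b d n.
rewrite na nb nd !scale0r !addr0 => /eqP; rewrite scaler_eq0 (negbTE n0) orbF.
by move/eqP.
Qed.

Lemma rows3_similar (k : R) a b d : dot a a = k -> dot b b = k -> dot d d = k ->
  dot a b = 0 -> dot a d = 0 -> dot b d = 0 ->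
  rows3 a b d *m (rows3 a b d)^T = k%:M.
Proof.
move=> aa bb dd ab ad bd; rewrite rows3_tr (dotC b a) (dotC d a) (dotC d b).
rewrite aa bb dd ab ad bd -[k in RHS]mulr1 -scale_scalar_mx -rows3_1.
by apply/matrixP => -[[|[|[|//]]] ?] -[[|[|[|//]]] ?]; rewrite !mxE /= ?mulr0 ?mulr1.
Qed.

Lemma dot_similar (k : R) (M : 'M[R]_3) x y : M *m M^T = k%:M ->
  dot (x *m M) (y *m M) = k * dot x y.
Proof.
by move=> Mk; rewrite !dot_mx trmx_mul mulmxA -(mulmxA x) Mk mul_mx_scalar -scalemxAl mxE.
Qed.

(* If the part of V already known were not all of V, a further vertex would be
   at the minimal distance or more from all the known ones. *)
Lemma copy_intro V (c k : R) (M : 'M[R]_3) (S : set 'rV[R]_3) : homset V 1 ->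
  (forall x y, x \in V -> y \in V -> x != y -> dot x y <= c) ->
  0 < k -> M *m M^T = k%:M -> (forall p, S p -> p *m M \in V) ->
  (forall p, k * dot p p = 1 -> (forall s, S s -> k * dot p s <= c) -> False) ->
  similar_copy V S.
Proof.
move=> hV c_max k0 Mk SV cover; exists k, M; split=> //; apply/seteqP; split=> [x /= xV|_ [p Sp <-]]; last exact: SV.
have kn0 : k != 0 by rewrite gt_eqF.
pose p := k^-1 *: (x *m M^T).
have pM : p *m M = x.
  have : M^T *m (k^-1 *: M) = 1%:M.
    by apply: mulmx1C; rewrite -scalemxAl Mk scale_scalar_mx mulVf.
  by move=> MM; rewrite /p -scalemxAl -mulmxA scalemxAr scalemxAr MM mulmx1.
apply: contrapT => xS; apply: (cover p) => [|s Ss].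
  by rewrite -(dot_similar p p Mk) pM (hs_norm hV).
rewrite -(dot_similar p s Mk) pM; apply: c_max; rewrite ?SV //.
by apply/eqP => xs; apply: xS; exists s.
Qed.

Lemma ord3P (Q : 'I_3 -> Prop) : Q 0 -> Q 1 -> Q 2 -> forall i, Q i.
Proof.
move=> q0 q1 q2 [[|[|[|//]]] lti].
- by rewrite (_ : Ordinal lti = 0) //; apply: val_inj.
- by rewrite (_ : Ordinal lti = 1) //; apply: val_inj.
- by rewrite (_ : Ordinal lti = 2) //; apply: val_inj.
Qed.

Lemma prod3E (F : 'I_3 -> R) : \prod_i F i = F 0 * F 1 * F 2.
Proof.
rewrite !big_ord_recl big_ord0 mulr1 !mulrA.
by congr (_ * F _ * F _); apply: val_inj.
Qed.

Lemma mul_rows3E p a b d :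
  p *m rows3 a b d = p 0 0 *: a + p 0 1 *: b + p 0 2 *: d.
Proof. by rewrite -{1}(vec3K p) vec3_rows3. Qed.

Definition tetrahedron_vertices : set 'rV[R]_3 :=
  [set p | (forall i, `|p 0 i| = 1) /\ \prod_i p 0 i = 1].

Definition cube_vertices : set 'rV[R]_3 := [set p | forall i, `|p 0 i| = 1].

Definition octahedron_vertices : set 'rV[R]_3 :=
  [set p | exists i, `|p 0 i| = 1 /\ forall j, j != i -> p 0 j = 0].

Definition cuboctahedron_vertices : set 'rV[R]_3 :=
  [set p | exists i, p 0 i = 0 /\ forall j, j != i -> `|p 0 j| = 1].

Definition icosahedron_vertices : set 'rV[R]_3 :=
  [set p | exists i : 'I_3,
    [/\ p 0 i = 0, `|p 0 (i + 1)| = 1 & `|p 0 (i + 2)| = golden_ratio]].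

Lemma ord3_cases (i : 'I_3) : [\/ i = 0, i = 1 | i = 2].
Proof. by move: i; apply: ord3P; [constructor 1|constructor 2|constructor 3]. Qed.

(* On the unit sphere two equal arcs p0 v and w p3 erected on the same side of
   an equally long arc v w at angles of sum at most pi have their free ends
   closer than v and w. *)
Lemma rhombus_dot v w p p' (c t : R) : -1 < c -> c < 1 -> 0 <= t -> t < 1 ->
  dot v v = 1 -> dot w w = 1 -> dot p p = 1 -> dot p' p' = 1 ->
  dot v w = c -> dot v p = c -> dot w p' = c ->
  dot w p = c ^+ 2 + (1 - c ^+ 2) * t ->
  dot v p' = c ^+ 2 + (1 - c ^+ 2) * t \/ dot v p' = c ^+ 2 - (1 - c ^+ 2) * t ->
  0 < triple v w p * triple v w p' -> c < dot p p'.
Proof.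
move=> cN c1 t0 t1 vv ww pp pp' vw vp wp' wp vp' D0.
have s0 : 0 < 1 - c ^+ 2.
  by have -> : 1 - c ^+ 2 = (1 - c) * (1 + c) by [ring]; apply: mulr_gt0; lra.
have sq y (b : R) : dot y y = 1 -> dot v y = c /\ dot w y = b \/ dot v y = b /\ dot w y = c ->
    triple v w y ^+ 2 = (1 - c ^+ 2) ^+ 2 - (b - c ^+ 2) ^+ 2.
  move=> yy [] [vy wy]; rewrite expr2 tripleM vv ww yy vw (dotC w v) (dotC y v) (dotC y w) vw vy wy; ring.
have Dp := sq p _ pp (or_introl (conj vp wp)).
have Dp' : triple v w p' ^+ 2 = (1 - c ^+ 2) ^+ 2 * (1 - t ^+ 2).
  by case: vp' => h; rewrite (sq p' _ pp' (or_intror (conj h wp'))); ring.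
have DD : triple v w p = triple v w p'.
  have : triple v w p ^+ 2 = triple v w p' ^+ 2 by rewrite Dp Dp'; ring.
  move/eqP; rewrite eqf_sqr => /orP[/eqP//|/eqP h]; move: D0; rewrite h mulNr -expr2.
  by have := sqr_ge0 (triple v w p'); lra.
(* The mixed Gram determinant is now known, and it is linear in the only unknown <p, p'>. *)
have := tripleM v w p v w p'; rewrite {1}DD -expr2 Dp' vv ww vw (dotC w v) vw wp' (dotC p v) (dotC p w) vp wp.
set X := dot p p'; set s := 1 - c ^+ 2 in s0 *.
rewrite -subr_gt0 -(pmulr_rgt0 _ s0); case: vp' => -> h.
  have -> : s * (X - c) = s ^+ 2 * ((1 - t) * ((1 - c) + (1 + c) * t)).
    by move: h; rewrite /s; lra.
  by rewrite !mulr_gt0 //; [lra|have : 0 <= (1 + c) * t by [apply: mulr_ge0; lra]; lra].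
have -> : s * (X - c) = s ^+ 2 * ((1 - c) * ((1 - t) * (1 + t))).
  by move: h; rewrite /s; lra.
by rewrite !mulr_gt0 //; lra.
Qed.

(** The triple-angle formula at pi gives 4 t^3 - 3 t + 1 = (t + 1) (2 t - 1)^2 = 0. *)
Lemma cos_pi3 : cos (pi / 3) = 1 / 2 :> R.
Proof.
have pi0 := @pi_gt0 R; set t := cos (pi / 3).
have t0 : 0 < t by apply: cos_gt0_pihalf; apply/andP; split; lra.
have h : cos pi = 4 * t ^+ 3 - 3 * t :> R.
  have -> : pi = pi / 3 *+ 2 + pi / 3 :> R by rewrite mulr2n; field.
  rewrite cosD cos_mulr2n sin_mulr2n -/t.
  have -> : cos (pi / 3) * sin (pi / 3) *+ 2 * sin (pi / 3) =
    t * sin (pi / 3) ^+ 2 *+ 2 by rewrite -/t !mulr2n; ring.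
  by rewrite sin2cos2 -/t !mulr2n; ring.
have /eqP : (t + 1) * (2 * t - 1) ^+ 2 = 0 by move: h; rewrite cospi; lra.
by rewrite mulf_eq0 sqrf_eq0 => /orP[]/eqP; lra.
Qed.

(** For a = 2 pi / 5 the cosines of 2a and 3a agree; the factor t - 1 of the resulting cubic
    equation is removed. *)
Lemma cos_2pi5 : let t : R := cos (2 * pi / 5%:R) in 0 < t /\ 4 * t ^+ 2 + 2 * t = 1.
Proof.
have pi0 := @pi_gt0 R; set a := 2 * pi / 5%:R => t.
have aE : a = 2 * pi / 5 by [].
have t0 : 0 < t by apply: cos_gt0_pihalf; apply/andP; split; rewrite aE; lra.
split=> //; have t1 : t < 1 by apply: cos_lt1; apply/andP; split; rewrite aE; lra.
have h2 : cos (a *+ 2) = 2 * t ^+ 2 - 1 by rewrite cos_mulr2n -/t mulr2n; lra.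
have h3 : cos (a *+ 2 + a) = 4 * t ^+ 3 - 3 * t.
  rewrite cosD h2 sin_mulr2n.
  have -> : cos a * sin a *+ 2 * sin a = t * sin a ^+ 2 *+ 2 by rewrite -/t !mulr2n; lra.
  by rewrite sin2cos2 -/t mulr2n; lra.
have e : cos (a *+ 2 + a) = cos (a *+ 2).
  have -> : a *+ 2 + a = - (a *+ 2) + pi *+ 2 by rewrite aE !mulr2n; field.
  by rewrite cosD2pi cosN.
have /eqP : (t - 1) * (4 * t ^+ 2 + 2 * t - 1) = 0 by move: e; rewrite h2 h3; lra.
by rewrite mulf_eq0 => /orP[]/eqP; lra.
Qed.

(** Here phi is the golden ratio and l its inverse. If p, q, s are the corners of a face, l (p + q)
    - s is the third corner of the other face at the edge p q; unfolding from one face reaches all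
    twelve vertices. *)
Lemma icosahedron_generated (l : R) (phi := 1 + l) (A : 'rV[R]_3 -> Prop) :
  l ^+ 2 = 1 - l -> A (vec3 0 1 phi) -> A (vec3 0 (-1) phi) -> A (vec3 phi 0 1) ->
  (forall p q s, A p -> A q -> A s -> dot p q = phi -> dot p s = phi -> dot q s = phi ->
     A (l *: (p + q) - s)) ->
  forall a b : R, a = 1 \/ a = -1 -> b = phi \/ b = - phi ->
    A (vec3 0 a b) /\ A (vec3 b 0 a) /\ A (vec3 a b 0).
Proof.
move=> l2 a1 a2 a3 step0.
have pp : phi * phi = phi + 1 by rewrite /phi; lra.
have lp : l * phi = 1 by rewrite /phi; lra.
have step (p q s y : 'rV[R]_3) : A p -> A q -> A s -> dot p q = phi -> dot p s = phi ->
    dot q s = phi -> (forall i, y 0 i = l * (p 0 i + q 0 i) - s 0 i) -> A y.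
  move=> Ap Aq As pq ps qs yE; have -> : y = l *: (p + q) - s.
    by apply/rowP => i; rewrite yE !mxE.
  exact: step0.
have lE : l = phi - 1 by rewrite /phi; ring.
clearbody phi.
have b1 : A (vec3 (- phi) 0 1).
  by apply: (step _ _ _ _ a1 a2 a3); last apply: ord3P; rewrite ?dot3E !vec3E; lra.
have b2 : A (vec3 1 phi 0).
  by apply: (step _ _ _ _ a1 a3 a2); last apply: ord3P; rewrite ?dot3E !vec3E; lra.
have b3 : A (vec3 (-1) phi 0).
  by apply: (step _ _ _ _ a1 b1 a2); last apply: ord3P; rewrite ?dot3E !vec3E; lra.
have b4 : A (vec3 1 (- phi) 0).
  by apply: (step _ _ _ _ a2 a3 a1); last apply: ord3P; rewrite ?dot3E !vec3E; lra.
have b5 : A (vec3 (-1) (- phi) 0).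
  by apply: (step _ _ _ _ a2 b1 a1); last apply: ord3P; rewrite ?dot3E !vec3E; lra.
have b6 : A (vec3 phi 0 (-1)).
  by apply: (step _ _ _ _ a3 b2 a1); last apply: ord3P; rewrite ?dot3E !vec3E; lra.
have b7 : A (vec3 (- phi) 0 (-1)).
  by apply: (step _ _ _ _ b1 b3 a1); last apply: ord3P; rewrite ?dot3E !vec3E; lra.
have b8 : A (vec3 0 1 (- phi)).
  by apply: (step _ _ _ _ b2 b3 a1); last apply: ord3P; rewrite ?dot3E !vec3E; lra.
have b9 : A (vec3 0 (-1) (- phi)).
  by apply: (step _ _ _ _ b4 b5 a2); last apply: ord3P; rewrite ?dot3E !vec3E; lra.
by move=> a b [->|->] [->|->].
Qed.

(** The vertices lie on three golden rectangles in the coordinate planes. On each, the inequalities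
    bound |a + b phi| and |a - b phi| by phi; averaging the squares gives a^2 + b^2 phi^2 <= phi^2,
    and the three results are added. *)
Lemma icosahedron_bound (phi p0 p1 p2 : R) :
  (forall a b : R, `|a| = 1 -> `|b| = phi -> [/\ p1 * a + p2 * b <= phi,
    p2 * a + p0 * b <= phi & p0 * a + p1 * b <= phi]) -> 0 < phi ->
  (p0 ^+ 2 + p1 ^+ 2 + p2 ^+ 2) * (1 + phi ^+ 2) <= 3 * phi ^+ 2.
Proof.
move=> inP phi0.
have [I1 N1] := (normr1 R, normrN1 R).
have Ip : `|phi| = phi by rewrite ger0_norm // ltW.
have Np : `|- phi| = phi by rewrite normrN.
have sq (a b : R) : (forall e f : R, `|e| = 1 -> `|f| = phi -> a * e + b * f <= phi) ->
    a ^+ 2 + b ^+ 2 * phi ^+ 2 <= phi ^+ 2.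
  move=> h; have h1 := h _ _ I1 Ip; have h2 := h _ _ N1 Np.
  have h3 := h _ _ I1 Np; have h4 := h _ _ N1 Ip.
  have : 0 <= (phi - (a + b * phi)) * (phi + (a + b * phi)) by apply: mulr_ge0; lra.
  have : 0 <= (phi - (a - b * phi)) * (phi + (a - b * phi)) by apply: mulr_ge0; lra.
  by lra.
have q1 : p1 ^+ 2 + p2 ^+ 2 * phi ^+ 2 <= phi ^+ 2.
  by apply: sq => e f he hf; case: (inP e f he hf).
have q2 : p2 ^+ 2 + p0 ^+ 2 * phi ^+ 2 <= phi ^+ 2.
  by apply: sq => e f he hf; case: (inP e f he hf).
have q3 : p0 ^+ 2 + p1 ^+ 2 * phi ^+ 2 <= phi ^+ 2.
  by apply: sq => e f he hf; case: (inP e f he hf).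
by lra.
Qed.

End Copies.

(** * Nearest neighbors in the irreducible case *)

Section Neighbors.
Context {R : realType}.
Implicit Types (a b d u v w x y z p : 'rV[R]_3) (g : 'M[R]_3).
Variable V : seq 'rV[R]_3.
Hypotheses (hV : homset V 1) (irrV : irreducible V).
Variable c : R.
Hypothesis c_max : forall x y, x \in V -> y \in V -> x != y -> dot x y <= c.
Hypothesis c_pair : exists v w, [/\ v \in V, w \in V, v != w & dot v w = c].

Definition nbrs v := [seq w <- V | dot v w == c].

Local Notation N := nbrs.

Lemma in_nbrs v w : (w \in N v) = (dot v w == c) && (w \in V).
Proof. by rewrite mem_filter. Qed.

Lemma nbrsP {v w} : reflect (w \in V /\ dot v w = c) (w \in N v).
Proof. by rewrite in_nbrs andbC; apply: (iffP andP) => -[? /eqP]. Qed.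

Lemma nbrsC v w : v \in V -> w \in N v -> v \in N w.
Proof. by move=> vV /nbrsP[wV e]; apply/nbrsP; rewrite dotC. Qed.

Lemma unit_neq_dot x y : x \in V -> y \in V -> x != y -> dot x y < 1.
Proof.
move=> xV yV xy; have : 0 < dot (x - y) (x - y) by rewrite dot_gt0 // subr_eq0.
by rewrite dot_subE !(hs_norm hV) //; lra.
Qed.

Lemma c_lt1 : c < 1.
Proof. by have [v [w [vV wV vw <-]]] := c_pair; apply: unit_neq_dot. Qed.

Lemma c_gtN1 : -1 < c.
Proof.
have [v [_ [vV _ _ _]]] := c_pair.
have [w [x [wV xV t0]]] := hs_basis hV vV.
have n0 : cross v w != 0 by apply: contraNneq t0 => e; rewrite /triple e dot0l.
have := dot_gt0 n0; rewrite dot_cross !(hs_norm hV) // (dotC w v).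
have vw : v != w.
  by apply: contraNneq n0 => <-; apply/eqP/dot_eq0; rewrite dot_cross subrr.
by have := c_max vV wV vw; nra.
Qed.

Lemma nbrs_cross v w : v \in V -> w \in N v -> cross v w != 0.
Proof.
move=> vV /nbrsP[wV e]; apply/eqP => n0; have := dot_cross v w v w.
rewrite n0 dot0l !(hs_norm hV) // (dotC w v) e => h.
by have := c_lt1; have := c_gtN1; nra.
Qed.

Lemma nbrs_sym g v w : is_sym V g -> w \in N v -> w *m g \in N (v *m g).
Proof. by move=> [og gV] /nbrsP[wV e]; apply/nbrsP; rewrite dot_mulmx // gV. Qed.

Lemma nbrs_uniq v : uniq (N v).
Proof. by rewrite filter_uniq // (hs_uniq hV). Qed.

Lemma nbrs_size v v' : v \in V -> v' \in V -> size (N v) = size (N v').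
Proof.
suff le x y : x \in V -> y \in V -> (size (N x) <= size (N y))%N.
  by move=> vV vV'; apply/eqP; rewrite eqn_leq !le.
move=> xV yV; have [g sg [xg _]] := hs_swap hV xV yV.
rewrite -(size_map (fun z => z *m g)); apply: uniq_leq_size.
  by rewrite map_inj_uniq ?nbrs_uniq //; apply: orth_inj; case: sg.
by move=> _ /mapP[w wN ->]; rewrite -xg; apply: nbrs_sym.
Qed.

Lemma nbrs_perm g v : is_sym V g -> v *m g = v ->
  perm_eq [seq x *m g | x <- N v] (N v).
Proof.
move=> sg vg; have uM : uniq [seq x *m g | x <- N v].
  by rewrite map_inj_uniq ?nbrs_uniq //; apply: orth_inj; case: sg.
apply: uniq_perm (nbrs_uniq v) _ => //.
have [] := uniq_min_size uM (s2 := N v); rewrite ?size_map //.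
by move=> _ /mapP[x xN ->]; rewrite -vg; apply: nbrs_sym.
Qed.

Lemma nbrs_sum v : v \in V -> \sum_(w <- N v) w = ((size (N v))%:R * c) *: v.
Proof.
move=> vV; have [l lE] : exists l, \sum_(w <- N v) w = l *: v.
  apply: (irreducible_fix hV irrV vV) => g sg vg.
  rewrite mulmx_suml -[RHS](perm_big _ (nbrs_perm sg vg)).
  by rewrite big_map.
rewrite lE; congr (_ *: _); have := congr1 (dot^~ v) lE.
rewrite dotZl (hs_norm hV vV) mulr1 => <-; rewrite dot_suml.
rewrite (eq_big_seq (fun=> c)) => [|w /nbrsP[_]]; last by rewrite dotC.
by rewrite big_const_seq count_predT iter_addr_0 mulr_natl.
Qed.

Lemma nbrs_nonempty v : v \in V -> exists w, w \in N v.
Proof.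
move=> vV; have [v' [w [v'V wV _ e]]] := c_pair.
have : (0 < size (N v))%N.
  rewrite (nbrs_size vV v'V); suff : w \in N v' by case: nbrs.
  exact/nbrsP.
by case: (N v) => // x s _; exists x; rewrite mem_head.
Qed.

Lemma nbrs_gt1 v : v \in V -> (1 < size (N v))%N.
Proof.
move=> vV; have [w wN] := nbrs_nonempty vV; have := nbrs_sum vV.
case E: (N v) wN => [|w' [|//]] //= _.
rewrite big_seq1 mul1r => e; have w'N : w' \in N v by rewrite E mem_head.
by have := nbrs_cross vV w'N; rewrite e; case/eqP; apply: rV3P; rewrite !mxE /= ?mxE; ring.
Qed.

Lemma nbrs2 v w : size (N v) = 2 -> v \in V -> w \in N v ->
  (2 * c) *: v - w \in N v /\ {in N v, forall y, y = w \/ y = (2 * c) *: v - w}.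
Proof.
move=> s2 vV wN; have := nbrs_sum vV; rewrite s2.
case E: (N v) s2 wN => [|a [|b [|//]]] //= _.
rewrite !big_cons big_nil addr0 !inE => /orP[]/eqP -> <-.
  rewrite addrC addKr eqxx orbT; split=> // y.
  by rewrite !inE => /orP[]/eqP->; [left|right].
rewrite addrK eqxx; split=> // y.
by rewrite !inE => /orP[]/eqP->; [right|left].
Qed.

(* With two neighbors each, the nearest-neighbor paths are great-circle
   polygons; two great circles meet, and near their intersection vertices of
   different circles would be too close. *)
Lemma nbrs_neq2 v : v \in V -> size (N v) <> 2.
Proof.
move=> vV s2; have sz x : x \in V -> size (N x) = 2.
  by move=> xV; rewrite (nbrs_size xV vV).
have [w wN] := nbrs_nonempty vV; set n := cross v w.
have n0 : n != 0 by apply: nbrs_cross wN.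
have [x xV xn] := hs_exists_out hV n0.
have [x' x'N] := nbrs_nonempty xV; set m := cross x x'.
have m0 : m != 0 by apply: nbrs_cross x'N.
have cc := c_lt1; have cN := c_gtN1.
(* The vertices in the plane orthogonal to k whose neighbors also lie there. As the two neighbors of
   y sum to 2c y, this set is closed under passing to a neighbor and contains whole paths. *)
pose E k := [seq y <- V | (dot k y == 0) && all (fun z => dot k z == 0) (N y)].
have EP k y : y \in E k -> [/\ y \in V, dot k y = 0 & {in N y, forall z, dot k z = 0}].
  rewrite mem_filter => /andP[/andP[/eqP ky /allP kz] yV]; split=> // z /kz.
  by move/eqP.
have Estep k y y' : y \in E k -> y' \in N y -> y' \in E k.
  move=> /EP[yV ky kN] y'N; have [y'V _] := nbrsP y'N.
  rewrite mem_filter y'V andbT kN // eqxx; apply/allP => z zN.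
  have [_ /(_ _ zN)] := nbrs2 (sz _ y'V) y'V (nbrsC yV y'N).
  by case=> ->; rewrite ?dotE ?ky ?(kN _ y'N) ?mulr0 ?subr0 eqxx.
have E0 y y' : y \in V -> y' \in N y -> y \in E (cross y y').
  move=> yV y'N; rewrite mem_filter yV andbT dot_crossl eqxx /=; apply/allP => z zN.
  have [_ /(_ _ zN)] := nbrs2 (sz _ yV) yV y'N.
  by case=> ->; rewrite ?dotE ?dot_crossl ?dot_crossr ?mulr0 ?subr0 eqxx.
have vE := E0 _ _ vV wN; have xE := E0 _ _ xV x'N; rewrite -/n in vE; rewrite -/m in xE.
set z := cross n m.
(* Were n and m parallel, x would lie in the plane orthogonal to n. *)
have z0 : z != 0.
  apply/eqP => z0; have := dot_cross n m n m; rewrite -/z z0 dot0l => e.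
  have e2 : dot n n *: m = dot n m *: n.
    apply/eqP; rewrite -subr_eq0; apply/eqP/dot_eq0; rewrite !dotE (dotC m n).
    rewrite (dotC m n) in e.
    transitivity (dot n n * (dot n n * dot m m - dot n m * dot n m)); first by ring.
    by rewrite -e mulr0.
  have := congr1 (dot x) e2; rewrite !dotZr [dot x m]dotC dot_crossl mulr0 => /esym/eqP.
  rewrite mulf_eq0 (negbTE xn) orbF => /eqP nm.
  move/eqP: e2; rewrite nm scale0r scaler_eq0 (negbTE m0) orbF => /eqP /dot_eq0 n00.
  by move: n0; rewrite n00 eqxx.
have zz := dot_gt0 z0.
(* Take p with the largest product with z. Neither neighbor p' nor 2c p - p' exceeds it, and the
   Gram determinant of the coplanar p, p', z vanishes. Hence p is within half an edge of the
   direction of z: (1 + c) / 2 is the squared cosine of half an edge. *)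
have near k y0 : k != 0 -> dot k z = 0 -> y0 \in E k ->
    exists2 p, p \in E k & 0 < dot p z /\ (1 + c) * dot z z <= 2 * dot p z ^+ 2.
  move=> k0 kz y0E; have [p pE pmax] := seq_argmax (dot^~ z) y0E.
  exists p => //; have [pV kp kN] := EP _ _ pE.
  have [p' p'N] := nbrs_nonempty pV; have [p''N _] := nbrs2 (sz _ pV) pV p'N.
  have h1 := pmax _ (Estep _ _ _ pE p'N); have := pmax _ (Estep _ _ _ pE p''N).
  have [p'V pp'] := nbrsP p'N.
  have := tripleM p p' z p p' z.
  rewrite (coplanar_triple k0 kp (kN _ p'N) kz) mul0r (dotC p' p) (dotC z p) (dotC z p').
  rewrite !dotE (hs_norm hV pV) (hs_norm hV p'V) pp'; set A := dot p z in h1 *; set B := dot p' z in h1 *.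
  set Z := dot z z in zz * => gram h2.
  have gram' : Z * (1 - c ^+ 2) = A ^+ 2 + B ^+ 2 - 2 * c * A * B by move: gram; lra.
  have A0 : 0 <= A by move: h1 h2; nra.
  have hB : (A - B) * (B - (2 * c - 1) * A) >= 0 by apply: mulr_ge0; move: h1 h2; lra.
  have key : (1 - c) * ((1 + c) * Z) <= (1 - c) * (2 * A ^+ 2) by move: gram' hB; lra.
  have key' : (1 + c) * Z <= 2 * A ^+ 2 by move: key; rewrite ler_pM2l //; lra.
  split=> //; rewrite lt_neqAle A0 andbT; apply/eqP => A00.
  by have : 0 < (1 + c) * Z by [apply: mulr_gt0 => //; lra]; move: key'; rewrite -A00; lra.
have [p pE [pz pZ]] := near n v n0 (dot_crossn n m) vE.
have [y yE [yz yZ]] := near m x m0 (etrans (dotC _ _) (dot_crossr n m)) xE.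
have [pV _ _] := EP _ _ pE; have [yV my mN] := EP _ _ yE.
(* Two points within half an edge of z are within an edge of each other; a smaller product would
   make the Gram determinant of p, y, z negative. *)
have py : c <= dot p y.
  rewrite leNgt; apply/negP => lt; have : 0 <= triple p y z * triple p y z.
    by rewrite -expr2 sqr_ge0.
  rewrite tripleM (hs_norm hV pV) (hs_norm hV yV) (dotC y p) (dotC z p) (dotC z y).
  set D := dot p y in lt *; set A := dot p z in pz pZ *; set B := dot y z in yz yZ *.
  set Z := dot z z in zz pZ yZ * => gram.
  have AB : (1 + c) * Z <= 2 * (A * B).
    rewrite -(@ler_pXn2r _ 2) ?nnegrE //; [|by rewrite mulr_ge0 //; lra|].
      have -> : (2 * (A * B)) ^+ 2 = (2 * A ^+ 2) * (2 * B ^+ 2) by ring.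
      by rewrite expr2 ler_pM // mulr_ge0 //; lra.
    by rewrite !mulr_ge0 // ltW.
  have f1 : (D - c) * (Z * (D + c) - 2 * (A * B)) > 0.
    rewrite nmulr_rgt0; last lra.
    have : Z * (D + c) < Z * (1 + c) by rewrite ltr_pM2l //; lra.
    by move: AB; rewrite (mulrC Z (1 + c)); lra.
  have f2 : 0 <= A ^+ 2 + B ^+ 2 - 2 * c * (A * B) - Z * (1 - c ^+ 2).
    have : 0 <= (A - B) ^+ 2 := sqr_ge0 _.
    have : 0 <= (1 - c) * (2 * (A * B) - (1 + c) * Z) by apply: mulr_ge0; lra.
    by lra.
  by move: gram f1 f2; lra.
have yE' : y \in E n.
  have [<-//|pny] := eqVneq p y; apply: Estep pE _; apply/nbrsP; split=> //.
  by apply/le_anti; rewrite py (c_max pV yV pny).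
(* Now y and y' span both planes, so n and m are parallel. *)
have [_ ny nN] := EP _ _ yE'; have [y' y'N] := nbrs_nonempty yV.
have k0 := nbrs_cross yV y'N; set k := cross y y' in k0.
have pn := perp_plane ny (nN _ y'N); have pm := perp_plane my (mN _ y'N).
have mk : dot m k != 0.
  apply/eqP => mk; move/eqP: pm; rewrite -/k mk scale0r scaler_eq0 (negbTE m0) orbF.
  by rewrite gt_eqF // dot_gt0.
have kx : dot k x = 0.
  have := congr1 (dot^~ x) pm; rewrite !dotZl dot_crossl mulr0 => /esym/eqP.
  by rewrite mulf_eq0 (negbTE mk) => /eqP.
have := congr1 (dot^~ x) pn; rewrite !dotZl -/k kx mulr0 => /eqP.
by rewrite mulf_eq0 (dotC n) (negbTE xn) orbF gt_eqF // dot_gt0.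
Qed.

Lemma sqr_c_lt1 : 0 < 1 - c ^+ 2.
Proof.
have c1 := c_lt1; have cN := c_gtN1.
by have -> : 1 - c ^+ 2 = (1 - c) * (1 + c) by [ring]; apply: mulr_gt0; lra.
Qed.

Let r := Num.sqrt (1 - c ^+ 2).

Lemma nbrs_radius : 0 < r /\ r ^+ 2 = 1 - c ^+ 2.
Proof.
by have s0 := sqr_c_lt1; rewrite sqrtr_gt0 sqr_sqrtr // ltW.
Qed.

Lemma nbrs_circle v w : v \in V -> w \in N v -> (2 < size (N v))%N ->
  exists e1 e2, [/\ frame e1 e2 v, w = c *: v + r *: e1 &
    (let C := [seq pcoord r e1 e2 x | x <- N v] in
      (forall z : R[i], (z \in C) = (z ^+ size (N v) == 1)) \/
      (exists y : R[i], [/\ y ^+ 2 != 1, y ^+ 2 != -1, size (N v) = 4 & C =i [:: 1; -1; y; - y]]))].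
Proof.
move=> vV wN s2; have [r0 rr] := nbrs_radius.
apply: (circle_level (nbrs_uniq _) wN s2 (hs_norm hV vV) (q := 1)) => //.
  by move=> x /nbrsP[xV vx]; rewrite dotC vx (hs_norm hV).
move=> x y /nbrsP[xV vx] /nbrsP[yV vy].
have [g sg [vg xg yg]] := hs_fix_swap hV vV xV yV (etrans vx (esym vy)).
by exists g; split=> //; [exact: sg.1|move=> z zN; rewrite -vg; apply: nbrs_sym].
Qed.

(** By [rhombus_dot] the vertices p and p' have a product above c, so they coincide, and p is a
    neighbor of w as well. *)
Lemma nbr_triangle v w p p' (t : R) : v \in V -> w \in N v -> p \in N v -> p' \in N w ->
  0 <= t -> t < 1 -> dot w p = c ^+ 2 + (1 - c ^+ 2) * t ->
  dot v p' = c ^+ 2 + (1 - c ^+ 2) * t \/ dot v p' = c ^+ 2 - (1 - c ^+ 2) * t ->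
  0 < triple v w p * triple v w p' -> dot w p = c.
Proof.
move=> vV wN pN p'N t0 t1 wp vp' D0.
have c1 := c_lt1; have cN := c_gtN1.
have [wV vw] := nbrsP wN; have [pV vp] := nbrsP pN.
have [p'V wp'] := nbrsP p'N.
have := rhombus_dot cN c1 t0 t1 (hs_norm hV vV) (hs_norm hV wV) (hs_norm hV pV)
  (hs_norm hV p'V) vw vp wp' wp vp' D0.
have [->//|pp'] := eqVneq p p'.
by rewrite ltNge c_max.
Qed.

(** Square or rectangle, the four neighbors form two antipodal pairs of their circle, and the
    antipode of w is 2c v - w. *)
Lemma nbrs4 v w : v \in V -> w \in N v -> size (N v) = 4 ->
  (2 * c) *: v - w \in N v /\
  exists x, [/\ x \in N v, (2 * c) *: v - x \in N v, x != w & x != (2 * c) *: v - w].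
Proof.
move=> vV wN s4; have s2 : (2 < size (N v))%N by rewrite s4.
have [e1 [e2 [f wE alt]]] := nbrs_circle vV wN s2.
have [r0 rr] := nbrs_radius; have rn0 : r != 0 by rewrite gt_eqF.
set C := map _ _ in alt; have [y [yy CE]] : exists y : R[i], y ^+ 2 != 1 /\ {subset [:: 1; -1; y; - y] <= C}.
  case: alt => [h|[y [y1 _ _ CE]]]; last by exists y; split=> // z; rewrite CE.
  exists 'i%C; rewrite sqr_i; split; first by rewrite eq_sym -subr_eq0 opprK -mulr2n pnatr_eq0.
  move=> z; rewrite !inE => /or4P[]/eqP ->; rewrite h s4 ?expr1n //.
  - by apply/eqP; ring.
  - have -> : ('i%C : R[i]) ^+ 4 = ('i%C ^+ 2) ^+ 2 by ring.
    by rewrite sqr_i; apply/eqP; ring.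
  have -> : (- 'i%C : R[i]) ^+ 4 = ('i%C ^+ 2) ^+ 2 by ring.
  by rewrite sqr_i; apply/eqP; ring.
have pc (z : R[i]) : z \in C -> exists2 x, x \in N v &
    x = c *: v + r *: ((Re z : R) *: e1 + (Im z : R) *: e2).
  move=> /mapP[x xN ->]; exists x => //; rewrite {1}(pcoord_expand r0 f x).
  by have [_ <-] := nbrsP xN; rewrite (dotC v).
have opp (z : R[i]) x x' : x = c *: v + r *: ((Re z : R) *: e1 + (Im z : R) *: e2) ->
    x' = c *: v + r *: ((Re (- z) : R) *: e1 + (Im (- z) : R) *: e2) ->
    x' = (2 * c) *: v - x.
  by case: z => a b /= -> ->; row_ring.
have wE1 : w = c *: v + r *: ((Re (1 : R[i]) : R) *: e1 + (Im (1 : R[i]) : R) *: e2).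
  by rewrite /= scale1r scale0r addr0.
have [w' w'N w'E] := pc (-1) ltac:(by apply: CE; rewrite !inE eqxx orbT).
have [x xN xE] := pc y ltac:(by apply: CE; rewrite !inE eqxx !orbT).
have [x' x'N x'E] := pc (- y) ltac:(by apply: CE; rewrite !inE eqxx !orbT).
have inj (z z' : R[i]) : c *: v + r *: ((Re z : R) *: e1 + (Im z : R) *: e2) =
    c *: v + r *: ((Re z' : R) *: e1 + (Im z' : R) *: e2) -> z = z'.
  move=> /addrI /(scalerI rn0) h; have [e11 e22 _ [e12 _ _]] := f.
  apply/eqP; rewrite eq_complex; apply/andP; split; apply/eqP.
    by have := congr1 (dot^~ e1) h; rewrite !dotE e11 (dotC e2) e12 !mulr0 !addr0 !mulr1.
  by have := congr1 (dot^~ e2) h; rewrite !dotE e22 e12 !mulr0 !add0r !mulr1.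
rewrite -(opp _ _ _ wE1 w'E); split=> //; exists x; rewrite -(opp _ _ _ xE x'E); split=> //.
  by apply: contra yy => /eqP; rewrite wE1 {1}xE => /inj ->; rewrite expr1n.
by apply: contra yy => /eqP; rewrite w'E {1}xE => /inj ->; rewrite sqrrN expr1n.
Qed.

(** A rectangle has only four points, so the neighbors form a regular polygon; x and x' are the
    corners next to w. *)
Lemma deg_ge5_nbrs v w (a := 2 * pi / (size (N v))%:R : R) : v \in V -> w \in N v ->
  (4 < size (N v))%N ->
  exists x x', [/\ x \in N v, x' \in N v, x != x',
    dot w x = c ^+ 2 + (1 - c ^+ 2) * cos a & dot w x' = c ^+ 2 + (1 - c ^+ 2) * cos a].
Proof.
move=> vV wN s4; have s2 : (2 < size (N v))%N by apply: leq_trans s4.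
have s0 : (0 < size (N v))%N by apply: leq_trans s4.
have [e1 [e2 [f wE alt]]] := nbrs_circle vV wN s2.
have [r0 rr] := nbrs_radius.
have rn0 : r != 0 by rewrite gt_eqF.
have {}alt : forall z : R[i], z ^+ size (N v) = 1 -> z \in [seq pcoord r e1 e2 x | x <- N v].
  case: alt => [h z zn|[y [_ _ sz _]]]; first by rewrite h zn.
  by move: s4; rewrite sz.
have a1 : cis a ^+ size (N v) = 1 by apply: prim_expr_order; apply: cis_prim.
have a2 : cis (- a) ^+ size (N v) = 1.
  by rewrite -[LHS]mul1r -{1}a1 -exprMn -cisD subrr cis0 expr1n.
have pi0 := @pi_gt0 R.
have k5 : 5 <= (size (N v))%:R :> R by rewrite (ler_nat R 5).
have a0 : 0 < a by rewrite divr_gt0 // ?mulr_gt0 //; lra.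
have api : a < pi by rewrite ltr_pdivrMr; [nra|lra].
have sa : 0 < sin a by apply: sin_gt0_pi; rewrite a0.
have [e11 e22 vv [e12 e1v e2v]] := f.
have dw x (z : R[i]) : x \in N v -> z = pcoord r e1 e2 x ->
    dot w x = c ^+ 2 + (1 - c ^+ 2) * (Re z : R).
  move=> xN ->; have [xV vx] := nbrsP xN.
  by rewrite wE !dotE vx /= (dotC e1) -rr; field.
have /mapP[x xN xE] := alt _ a1; have /mapP[x' x'N x'E] := alt _ a2.
exists x, x'; split=> //.
- apply/eqP => xx; move: xE; rewrite xx -x'E => -[_]; rewrite sinN; lra.
- by rewrite (dw _ _ xN xE).
by rewrite (dw _ _ x'N x'E) /= cosN.
Qed.

(** Adjacent neighbors would be seen from v at an angle of at most pi / 3, so their product would be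
    at least c^2 + (1 - c^2) / 2, which exceeds c by (1 - c)^2 / 2. *)
Lemma deg_lt6 v : v \in V -> (size (N v) < 6)%N.
Proof.
move=> vV; rewrite ltnNge; apply/negP => s6.
have [w wN] := nbrs_nonempty vV.
have [x [x' [xN x'N xx' wx wx']]] := deg_ge5_nbrs vV wN (leq_trans (isT : (4 < 6)%N) s6).
have c1 := c_lt1; have cN := c_gtN1.
have [wV _] := nbrsP wN.
have [y [yN wy yE]] : exists y, [/\ y \in N v, w != y &
    dot w y = c ^+ 2 + (1 - c ^+ 2) * cos (2 * pi / (size (N v))%:R)].
  have [wx0|wx0] := eqVneq w x; last by exists x.
  by exists x'; split=> //; rewrite wx0.
have [yV _] := nbrsP yN.
have := c_max wV yV wy; rewrite yE; set a := 2 * pi / _.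
have : cos (pi / 3) <= cos a.
  have pi0 := @pi_gt0 R.
  have k6 : 6 <= (size (N v))%:R :> R by rewrite (ler_nat R 6).
  have a0 : 0 < a by rewrite divr_gt0 // ?mulr_gt0 //; lra.
  have a3 : a <= pi / 3 by rewrite ler_pdivrMr; [nra|lra].
  rewrite leNgt ltr_cos ?in_itv /= -?leNgt //; apply/andP; split; lra.
rewrite cos_pi3 => t1 h.
have : 0 <= (cos a - 1 / 2) * ((1 - c) * (1 + c)) by apply: mulr_ge0; [|apply: mulr_ge0]; lra.
have : 0 < (1 - c) * (1 - c) by apply: mulr_gt0; lra.
by lra.
Qed.

(** * Three neighbors: tetrahedron and cube *)

Section Degree3.
Hypothesis deg3 : forall v, v \in V -> size (N v) = 3.

(** For neighbors w and x of v, the mirror image of x in the plane bisecting v and w is x - mu (v -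
    w): the factor is <x, v - w> / (1 - c), with <w, x> taken from [deg3_dot]. *)
Let mu := (3 * c + 1) / 2.

Lemma deg3_nbrs v w x : v \in V -> w \in N v -> x \in N v -> w != x ->
  exists y, [/\ w != y, x != y, w + x + y = (3 * c) *: v &
    forall z, (z \in N v) = (z \in [:: w; x; y])].
Proof.
move=> vV wN xN wx; have uN : uniq (N v) := nbrs_uniq _.
have uNw := rem_uniq w uN; have xr : x \in rem w (N v) by rewrite mem_rem_uniq // !inE eq_sym wx.
have p1 := perm_to_rem wN; have p2 := perm_to_rem xr.
have s3 : size (N v) = 3 := deg3 vV.
have p3 : perm_eq (N v) [:: w, x & rem x (rem w (N v))].
  by apply: (perm_trans p1); rewrite perm_cons.
have := perm_size p3; rewrite s3 /=; case E: rem => [|y [|//]] // _.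
rewrite E in p3; exists y; have := uN; rewrite (perm_uniq p3) /= !inE !negb_or.
case/andP => /andP[_ wy] /andP[xy _]; split=> //; last first.
  by move=> z; rewrite (perm_mem p3).
have := nbrs_sum vV; rewrite s3 => <-.
by rewrite (perm_big _ p3) !big_cons big_nil /= addr0 addrA.
Qed.

(** A symmetry that fixes v and exchanges two neighbors fixes the third, so the mutual products are
    equal; pairing w with w + x + y = 3c v gives their value. *)
Lemma deg3_dot v w x : v \in V -> w \in N v -> x \in N v -> w != x ->
  dot w x = (3 * c ^+ 2 - 1) / 2.
Proof.
move=> vV wN xN wx; have [y [wy xy wxy Nv]] := deg3_nbrs vV wN xN wx.
have yN : y \in N v by rewrite Nv !inE eqxx !orbT.
have [wV vw] := nbrsP wN; have [xV vx] := nbrsP xN.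
have [yV vy] := nbrsP yN.
have fixthird a b d : a \in V -> b \in V -> dot v a = c -> dot v b = c -> d != a -> d != b ->
    N v =i [:: a; b; d] -> dot a d = dot b d.
  move=> aV bV va vb da db Nabd.
  have [g sg [vg ag bg]] := hs_fix_swap hV vV aV bV (etrans va (esym vb)).
  have dN : d \in N v by rewrite Nabd !inE eqxx !orbT.
  have : d *m g \in N v by rewrite -vg; apply: nbrs_sym.
  rewrite Nabd !inE => /or3P[]/eqP dg.
  - by case/eqP: db; apply: (orth_inj sg.1); rewrite dg bg.
  - by case/eqP: da; apply: (orth_inj sg.1); rewrite dg ag.
  by rewrite -(dot_mulmx a d sg.1) ag dg.
have e1 : dot w y = dot x y by apply: fixthird; rewrite // eq_sym.
have e2 : dot w x = dot y x.
  apply: fixthird; rewrite // 1?eq_sym // => z; rewrite Nv !inE.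
  by congr (_ || _); rewrite orbC.
have := congr1 (dot w) wxy; rewrite !dotE (hs_norm hV wV) (dotC w v) vw.
by rewrite e2 (dotC y x) -e1 => h; lra.
Qed.

(** A symmetry exchanging v and w sends x and y to neighbors of w. These and the mirror image of x
    have the same norm and the same products with v and w, so [mirror_two] identifies the image with
    one of them. *)
Lemma deg3_step v w x : v \in V -> w \in N v -> x \in N v -> w != x ->
  x - mu *: (v - w) \in N w.
Proof.
move=> vV wN xN wx; have wx' := deg3_dot vV wN xN wx.
have [wV vw] := nbrsP wN; have [xV vx] := nbrsP xN.
have [y [wy xy _ Nv]] := deg3_nbrs vV wN xN wx.
have yN : y \in N v by rewrite Nv !inE eqxx !orbT.
have wy' := deg3_dot vV wN yN wy.
have [yV vy] := nbrsP yN.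
have [g sg [vg wg]] := hs_swap hV vV wV.
have xgN : x *m g \in N w by rewrite -{1}vg; apply: nbrs_sym.
have ygN : y *m g \in N w by rewrite -{1}vg; apply: nbrs_sym.
have [t tE] : exists t, t = x - mu *: (v - w) by eexists.
rewrite -tE.
have [wx1 [wv xv]] : dot x w = (3 * c ^+ 2 - 1) / 2 /\ dot w v = c /\ dot x v = c.
  by rewrite (dotC x) (dotC w v) (dotC x v).
have [vv ww xx] : [/\ dot v v = 1, dot w w = 1 & dot x x = 1] by rewrite !(hs_norm hV).
have tt1 : dot t t = 1.
  by rewrite tE !dotE vv ww xx vw wv wx' wx1 vx xv /mu; field.
have tw : dot t w = c by rewrite tE !dotE ww vw wx1 /mu; field.
have tv : dot t v = (3 * c ^+ 2 - 1) / 2 by rewrite tE !dotE vv wv xv /mu; field.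
have [xgV wxg] := nbrsP xgN; have [ygV wyg] := nbrsP ygN.
have xgv : dot (x *m g) v = (3 * c ^+ 2 - 1) / 2 by rewrite -wg dot_mulmx ?sg.1.
have ygv : dot (y *m g) v = (3 * c ^+ 2 - 1) / 2.
  by rewrite -wg dot_mulmx ?sg.1 // dotC.
have tor : t = x *m g \/ t = y *m g; last by case: tor => ->.
apply: (@mirror_two R w v); rewrite ?tt1 ?tw ?tv ?(hs_norm hV) //.
- by rewrite crossC oppr_eq0; exact: nbrs_cross vV wN.
- by apply: contra xy => /eqP /(orth_inj sg.1) ->.
- by rewrite dotC.
- by rewrite dotC.
Qed.

Lemma deg3_vertex : exists v w x, [/\ v \in V, w \in N v, x \in N v & w != x].
Proof.
have [v vV] := hs_nonempty hV; have [w wN] := nbrs_nonempty vV.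
have [x xN wx] : exists2 x, x \in N v & w != x.
  have s3 := deg3 vV; apply/hasP; rewrite -[has _ _]negbK; apply/negP => /hasPn h.
  have : {subset N v <= [:: w]} by move=> z /h; rewrite negbK inE eq_sym.
  by move/(uniq_leq_size (nbrs_uniq _)); rewrite s3.
by exists v, w, x.
Qed.

(* The rotation of order 3 about v turns the step x - mu (v - w) into an
   equilateral triangle; a symmetry fixing v and one corner while exchanging
   the other two must permute the three neighbors. *)
Lemma deg3_values : c = - (1 / 3) \/ c = 1 / 3.
Proof.
have cc := c_lt1; have cN := c_gtN1.
have [v [w [x [vV wN xN wx]]]] := deg3_vertex.
have [y [wy xy _ Nv]] := deg3_nbrs vV wN xN wx.
have yN : y \in N v by rewrite Nv !inE eqxx !orbT.
set e := (3 * c ^+ 2 - 1) / 2.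
have wx' : dot w x = e := deg3_dot vV wN xN wx.
have wy' : dot w y = e := deg3_dot vV wN yN wy.
have xy' : dot x y = e := deg3_dot vV xN yN xy.
have [wV vw] := nbrsP wN; have [xV vx] := nbrsP xN.
have [yV vy] := nbrsP yN.
have [rho sr [vr wr xr]] := hs_hom3 hV vV wV xV vV xV yV (etrans vw (esym vx))
  (etrans vx (esym vy)) (etrans wx' (esym xy')).
have yr : y *m rho = w.
  have : y *m rho \in N v by rewrite -vr; apply: nbrs_sym.
  rewrite Nv !inE => /or3P[/eqP//|/eqP h|/eqP h].
    by move: wy; rewrite (orth_inj sr.1 (etrans wr (esym h))) eqxx.
  by move: xy; rewrite (orth_inj sr.1 (etrans xr (esym h))) eqxx.
set q1 := x - mu *: (v - w); set q2 := y - mu *: (v - x); set q3 := w - mu *: (v - y).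
have q12 : q1 *m rho = q2 by rewrite /q1 mulmxBl -scalemxAl mulmxBl xr vr wr.
have q23 : q2 *m rho = q3 by rewrite /q2 mulmxBl -scalemxAl mulmxBl yr vr xr.
have q31 : q3 *m rho = q1 by rewrite /q3 mulmxBl -scalemxAl mulmxBl wr vr yr.
have q1V : q1 \in V by have [] := nbrsP (deg3_step vV wN xN wx).
have q2V : q2 \in V by rewrite -q12; apply: sr.2.
have q3V : q3 \in V by rewrite -q23; apply: sr.2.
have vq23 : dot v q2 = dot v q3 by rewrite -q23 -{2}vr dot_mulmx ?sr.1.
have q123 : dot q1 q2 = dot q1 q3 by rewrite -(dot_mulmx q1 q3 sr.1) q31 q12 dotC.
have [g sg [vg q1g q2g]] := hs_hom3 hV vV q1V q2V vV q1V q3V erefl vq23 q123.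
have [vv ww xx] : [/\ dot v v = 1, dot w w = 1 & dot x x = 1] by rewrite !(hs_norm hV).
have yy : dot y y = 1 by rewrite (hs_norm hV).
have q1w : dot q1 w = c by rewrite /q1 !dotE (dotC x w) wx' vw ww /e /mu; field.
have q1x : dot q1 x = 1 - mu ^+ 2 * (1 - c).
  by rewrite /q1 !dotE xx vx wx' /e /mu; field.
have q1y : dot q1 y = e - mu ^+ 2 * (1 - c).
  by rewrite /q1 !dotE xy' vy wy' /e /mu; field.
have inv z : z \in N v -> z *m g \in N v /\ dot q1 (z *m g) = dot q1 z.
  move=> zN; split; first by rewrite -vg; apply: nbrs_sym.
  by rewrite -{1}q1g dot_mulmx ?sg.1.
(* The cube has mu = 1, and [beta] gives mu = 0 for the tetrahedron; mu = -1 would mean c = -1. *)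
have alpha : dot q1 x = c -> c = 1 / 3.
  rewrite q1x => h; have : (1 - c) * (1 - mu) * (1 + mu) = 0 by move: h; rewrite /mu; lra.
  move/eqP; rewrite mulf_eq0 => /orP[|/eqP]; [rewrite mulf_eq0 => /orP[]/eqP|]; rewrite /mu; lra.
have beta : dot q1 y = c -> c = - (1 / 3).
  rewrite q1y => h; have : (1 - c) * mu * (1 + mu) = 0 by move: h; rewrite /e /mu; lra.
  move/eqP; rewrite mulf_eq0 => /orP[|/eqP]; [rewrite mulf_eq0 => /orP[]/eqP|]; rewrite /mu; lra.
have alphabeta : dot q1 x != dot q1 y.
  have h0 : 0 < (1 - c) * (1 + c) by apply: mulr_gt0; lra.
  by rewrite q1x q1y /e; apply/eqP => ?; lra.
have [wgN wgd] := inv w wN; have [xgN xgd] := inv x xN.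
(* The symmetry g permutes w, x, y and keeps their products with q1; that of w is c. If w moves, x
   or y has this product as well. *)
move: wgN wgd; rewrite Nv !inE => /or3P[]/eqP wg; rewrite wg q1w => wgd.
- move: xgN xgd; rewrite Nv !inE => /or3P[]/eqP xg; rewrite xg => xgd.
  + by right; apply: alpha; rewrite -xgd q1w.
  + have [ygN ygd] := inv y yN.
    have yg : y *m g = y.
      move: ygN; rewrite Nv !inE => /or3P[/eqP h|/eqP h|/eqP//].
        by move: wy; rewrite (orth_inj sg.1 (etrans wg (esym h))) eqxx.
      by move: xy; rewrite (orth_inj sg.1 (etrans xg (esym h))) eqxx.
    (* If g fixes all three neighbors it fixes q2, whose image is q3; the rotation then carries <q1,
       w> = c to <q1, x>. *)
    have q23e : q2 = q3.
      by rewrite -q2g /q2 mulmxBl -scalemxAl mulmxBl yg vg xg.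
    right; apply: alpha; have r1 : dot q1 x = dot q2 y by rewrite -q12 -xr dot_mulmx ?sr.1.
    have r2 : dot q3 y = dot q2 x by rewrite -q23 -xr dot_mulmx ?sr.1.
    have r3 : dot q2 x = dot q1 w by rewrite -q12 -wr dot_mulmx ?sr.1.
    by rewrite r1 q23e r2 r3.
  + by case/eqP: alphabeta.
- by right; apply: alpha.
by left; apply: beta.
Qed.

Lemma tetrahedron_copy : c = - (1 / 3) -> similar_copy V tetrahedron_vertices.
Proof.
move=> cE; have [v [w [x [vV wN xN wx]]]] := deg3_vertex.
have [y [wy xy wxy Nv]] := deg3_nbrs vV wN xN wx.
have yN : y \in N v by rewrite Nv !inE eqxx !orbT.
have wx' := deg3_dot vV wN xN wx.
have [wV vw] := nbrsP wN; have [xV vx] := nbrsP xN.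
have [yV vy] := nbrsP yN.
have yE : y = - v - w - x.
  have -> : y = w + x + y - w - x by row_ring.
  by rewrite wxy cE; row_field.
have [vv ww xx] : [/\ dot v v = 1, dot w w = 1 & dot x x = 1] by rewrite !(hs_norm hV).
(* Solved from v = e1 + e2 + e3, w = e1 - e2 - e3, x = - e1 + e2 - e3, three corners of the
   model. *)
pose e1 := 2^-1 *: (v + w); pose e2 := 2^-1 *: (v + x); pose e3 := - 2^-1 *: (w + x).
have Mk : rows3 e1 e2 e3 *m (rows3 e1 e2 e3)^T = (1 / 3)%:M.
  by apply: rows3_similar; rewrite /e1 /e2 /e3 !dotE ?(dotC w v) ?(dotC x v) ?(dotC x w)
    ?vv ?ww ?xx ?vw ?vx ?wx' cE; field.
apply: (copy_intro hV c_max _ Mk); first by lra.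
  move=> p [/= p1 pp]; rewrite mul_rows3E; move: pp; rewrite prod3E.
  case: (norm_eq1 (p1 0)) => ->; case: (norm_eq1 (p1 1)) => ->;
    case: (norm_eq1 (p1 2)) => -> h; try (exfalso; lra).
  - by row_is v.
  - by row_is w.
  - by row_is x.
  - by rewrite (_ : _ + _ = y) // yE; row_field.
(* The four corners of the model sum to zero, so the products with them cannot all be at most -1. *)
move=> p _ ps; have [I1 N1] := (normr1 R, normrN1 R).
have key (a b d : R) : `|a| = 1 -> `|b| = 1 -> `|d| = 1 -> a * b * d = 1 ->
    p 0 0 * a + p 0 1 * b + p 0 2 * d <= -1.
  move=> ha hb hd h; have /ps : tetrahedron_vertices (vec3 a b d).
    by split=> [|/=]; [apply: ord3P|rewrite prod3E]; rewrite !vec3E.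
  by rewrite dot3E !vec3E cE; lra.
have := (key 1 1 1 I1 I1 I1 ltac:(ring), key 1 (-1) (-1) I1 N1 N1 ltac:(ring)).
have := (key (-1) 1 (-1) N1 I1 N1 ltac:(ring), key (-1) (-1) 1 N1 N1 I1 ltac:(ring)).
by move=> [k1 k2] [k3 k4]; lra.
Qed.

Lemma cube_copy : c = 1 / 3 -> similar_copy V cube_vertices.
Proof.
move=> cE; have [v [w [x [vV wN xN wx]]]] := deg3_vertex.
have [y [wy xy wxy Nv]] := deg3_nbrs vV wN xN wx.
have yN : y \in N v by rewrite Nv !inE eqxx !orbT.
have step v1 w1 x1 : v1 \in V -> w1 \in N v1 -> x1 \in N v1 -> w1 != x1 ->
    x1 + w1 - v1 \in N w1.
  move=> v1V w1N x1N wx1; have := deg3_step v1V w1N x1N wx1.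
  by rewrite (_ : _ - _ = x1 + w1 - v1) // /mu cE; row_field.
have wx' := deg3_dot vV wN xN wx.
have [wV vw] := nbrsP wN; have [xV vx] := nbrsP xN.
have [yV vy] := nbrsP yN.
have yE : y = v - w - x.
  have -> : y = w + x + y - w - x by row_ring.
  by rewrite wxy cE; row_field.
have wxN := step _ _ _ vV wN xN wx; have wyN := step _ _ _ vV wN yN wy.
have xyN := step _ _ _ vV xN yN xy.
have nN : x + w - v + (y + w - v) - w \in N (y + w - v).
  apply: step => //; first by rewrite eq_sym; apply: contra xy => /eqP /addIr /addIr ->.
have [[wxV _] [wyV _]] := (nbrsP wxN, nbrsP wyN).
have [[xyV _] [nV _]] := (nbrsP xyN, nbrsP nN).
have [vv ww xx] : [/\ dot v v = 1, dot w w = 1 & dot x x = 1] by rewrite !(hs_norm hV).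
(* Solved from v = e1 + e2 + e3, w = - e1 + e2 + e3, x = e1 - e2 + e3. *)
pose e1 := 2^-1 *: (v - w); pose e2 := 2^-1 *: (v - x); pose e3 := 2^-1 *: (w + x).
have Mk : rows3 e1 e2 e3 *m (rows3 e1 e2 e3)^T = (1 / 3)%:M.
  by apply: rows3_similar; rewrite /e1 /e2 /e3 !dotE ?(dotC w v) ?(dotC x v) ?(dotC x w)
    ?vv ?ww ?xx ?vw ?vx ?wx' cE; field.
apply: (copy_intro hV c_max _ Mk); first by lra.
  move=> p /= p1; rewrite mul_rows3E.
  case: (norm_eq1 (p1 0)) => ->; case: (norm_eq1 (p1 1)) => ->; case: (norm_eq1 (p1 2)) => ->.
  - by row_is v.
  - by rewrite (_ : _ + _ = y) // yE; row_field.
  - by row_is x.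
  - by rewrite (_ : _ + _ = y + x - v) // yE; row_field.
  - by row_is w.
  - by rewrite (_ : _ + _ = y + w - v) // yE; row_field.
  - by row_is (x + w - v).
  - by rewrite (_ : _ + _ = x + w - v + (y + w - v) - w) // yE; row_field.
have [I1 N1] := (normr1 R, normrN1 R).
move=> p pp ps; have key (b1 b2 b3 : R) : `|b1| = 1 -> `|b2| = 1 -> `|b3| = 1 ->
    p 0 0 * b1 + p 0 1 * b2 + p 0 2 * b3 <= 1.
  move=> h1 h2 h3; have : cube_vertices (vec3 b1 b2 b3) by apply: ord3P; rewrite vec3E.
  by move/ps; rewrite dot3E !vec3E cE; lra.
(* The squares of the products with the four diagonals sum to four times the squared norm 3 of p,
   but each would be at most 1. *)
have key2 (b1 b2 b3 : R) : `|b1| = 1 -> `|b2| = 1 -> `|b3| = 1 ->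
    (p 0 0 * b1 + p 0 1 * b2 + p 0 2 * b3) ^+ 2 <= 1.
  move=> h1 h2 h3; rewrite -real_normK ?num_real // expr_le1 // ler_norml key // andbT.
  by have := key (- b1) (- b2) (- b3); rewrite !normrN !mulrN => /(_ h1 h2 h3); lra.
move: pp (key2 _ _ _ I1 I1 I1) (key2 _ _ _ I1 I1 N1) (key2 _ _ _ I1 N1 I1) (key2 _ _ _ I1 N1 N1).
by rewrite dot3E; lra.
Qed.

Lemma deg3_copy : similar_copy V tetrahedron_vertices \/ similar_copy V cube_vertices.
Proof.
case: deg3_values => cE.
  by left; apply: tetrahedron_copy.
by right; apply: cube_copy.
Qed.

End Degree3.

(** * Four neighbors: octahedron and cuboctahedron *)

Section Degree4.
Hypothesis deg4 : forall v, v \in V -> size (N v) = 4.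

Lemma deg4_opp v w : v \in V -> w \in N v -> (2 * c) *: v - w \in N v.
Proof. by move=> vV wN; have [] := nbrs4 vV wN (deg4 vV). Qed.

(** One of the two antipodal neighbors of v other than w and its antipode is seen at an angle of at
    most pi / 2 from w; call it x. An exchange of v and w moves x to a neighbor of w, and this or
    its antipode is on the side of x, so [nbr_triangle] applies. Then c^2 <= <w, x> = c. *)
Lemma deg4_triangle v w : v \in V -> w \in N v -> 0 <= c /\ exists2 x, x \in N v & x \in N w.
Proof.
move=> vV wN; have c1 := c_lt1; have cN := c_gtN1.
have [w'N [x0 [x0N x0'N x0w x0w']]] := nbrs4 vV wN (deg4 vV).
have [wV vw] := nbrsP wN; have [w'V _] := nbrsP w'N.
have s0 := sqr_c_lt1.
have [vv ww] : dot v v = 1 /\ dot w w = 1 by rewrite !(hs_norm hV).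
have [x [xN xw xw' xd]] : exists x, [/\ x \in N v, x != w, x != (2 * c) *: v - w & c ^+ 2 <= dot w x].
  have [h|h] := leP (c ^+ 2) (dot w x0); first by exists x0.
  exists ((2 * c) *: v - x0); split=> //.
  - by apply: contra x0w' => /eqP <-; rewrite opprB addrCA subrr addr0.
  - by apply: contra x0w => /eqP /addrI /oppr_inj ->.
  by rewrite !dotE (dotC w v) vw; lra.
have [xV vx] := nbrsP xN.
have wx1 : dot w x < 1 by apply: (unit_neq_dot) => //; rewrite eq_sym.
have wx2 : dot w x <= c by apply: c_max => //; rewrite eq_sym.
(* The cosine of the angle at v between the arcs to w and x. *)
pose t := (dot w x - c ^+ 2) / (1 - c ^+ 2).
have sn0 : 1 - c ^+ 2 != 0 by rewrite gt_eqF.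
have wxt : dot w x = c ^+ 2 + (1 - c ^+ 2) * t by rewrite /t; field.
have t0 : 0 <= t by apply: divr_ge0; [rewrite subr_ge0|exact: ltW].
have t1 : t < 1 by rewrite ltr_pdivrMr // mul1r; lra.
have Dx : 0 < triple v w x ^+ 2.
  rewrite expr2 tripleM vv ww (hs_norm hV xV) (dotC w v) (dotC x v) (dotC x w) vw vx wxt.
  set s := 1 - c ^+ 2 in s0 *; have -> : 1 * (1 * 1 - (c ^+ 2 + s * t) * (c ^+ 2 + s * t)) -
    c * (c * 1 - (c ^+ 2 + s * t) * c) + c * (c * (c ^+ 2 + s * t) - 1 * c) =
    s ^+ 2 * ((1 - t) * (1 + t)) by rewrite /s; ring.
  by rewrite !mulr_gt0 //; lra.
have [g sg [vg wg]] := hs_swap hV vV wV.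
have xgN : x *m g \in N w by rewrite -{1}vg; apply: nbrs_sym.
have xg'N := deg4_opp wV xgN.
have vxg : dot v (x *m g) = c ^+ 2 + (1 - c ^+ 2) * t.
  by rewrite -wg dot_mulmx ?sg.1.
have vxg' : dot v ((2 * c) *: w - x *m g) = c ^+ 2 - (1 - c ^+ 2) * t.
  by rewrite !dotE vw vxg; ring.
have [xgV wxg] := nbrsP xgN.
have Dg : triple v w (x *m g) ^+ 2 = triple v w x ^+ 2.
  rewrite !expr2 !tripleM vv ww (hs_norm hV xV) (hs_norm hV xgV) (dotC w v) (dotC x v)
    (dotC x w) (dotC _ v) (dotC _ w) vw vx wxt vxg wxg; ring.
have wxc : dot w x = c.
  move/eqP: Dg; rewrite eqf_sqr => /orP[]/eqP Dg.
    by apply: (nbr_triangle vV wN xN xgN t0 t1 wxt); [left|rewrite Dg -expr2].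
  apply: (nbr_triangle vV wN xN xg'N t0 t1 wxt); first by right.
  by rewrite [triple v w (_ - _)]dotDr dotZr dot_crossr mulr0 add0r dotNr -/(triple _ _ _)
    Dg opprK -expr2.
split; last by exists x => //; apply/nbrsP.
by move: xd; rewrite wxc => h; rewrite leNgt; apply/negP => ?; have := sqr_ge0 c; lra.
Qed.

(** The path v, w, p3, p4, p5, p6 runs along a face beside the triangle v w x; it closes after
    three, four and five steps for the three values of c. The products of v with p4 and p6 are
    polynomials in c, and each is 1 or at most c. *)
Lemma deg4_values : c = 0 \/ c = 1 / 2 \/ 4 * c ^+ 2 = 2 * c + 1.
Proof.
have c1 := c_lt1.
have [v vV] := hs_nonempty hV; have [w wN] := nbrs_nonempty vV.
have [c0 [x xN xNw]] := deg4_triangle vV wN.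
have [wV vw] := nbrsP wN; have [xV vx] := nbrsP xN.
have vv : dot v v = 1 by rewrite (hs_norm hV).
(* The antipodes across b of the other two corners of the triangle a b d form the opposite triangle
   at b. *)
have step a b d : b \in N a -> d \in N a -> a \in V -> d \in N b ->
    [/\ b \in V, (2 * c) *: b - d \in N b, (2 * c) *: b - a \in N b &
        (2 * c) *: b - a \in N ((2 * c) *: b - d)].
  move=> bN dN aV dNb; have [bV ab] := nbrsP bN.
  have aNb := nbrsC aV bN; have h1 := deg4_opp bV aNb; have h2 := deg4_opp bV dNb.
  have [aV' ba] := nbrsP aNb; have [dV bd] := nbrsP dNb.
  have [_ ad] := nbrsP dN.
  split=> //; apply/nbrsP; split; first by have [] := nbrsP h1.
  by rewrite !dotE (dotC d b) (dotC d a) (hs_norm hV bV) ba bd ad; ring.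
have [_ p3 z3 a3] := step _ _ _ wN xN vV xNw.
have [p3V p4 z4 a4] := step _ _ _ p3 z3 wV a3.
have [p4V p5 z5 a5] := step _ _ _ p4 z4 p3V a4.
have [p5V p6 _ _] := step _ _ _ p5 z5 p4V a5.
have [p6V _] := nbrsP p6.
have bound y : y \in V -> dot v y <= c \/ dot v y = 1.
  by move=> yV; have [<-|vy] := eqVneq v y; [right|left; apply: c_max].
have d4 := bound _ p4V; have d6 := bound _ p6V.
have e4 : 4 * c ^+ 3 - 4 * c ^+ 2 + 1 <= c \/ 4 * c ^+ 3 - 4 * c ^+ 2 + 1 = 1.
  by move: d4; rewrite (_ : dot v _ = 4 * c ^+ 3 - 4 * c ^+ 2 + 1) // !dotE vv vw vx; ring.
have e6 : 16 * c ^+ 5 - 32 * c ^+ 4 + 12 * c ^+ 3 + 8 * c ^+ 2 - 3 * c <= c \/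
    16 * c ^+ 5 - 32 * c ^+ 4 + 12 * c ^+ 3 + 8 * c ^+ 2 - 3 * c = 1.
  move: d6; rewrite (_ : dot v _ = 16 * c ^+ 5 - 32 * c ^+ 4 + 12 * c ^+ 3 + 8 * c ^+ 2 - 3 * c) //.
  by rewrite !dotE vv vw vx; ring.
clear d4 d6 p3 z3 a3 p4 z4 a4 p5 z5 a5 p6 p3V p4V p5V p6V.
have [->|cn0] := eqVneq c 0; [by left|right].
have cpos : 0 < c by rewrite lt_neqAle eq_sym cn0.
have ch : 1 / 2 <= c.
  (* A product of at most c gives (1 - c) (1 - 4 c^2) <= 0; a product of 1 gives c = 0 or c = 1. *)
  case: e4 => h.
    rewrite leNgt; apply/negP => lt.
    have : 0 < (1 - c) * ((1 - 2 * c) * (1 + 2 * c)) by rewrite !mulr_gt0 //; lra.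
    by lra.
  have /eqP : 4 * c ^+ 2 * (c - 1) = 0 by lra.
  rewrite mulf_eq0 => /orP[|/eqP]; last by lra.
  by rewrite mulf_eq0 sqrf_eq0 (negbTE cn0) pnatr_eq0.
have [->|chn] := eqVneq c (1 / 2); [by left|right].
have {}ch : 1 / 2 < c by rewrite lt_neqAle eq_sym chn.
case: e6 => h.
  have : 0 < c * ((1 - c) ^+ 2 * ((2 * c - 1) * (2 * c + 1))).
    by rewrite !(mulr_gt0, exprn_gt0) //; lra.
  by lra.
have /eqP : (c - 1) * (4 * c ^+ 2 - 2 * c - 1) ^+ 2 = 0 by lra.
by rewrite mulf_eq0 sqrf_eq0 => /orP[]/eqP; lra.
Qed.

Lemma deg4_vertex : exists v w x, [/\ v \in V, w \in N v, x \in N v & x \in N w].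
Proof.
have [v vV] := hs_nonempty hV; have [w wN] := nbrs_nonempty vV.
have [_ [x xN xNw]] := deg4_triangle vV wN.
by exists v, w, x.
Qed.

Lemma deg4_mem v w x : v \in V -> w \in N v -> x \in N v ->
  x != w -> x != (2 * c) *: v - w ->
  N v =i [:: w; (2 * c) *: v - w; x; (2 * c) *: v - x].
Proof.
move=> vV wN xN xw xw'; have c1 := c_lt1; have cN := c_gtN1.
have opp y : y \in N v -> (2 * c) *: v - y \in N v.
  by apply: (deg4_opp vV).
have nop y : y \in N v -> y != (2 * c) *: v - y.
  move=> /nbrsP[yV vy]; apply/eqP => /(congr1 (dot y)).
  rewrite !dotE (dotC y v) vy (hs_norm hV yV) => h.
  have /eqP : (1 - c) * (1 + c) = 0 by lra.
  by rewrite mulf_eq0 => /orP[]/eqP; lra.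
have wx' : w != (2 * c) *: v - x.
  by apply: contra xw' => /eqP ->; rewrite opprB addrCA subrr addr0.
have w'x' : (2 * c) *: v - w != (2 * c) *: v - x.
  by apply: contra xw => /eqP /addrI /oppr_inj ->.
have uL : uniq [:: w; (2 * c) *: v - w; x; (2 * c) *: v - x].
  rewrite /= !inE !negb_or !nop // wx' w'x' (eq_sym w x) xw.
  by rewrite (eq_sym _ x) xw'.
have sL : {subset [:: w; (2 * c) *: v - w; x; (2 * c) *: v - x] <= N v}.
  by move=> y; rewrite !inE => /or4P[]/eqP ->; rewrite ?opp.
have := uniq_min_size uL sL; rewrite (deg4 vV) => /(_ isT)[_ h] y; exact/esym/h.
Qed.

Lemma octahedron_copy : c = 0 -> similar_copy V octahedron_vertices.
Proof.
move=> cE; have [v [w [x [vV wN xN xNw]]]] := deg4_vertex.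
have [wV vw] := nbrsP wN; have [xV vx] := nbrsP xN.
have [_ wx] := nbrsP xNw.
have opp a b : a \in V -> b \in N a -> - b \in V.
  move=> aV bN; have := deg4_opp aV bN.
  by rewrite cE mulr0 scale0r sub0r => /nbrsP[].
have wV' := opp _ _ vV wN; have xV' := opp _ _ vV xN; have vV' := opp _ _ wV (nbrsC vV wN).
have [vv ww xx] : [/\ dot v v = 1, dot w w = 1 & dot x x = 1] by rewrite !(hs_norm hV).
have Mk : rows3 v w x *m (rows3 v w x)^T = 1%:M.
  by apply: rows3_similar => //; rewrite ?vw ?vx ?wx.
apply: (copy_intro hV c_max _ Mk) => //.
  move=> p [i [/norm_eq1 pi pj]]; rewrite mul_rows3E; case: (ord3_cases i) => ii; subst i.
  - rewrite (pj 1) // (pj 2) // !scale0r !addr0.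
    by case: pi => ->; rewrite ?scale1r ?scaleN1r.
  - rewrite (pj 0) // (pj 2) // !scale0r addr0 add0r.
    by case: pi => ->; rewrite ?scale1r ?scaleN1r.
  rewrite (pj 0) // (pj 1) // !scale0r addr0 add0r.
  by case: pi => ->; rewrite ?scale1r ?scaleN1r.
move=> p pp ps.
have in0 (a : R) : `|a| = 1 -> octahedron_vertices (vec3 a 0 0).
  by move=> ha; exists 0; split; [rewrite vec3E|apply: ord3P; rewrite !vec3E].
have in1 (a : R) : `|a| = 1 -> octahedron_vertices (vec3 0 a 0).
  by move=> ha; exists 1; split; [rewrite vec3E|apply: ord3P; rewrite !vec3E].
have in2 (a : R) : `|a| = 1 -> octahedron_vertices (vec3 0 0 a).
  by move=> ha; exists 2; split; [rewrite vec3E|apply: ord3P; rewrite !vec3E].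
have [I1 N1] := (normr1 R, normrN1 R).
move: (ps _ (in0 _ I1)) (ps _ (in0 _ N1)) (ps _ (in1 _ I1)) (ps _ (in1 _ N1)).
move: (ps _ (in2 _ I1)) (ps _ (in2 _ N1)) pp; rewrite !dot3E !vec3E cE.
move=> h1 h2 pp h3 h4 h5 h6.
have [p0 [p1 p2]] : p 0 0 = 0 /\ p 0 1 = 0 /\ p 0 2 = 0 by split; [lra|split; lra].
by move: pp; rewrite p0 p1 p2; lra.
Qed.

Lemma cuboctahedron_copy : c = 1 / 2 -> similar_copy V cuboctahedron_vertices.
Proof.
move=> cE; have [v [w [x [vV wN xN xNw]]]] := deg4_vertex.
have [wV vw] := nbrsP wN; have [xV vx] := nbrsP xN.
have [_ wx] := nbrsP xNw.
have [vv ww xx] : [/\ dot v v = 1, dot w w = 1 & dot x x = 1] by rewrite !(hs_norm hV).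
have sub a b : a \in V -> b \in N a -> a - b \in N a.
  move=> aV bN; have := deg4_opp aV bN.
  by rewrite cE mul1r mulfV ?scale1r // pnatr_eq0.
have inV a b : a \in V -> b \in N a -> a - b \in V.
  by move=> aV /(sub _ _ aV) /nbrsP[].
have vN := nbrsC vV wN; have vNx := nbrsC vV xN; have wNx := nbrsC wV xNw.
have vwV := inV _ _ vV wN; have vxV := inV _ _ vV xN; have wxV := inV _ _ wV xNw.
have wvV := inV _ _ wV vN; have xvV := inV _ _ xV vNx; have xwV := inV _ _ xV wNx.
have nvV := inV _ _ wvV (nbrsC wV (sub _ _ wV vN)).
have nwV := inV _ _ vwV (nbrsC vV (sub _ _ vV wN)).
have nxV := inV _ _ vxV (nbrsC vV (sub _ _ vV xN)).
(* Solved from v = e1 + e2, w = e1 + e3, x = e2 + e3. *)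
pose e1 := 2^-1 *: (v + w - x); pose e2 := 2^-1 *: (v + x - w); pose e3 := 2^-1 *: (w + x - v).
have Mk : rows3 e1 e2 e3 *m (rows3 e1 e2 e3)^T = (1 / 2)%:M.
  by apply: rows3_similar; rewrite /e1 /e2 /e3 !dotE ?(dotC w v) ?(dotC x v) ?(dotC x w)
    ?vv ?ww ?xx ?vw ?vx ?wx cE; field.
apply: (copy_intro hV c_max _ Mk); first by lra.
  move=> p [i [pi pj]]; rewrite mul_rows3E; case: (ord3_cases i) => ii; subst i; rewrite pi.
  - case: (norm_eq1 (pj 1 isT)) => ->; case: (norm_eq1 (pj 2 isT)) => ->.
    + by row_is x.
    + by row_is (v - w).
    + by row_is (w - v).
    + by row_is (v - x - v).
  - case: (norm_eq1 (pj 0 isT)) => ->; case: (norm_eq1 (pj 2 isT)) => ->.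
    + by row_is w.
    + by row_is (v - x).
    + by row_is (x - v).
    + by row_is (v - w - v).
  case: (norm_eq1 (pj 0 isT)) => ->; case: (norm_eq1 (pj 1 isT)) => ->.
  + by row_is v.
  + by row_is (w - x).
  + by row_is (x - w).
  + by row_is (w - v - w).
move=> p pp ps.
have in0 (a b : R) : `|a| = 1 -> `|b| = 1 -> p 0 1 * a + p 0 2 * b <= 1.
  move=> ha hb; have : cuboctahedron_vertices (vec3 0 a b).
    by exists 0; split; [rewrite vec3E|apply: ord3P; rewrite !vec3E].
  by move/ps; rewrite dot3E !vec3E cE; lra.
have in1 (a b : R) : `|a| = 1 -> `|b| = 1 -> p 0 0 * a + p 0 2 * b <= 1.
  move=> ha hb; have : cuboctahedron_vertices (vec3 a 0 b).
    by exists 1; split; [rewrite vec3E|apply: ord3P; rewrite !vec3E].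
  by move/ps; rewrite dot3E !vec3E cE; lra.
have in2 (a b : R) : `|a| = 1 -> `|b| = 1 -> p 0 0 * a + p 0 1 * b <= 1.
  move=> ha hb; have : cuboctahedron_vertices (vec3 a b 0).
    by exists 2; split; [rewrite vec3E|apply: ord3P; rewrite !vec3E].
  by move/ps; rewrite dot3E !vec3E cE; lra.
have [I1 N1] := (normr1 R, normrN1 R).
(* Each pair of coordinates of p has squares summing to at most 1, so twice the squared norm is at
   most 3; but the squared norm is 2. *)
have sq (a b : R) : (forall e f : R, `|e| = 1 -> `|f| = 1 -> a * e + b * f <= 1) ->
    a ^+ 2 + b ^+ 2 <= 1.
  move=> h; have h1 := h _ _ I1 I1; have h2 := h _ _ N1 N1.
  have h3 := h _ _ I1 N1; have h4 := h _ _ N1 I1.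
  have : 0 <= (1 - (a + b)) * (1 + (a + b)) by apply: mulr_ge0; lra.
  have : 0 <= (1 - (a - b)) * (1 + (a - b)) by apply: mulr_ge0; lra.
  by lra.
move: (sq _ _ in0) (sq _ _ in1) (sq _ _ in2) pp; rewrite dot3E; lra.
Qed.

(* The remaining value of c is that of the icosidodecahedron, where two
   vertices orthogonal to v see the neighbors of v differently. *)
Lemma deg4_not_icosidodecahedron : 4 * c ^+ 2 <> 2 * c + 1.
Proof.
move=> c2; have [v [w [x [vV wN xN xNw]]]] := deg4_vertex.
have c1 := c_lt1.
have [wV vw] := nbrsP wN; have [xV vx] := nbrsP xN.
have [_ wx] := nbrsP xNw.
have [vv ww xx] : [/\ dot v v = 1, dot w w = 1 & dot x x = 1] by rewrite !(hs_norm hV).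
have opp a b : a \in V -> b \in N a -> (2 * c) *: a - b \in N a.
  by move=> aV bN; apply: (deg4_opp aV bN).
have aN := opp _ _ wV (nbrsC vV wN); have bN := opp _ _ wV xNw.
set a := (2 * c) *: w - v in aN; set b := (2 * c) *: w - x in bN.
have [aV wa] := nbrsP aN; have [bV wb] := nbrsP bN.
have abN : b \in N a.
  by apply/nbrsP; split=> //; rewrite /a /b !dotE ww wx vw vx; ring.
pose e := (2 * c) *: a - b; pose f := (2 * c) *: b - w.
have eV : e \in V by have [] := nbrsP (opp _ _ aV abN).
have fV : f \in V by have [] := nbrsP (opp _ _ bV (nbrsC wV bN)).
have c3 : 4 * c ^+ 3 = 2 * c ^+ 2 + c by have := congr1 ( *%R c) c2; lra.
have ve : dot v e = dot v f by rewrite /e /f /a /b !dotE vv vw vx; lra.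
(* As seen from v alone, e and f are alike. But <w, e> = 1 / 2, while the four neighbors of v have
   with f only the products c - 1 / 2 and 1 / 2 - c. *)
have [g sg [vg eg]] := hs_pair hV vV eV vV fV ve.
have wgN : w *m g \in N v by rewrite -vg; apply: nbrs_sym.
have := dot_mulmx w e sg.1; rewrite eg.
have we : dot w e = 1 / 2 by rewrite /e /a /b !dotE ww (dotC w v) vw wx; lra.
have c4 : 4 * c ^+ 4 = 2 * c ^+ 3 + c ^+ 2 by have := congr1 ( *%R c) c3; lra.
have wf : dot w f = c - 1 / 2 by rewrite /f /b !dotE ww wx; lra.
have xf : dot x f = 1 / 2 - c by rewrite /f /b !dotE (dotC x w) wx xx; lra.
have vf : dot v f = 0 by rewrite /f /b !dotE vw vx; lra.
have xw : x != w by apply/eqP => e0; move: wx; rewrite e0 ww; lra.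
have xw' : x != (2 * c) *: v - w.
  by apply/eqP => e0; move: wx; rewrite e0 !dotE (dotC w v) vw ww => ?; nra.
have [c0 _] := deg4_triangle vV wN.
have {c0}cpos : 0 < c.
  rewrite lt_neqAle c0 andbT; apply/eqP => z0; move: c2; rewrite -z0 expr0n /= !mulr0.
  by lra.
move: wgN; rewrite (deg4_mem vV wN xN xw xw') !inE we => /or4P[]/eqP ->;
  by rewrite ?dotDl ?dotNl ?dotZl ?vf ?wf ?xf ?mulr0; lra.
Qed.

End Degree4.

(** * Five neighbors: icosahedron *)

Section Degree5.
Hypothesis deg5 : forall v, v \in V -> size (N v) = 5.
Let t : R := cos (2 * pi / 5%:R).

Lemma deg5_mirror v w : v \in V -> w \in N v ->
  exists x x', [/\ x \in N v, x' \in N v, x != x' & dot w x = c ^+ 2 + (1 - c ^+ 2) * t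
    /\ dot w x' = c ^+ 2 + (1 - c ^+ 2) * t].
Proof.
move=> vV wN; have s4 : (4 < size (N v))%N by rewrite (deg5 vV).
have [x [x' [xN x'N xx' wx wx']]] := deg_ge5_nbrs vV wN s4.
exists x, x'; split=> //; move: wx wx'; rewrite (deg5 vV) => -> ->; split=> //.
Qed.

(** Adjacent neighbors of v are neighbors of each other, that is, c^2 + (1 - c^2) t = c; divide by 1
    - c. An exchange of v and w sends x and x' to neighbors of w on different sides of the plane of
    v and w, so one is on the side of x and [nbr_triangle] applies. *)
Lemma deg5_value : t * (1 + c) = c.
Proof.
have [v vV] := hs_nonempty hV; have [w wN] := nbrs_nonempty vV.
have [t0 tt] := @cos_2pi5 R; rewrite -/t in t0 tt.
have c1 := c_lt1; have cN := c_gtN1.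
have t1 : t < 1 by rewrite ltNge; apply/negP => ?; have := sqr_ge0 t; lra.
have [wV vw] := nbrsP wN.
have [x [x' [xN x'N xx' [wx wx']]]] := deg5_mirror vV wN.
have [xV vx] := nbrsP xN; have [x'V vx'] := nbrsP x'N.
have [g sg [vg wg]] := hs_swap hV vV wV.
have xgN : x *m g \in N w by rewrite -{1}vg; apply: nbrs_sym.
have x'gN : x' *m g \in N w by rewrite -{1}vg; apply: nbrs_sym.
have [xgV wxg] := nbrsP xgN; have [x'gV wx'g] := nbrsP x'gN.
have vxg : dot v (x *m g) = c ^+ 2 + (1 - c ^+ 2) * t by rewrite -wg dot_mulmx ?sg.1.
have vx'g : dot v (x' *m g) = c ^+ 2 + (1 - c ^+ 2) * t by rewrite -wg dot_mulmx ?sg.1.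
have [vv ww] : dot v v = 1 /\ dot w w = 1 by rewrite !(hs_norm hV).
have s0 := sqr_c_lt1.
have D y (b d : R) : y \in V -> dot v y = b -> dot w y = d -> triple v w y ^+ 2 =
    1 - c ^+ 2 - b ^+ 2 - d ^+ 2 + 2 * c * b * d.
  move=> yV vy wy; rewrite expr2 tripleM vv ww (hs_norm hV yV) (dotC w v) (dotC y v) (dotC y w) vw vy wy; ring.
have Dx := D _ _ _ xV vx wx; have Dxg := D _ _ _ xgV vxg wxg.
have Dx'g := D _ _ _ x'gV vx'g wx'g.
have D0 : 0 < triple v w x ^+ 2.
  rewrite Dx; set s := 1 - c ^+ 2 in s0 *.
  have -> : s - c ^+ 2 - (c ^+ 2 + s * t) ^+ 2 + 2 * c * c * (c ^+ 2 + s * t) =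
    s ^+ 2 * ((1 - t) * (1 + t)) by rewrite /s; ring.
  by rewrite !mulr_gt0 //; lra.
have Dneq : triple v w (x *m g) != triple v w (x' *m g).
  apply/eqP => e; case/eqP: xx'; apply: (orth_inj sg.1).
  apply: (triple_dot_inj (a := v) (b := w) (c := cross v w)).
  - by rewrite /triple gt_eqF // dot_gt0 // (nbrs_cross vV wN).
  - by rewrite !(dotC _ v) vxg.
  - by rewrite !(dotC _ w) wxg.
  by rewrite !(dotC _ (cross v w)).
have wxc : dot w x = c.
  have /eqP : triple v w (x *m g) ^+ 2 = triple v w x ^+ 2 by rewrite Dx Dxg; ring.
  rewrite eqf_sqr => /orP[]/eqP e1.
    apply: (nbr_triangle vV wN xN xgN (ltW t0) t1 wx); first by left.
    by rewrite e1 -expr2.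
  have /eqP : triple v w (x' *m g) ^+ 2 = triple v w x ^+ 2 by rewrite Dx Dx'g; ring.
  rewrite eqf_sqr => /orP[]/eqP e2; last by rewrite e1 e2 eqxx in Dneq.
  apply: (nbr_triangle vV wN xN x'gN (ltW t0) t1 wx); first by left.
  by rewrite e2 -expr2.
apply: (mulfI (lt0r_neq0 (_ : 0 < 1 - c))); first by lra.
by move: wx; rewrite wxc; lra.
Qed.

(** The projection of y to the plane of v and w is t (v + w), so the vector is the mirror image of y
    in this plane; by its products with v and w it is one of their common neighbors. *)
Lemma deg5_step v w y : v \in V -> w \in N v -> y \in N v -> y \in N w ->
  (2 * t) *: (v + w) - y \in V.
Proof.
move=> vV wN yN yNw; have [x [x' [xN x'N xx' [wx wx']]]] := deg5_mirror vV wN.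
have ct := deg5_value.
have ct2 : c ^+ 2 + (1 - c ^+ 2) * t = c.
  have -> : (1 - c ^+ 2) * t = (1 - c) * (t * (1 + c)) by ring.
  by rewrite ct; ring.
rewrite ct2 in wx wx'.
have [xV vx] := nbrsP xN; have [x'V vx'] := nbrsP x'N.
have [wV vw] := nbrsP wN; have [yV vy] := nbrsP yN.
have [_ wy] := nbrsP yNw.
have [vv [ww yy]] : dot v v = 1 /\ dot w w = 1 /\ dot y y = 1 by rewrite !(hs_norm hV).
set z := _ - y; have zor : z = x \/ z = x'; last by case: zor => ->.
have zv : dot z v = c.
  by rewrite /z !dotE vv (dotC w v) (dotC y v) vw vy; lra.
have zw : dot z w = c by rewrite /z !dotE ww (dotC y w) vw wy; lra.
have zz : dot z z = 1.
  have ct' : t * (t * (1 + c)) = t * c by rewrite ct.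
  by rewrite /z !dotE vv ww yy (dotC w v) (dotC y v) (dotC y w) vw vy wy; lra.
apply: (@mirror_two _ v w) => //; rewrite ?zz ?zv ?zw ?(hs_norm hV) //.
- exact: (nbrs_cross vV wN).
- by rewrite dotC.
- by rewrite dotC.
- by rewrite dotC.
by rewrite dotC.
Qed.

Lemma icosahedron_copy : similar_copy V icosahedron_vertices.
Proof.
have [v vV] := hs_nonempty hV; have [w wN] := nbrs_nonempty vV.
have [t0 tt] := @cos_2pi5 R; rewrite -/t in t0 tt.
have ct := deg5_value; have c1 := c_lt1; have cN := c_gtN1.
have [x [x' [xN _ _ [wx _]]]] := deg5_mirror vV wN.
have ct2 : c ^+ 2 + (1 - c ^+ 2) * t = c.
  have -> : (1 - c ^+ 2) * t = (1 - c) * (t * (1 + c)) by ring.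
  by rewrite ct; ring.
rewrite ct2 in wx.
have [wV vw] := nbrsP wN; have [xV vx] := nbrsP xN.
have [vv ww xx] : [/\ dot v v = 1, dot w w = 1 & dot x x = 1] by rewrite !(hs_norm hV).
(* The inverse of the golden ratio. *)
pose l := 2 * t; have l0 : 0 < l by rewrite /l; lra.
have l2 : l ^+ 2 = 1 - l by rewrite /l; lra.
have l3 : l ^+ 3 = 2 * l - 1 by have -> : l ^+ 3 = l * l ^+ 2 by [ring]; rewrite l2; lra.
have cE : c = (1 + 2 * l) / 5.
  have h : (2 - l) * c = l by move: ct; rewrite /l; lra.
  have n0 : 2 - l != 0 by apply/eqP => ?; nra.
  by apply: (mulfI n0); rewrite h; lra.
(* The three vectors are solved from the correspondence of v, w, x with (0, 1, phi), (0, -1, phi),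
   (phi, 0, 1) in the model. *)
have [e2 e2E] : exists e, e = 2^-1 *: (v - w) by eexists.
have [e3 e3E] : exists e, e = (l / 2) *: (v + w) by eexists.
have [e1 e1E] : exists e, e = l *: (x - e3) by eexists.
set k := (1 - c) / 2.
have Mk : rows3 e1 e2 e3 *m (rows3 e1 e2 e3)^T = k%:M.
  have e33 : dot e3 e3 = k.
    by rewrite e3E /k !dotE vv ww (dotC w v) vw cE; lra.
  have xe3 : dot x e3 = k by rewrite e3E /k !dotE (dotC x v) (dotC x w) vx wx cE; lra.
  apply: rows3_similar => //.
  - by rewrite e1E !dotE xx xe3 (dotC e3 x) xe3 e33 /k cE; lra.
  - by rewrite e2E /k !dotE vv ww (dotC w v) vw; field.
  - by rewrite e1E e2E e3E !dotE vv ww (dotC w v) (dotC x v) (dotC x w) vw vx wx; lra.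
  - by rewrite e1E !dotE xe3 e33; ring.
  by rewrite e2E e3E !dotE vv ww (dotC w v) vw; ring.
have k0 : 0 < k by rewrite /k; lra.
pose phi := 1 + l; have kphi : k * phi = c by rewrite /k /phi cE; lra.
have lphi : l * phi = 1 by rewrite /phi; lra.
pose A p := p *m rows3 e1 e2 e3 \in V.
have phie3 : phi *: e3 = 2^-1 *: (v + w).
  by rewrite e3E scalerA; congr (_ *: _); move: lphi; lra.
have phie1 : phi *: e1 = x - e3 by rewrite e1E scalerA mulrC lphi scale1r.
have a1 : A (vec3 0 1 phi).
  rewrite /A mul_rows3E !vec3E phie3 scale0r e2E (_ : 0 + 1 *: (2^-1 *: (v - w)) + 2^-1 *: (v + w) = v) //.
  by row_field.
have a2 : A (vec3 0 (-1) phi).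
  rewrite /A mul_rows3E !vec3E phie3 scale0r e2E (_ : 0 + -1 *: (2^-1 *: (v - w)) + 2^-1 *: (v + w) = w) //.
  by row_field.
have a3 : A (vec3 phi 0 1).
  rewrite /A mul_rows3E !vec3E phie1 scale0r (_ : x - e3 + 0 + 1 *: e3 = x) //.
  by row_ring.
have step (p q s : 'rV[R]_3) : A p -> A q -> A s -> dot p q = phi -> dot p s = phi ->
    dot q s = phi -> A (l *: (p + q) - s).
  move=> Ap Aq As pq ps qs; rewrite /A mulmxBl -scalemxAl mulmxDl; apply: deg5_step => //;
    by apply/nbrsP; split=> //; rewrite (dot_similar _ _ Mk) ?pq ?ps ?qs.
have gen := icosahedron_generated l2 a1 a2 a3 step.
have goldenE : golden_ratio = phi.
  rewrite /golden_ratio; have -> : Num.sqrt 5 = 1 + 2 * l :> R; last by rewrite /phi; field.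
  have -> : 5 = (1 + 2 * l) ^+ 2 by lra.
  by rewrite sqrtr_sqr ger0_norm //; lra.
have phi0 : 0 < phi by rewrite /phi; lra.
have normphi (a : R) : `|a| = phi -> a = phi \/ a = - phi.
  by move=> /eqP; rewrite eqr_norml (ltW phi0) andbT => /orP[]/eqP; [left|right].
have add12 : (1 + 2 = 0 :> 'I_3) by apply: val_inj.
have add21 : (2 + 1 = 0 :> 'I_3) by apply: val_inj.
have add11 : (1 + 1 = 2 :> 'I_3) by apply: val_inj.
have add22 : (2 + 2 = 1 :> 'I_3) by apply: val_inj.
apply: (copy_intro hV c_max k0 Mk).
  move=> p [i [pi /norm_eq1 p1]]; rewrite goldenE => /normphi p2.
  rewrite -/(A p) -(vec3K p); case: (ord3_cases i) => ii; subst i; move: pi p1 p2;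
    rewrite ?add0r ?add12 ?add21 ?add11 ?add22 => -> p1 p2; by have [? []] := gen _ _ p1 p2.
move=> p pp ps.
have inP (a b : R) : `|a| = 1 -> `|b| = phi -> [/\ p 0 1 * a + p 0 2 * b <= phi,
    p 0 2 * a + p 0 0 * b <= phi & p 0 0 * a + p 0 1 * b <= phi].
  move=> ha hb; split; rewrite -(ler_pM2l k0) kphi.
  - have /ps : icosahedron_vertices (vec3 0 a b).
      by exists 0; rewrite !add0r !vec3E goldenE.
    by rewrite dot3E !vec3E; lra.
  - have /ps : icosahedron_vertices (vec3 b 0 a).
      by exists 1; rewrite add11 add12 !vec3E goldenE.
    by rewrite dot3E !vec3E; lra.
  have /ps : icosahedron_vertices (vec3 a b 0).
    by exists 2; rewrite add21 add22 !vec3E goldenE.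
  by rewrite dot3E !vec3E; lra.
have phi2 : phi ^+ 2 = phi + 1 by rewrite /phi; lra.
have qq := icosahedron_bound inP phi0.
have k2 : k * (1 + phi ^+ 2) = 1 by rewrite /k /phi cE; lra.
have : k * ((p 0 0 ^+ 2 + p 0 1 ^+ 2 + p 0 2 ^+ 2) * (1 + phi ^+ 2)) <= k * (3 * phi ^+ 2).
  by rewrite ler_pM2l.
have -> : k * ((p 0 0 ^+ 2 + p 0 1 ^+ 2 + p 0 2 ^+ 2) * (1 + phi ^+ 2)) =
  (k * dot p p) * (1 + phi ^+ 2) by rewrite dot3E; ring.
(* The left side is 2 + phi > 3, the right side 3 (1 + c) / 2 < 3. *)
rewrite pp mul1r phi2; have -> : k * (3 * (phi + 1)) = 3 * (k * phi + k) by ring.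
by rewrite kphi /k /phi; lra.
Qed.

End Degree5.

End Neighbors.

Lemma irreducible_copy (R : realType) (V : seq 'rV[R]_3) : homset V 1 -> irreducible V ->
  similar_copy V tetrahedron_vertices \/ similar_copy V cube_vertices \/
  similar_copy V octahedron_vertices \/ similar_copy V icosahedron_vertices \/
  similar_copy V cuboctahedron_vertices.
Proof.
move=> hV irrV; have [v vV] := hs_nonempty hV.
have [w wV vw] : exists2 w, w \in V & v != w.
  have [w [x [wV xV t0]]] := hs_basis hV vV; exists w => //.
  apply: contraNneq t0 => <-; rewrite /triple (_ : cross v v = 0) ?dot0l //.
  by apply: dot_eq0; rewrite dot_cross subrr.
pose pairs := [seq p <- [seq (x, y) | x <- V, y <- V] | p.1 != p.2].
have vwP : (v, w) \in pairs by rewrite mem_filter vw; apply/allpairsP; exists (v, w).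
have [[a b] abP abmax] := seq_argmax (fun p : 'rV[R]_3 * 'rV[R]_3 => dot p.1 p.2) vwP.
move: abP; rewrite mem_filter /= => /andP[ab /allpairsP[[a' b'] /= [aV bV [? ?]]]]; subst a' b'.
have c_max x y : x \in V -> y \in V -> x != y -> dot x y <= dot a b.
  move=> xV yV xy; apply: (abmax (x, y)).
  by rewrite mem_filter xy; apply/allpairsP; exists (x, y).
have c_pair : exists v w, [/\ v \in V, w \in V, v != w & dot v w = dot a b] by exists a, b.
have sz x : x \in V -> size (nbrs V (dot a b) x) = size (nbrs V (dot a b) v).
  by move=> xV; apply: nbrs_size hV _ _ _ xV vV.
have s1 := nbrs_gt1 hV irrV c_max c_pair vV; have s2 := nbrs_neq2 hV irrV c_max c_pair vV.
have s6 := deg_lt6 hV c_max c_pair vV.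
case E: (size _) s1 s2 s6 sz => [|[|[|[|[|[|n]]]]]] // _ _ _ sz.
- have [h|h] := deg3_copy hV irrV c_max c_pair sz; first by left.
  by right; left.
- have [h|[h|h]] := deg4_values hV c_max c_pair sz.
  + by do 2!right; left; apply: octahedron_copy hV _ c_max c_pair sz h.
  + by do 4!right; apply: cuboctahedron_copy hV _ c_max c_pair sz h.
  by case: (deg4_not_icosidodecahedron hV c_max c_pair sz h).
by do 3!right; left; apply: icosahedron_copy hV _ c_max c_pair sz.
Qed.

(** * Two layers in the reducible case *)

Section Reducible.
Context {R : realType}.
Implicit Types (x y : 'rV[R]_3) (g : 'M[R]_3).
Variables (V : seq 'rV[R]_3) (q : R).
Hypothesis hV : homset V q.
Variable u : 'rV[R]_3.
Hypothesis uu : dot u u = 1.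
Hypothesis ufix : forall g, is_sym V g -> u *m g = u \/ u *m g = - u.

Lemma height_exists : exists2 h, 0 < h & {in V, forall x, dot x u = h \/ dot x u = - h}.
Proof.
have u0 : u != 0.
  by apply/eqP => u0; move: uu; rewrite u0 dot0l => /esym/eqP; rewrite oner_eq0.
have [x xV xu] := hs_exists_out hV u0; exists `|dot x u|; first by rewrite normr_gt0.
move=> y yV; have [g sg [xg _]] := hs_swap hV xV yV.
have e : dot y (u *m g) = dot x u by rewrite -xg dot_mulmx // sg.1.
case: (ufix sg) e => -> e; move: e; rewrite ?dotNr => e.
  by rewrite e; case: (ger0P (dot x u)) => _; [left|right]; rewrite ?opprK.
have -> : dot y u = - dot x u by rewrite -e opprK.
by case: (ger0P (dot x u)) => _; [right|left]; rewrite ?opprK.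
Qed.

Variable h : R.
Hypothesis h0 : 0 < h.
Hypothesis hs : {in V, forall x, dot x u = h \/ dot x u = - h}.

Lemma height_neq0 x : x \in V -> dot x u != 0.
Proof. by move=> /hs[] ->; rewrite ?oppr_eq0 gt_eqF. Qed.

Lemma height_fix g x : is_sym V g -> x \in V -> dot (x *m g) u = dot x u -> u *m g = u.
Proof.
move=> sg xV e; case: (ufix sg) => // ug; have := dot_mulmx x u sg.1.
rewrite ug dotNr e => /eqP; rewrite eq_sym -subr_eq0 opprK -mulr2n mulrn_eq0 /=.
by rewrite (negbTE (height_neq0 xV)).
Qed.

Lemma height_flip g x : is_sym V g -> x \in V -> dot (x *m g) u = - dot x u -> u *m g = - u.
Proof.
move=> sg xV e; case: (ufix sg) => // ug; have := dot_mulmx x u sg.1.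
rewrite ug e => /eqP; rewrite eq_sym -subr_eq0 opprK -mulr2n mulrn_eq0 /=.
by rewrite (negbTE (height_neq0 xV)).
Qed.

(** Symmetries keep u up to sign, so they cannot send a pair of equal heights to one of different
    heights. This becomes the disjointness of the distance sets of prisms and antiprisms. *)
Lemma height_separated x x' y y' : x \in V -> x' \in V -> y \in V -> y' \in V ->
  dot x u = dot x' u -> dot y u != dot y' u -> dot x x' != dot y y'.
Proof.
move=> xV x'V yV y'V xx' yy'; apply/eqP => e.
have [g sg [xg x'g]] := hs_pair hV xV x'V yV y'V e; case/eqP: yy'.
have e1 := dot_mulmx x u sg.1; have e2 := dot_mulmx x' u sg.1.
rewrite xg in e1; rewrite x'g in e2.
by case: (ufix sg) e1 e2 => ->; rewrite ?dotNr; move: xx'; lra.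
Qed.

Definition layer s := [seq x <- V | dot x u == s].

Lemma layerP {s x} : reflect (x \in V /\ dot x u = s) (x \in layer s).
Proof. by rewrite mem_filter andbC; apply: (iffP andP) => -[? /eqP]. Qed.

Lemma layer_uniq s : uniq (layer s).
Proof. by rewrite filter_uniq // (hs_uniq hV). Qed.

Lemma layers_nonempty : (exists x, x \in layer h) /\ (exists x, x \in layer (- h)).
Proof.
have sum0 : \sum_(x <- V) dot x u = 0 by rewrite -dot_suml (hs_sum hV) dot0l.
have [v vV] := hs_nonempty hV.
have key s : {in V, forall x, dot x u = s} -> s = 0.
  move=> sV; move: sum0; rewrite (eq_big_seq (fun=> s)) // big_const_seq count_predT iter_addr_0.
  by move=> /eqP; rewrite mulrn_eq0; case: (V) vV => //= a t _ /eqP.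
split; apply: contrapT => no.
  have := key (- h); rewrite -[RHS]oppr0 => /(_ _)/oppr_inj hh.
  move: h0; rewrite hh ?ltxx // => x xV; case: (hs xV) => // e.
  by case: no; exists x; apply/layerP.
move: h0; rewrite (key h) ?ltxx // => x xV; case: (hs xV) => // e.
by case: no; exists x; apply/layerP.
Qed.

Lemma flip_exists : exists2 g, is_sym V g & u *m g = - u.
Proof.
have [[x /layerP[xV xh]] [y /layerP[yV yh]]] := layers_nonempty.
have [g sg [xg _]] := hs_swap hV xV yV; exists g => //.
by apply: (height_flip sg xV); rewrite xg yh xh.
Qed.

Lemma layer_flip g s x : is_sym V g -> u *m g = - u -> x \in layer s -> x *m g \in layer (- s).
Proof.
move=> sg ug /layerP[xV xs]; apply/layerP; split; first exact: sg.2.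
by rewrite -xs -(dot_mulmx x u sg.1) ug dotNr opprK.
Qed.

Lemma layer_fix g s x : is_sym V g -> u *m g = u -> x \in layer s -> x *m g \in layer s.
Proof.
move=> sg ug /layerP[xV xs]; apply/layerP; split; first exact: sg.2.
by rewrite -xs -(dot_mulmx x u sg.1) ug.
Qed.

Lemma layer_size : size (layer (- h)) = size (layer h).
Proof.
have [g sg ug] := flip_exists.
have le s : (size (layer s) <= size (layer (- s)))%N.
  rewrite -(size_map (fun z => z *m g)); apply: uniq_leq_size.
    by rewrite map_inj_uniq ?layer_uniq //; apply: orth_inj; case: sg.
  by move=> _ /mapP[w wN ->]; apply: layer_flip.
by apply/eqP; rewrite eqn_leq le -{2}(opprK h) le.
Qed.

Lemma layer_sizeD : size V = (size (layer h) + size (layer h))%N.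
Proof.
rewrite -{2}layer_size !size_filter -(count_predC (fun x => dot x u == h)); congr (_ + _)%N.
have hN : (h == - h) = false.
  by apply/negbTE/eqP => e; have : 0 < h + h by [rewrite addr_gt0]; rewrite {2}e subrr ltxx.
by apply: eq_in_count => x xV /=; case: (hs xV) => ->; rewrite ?eqxx ?(eq_sym (- h)) hN.
Qed.

Lemma radius_exists : exists2 r, 0 < r & q = r ^+ 2 + h ^+ 2.
Proof.
have [v vV] := hs_nonempty hV; have [w [x [wV xV t0]]] := hs_basis hV vV.
have par y : y \in V -> dot (y - dot y u *: u) (y - dot y u *: u) = q - h ^+ 2.
  move=> yV; rewrite !dotE (dotC u y) uu (hs_norm hV yV).
  by case: (hs yV) => ->; ring.
have r2 : 0 < q - h ^+ 2.
  rewrite lt_neqAle -(par _ vV) dot_ge0 andbT; apply/eqP => e.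
  have z y : y \in V -> y = dot y u *: u.
    by move=> yV; apply/eqP; rewrite -subr_eq0; apply/eqP/dot_eq0; rewrite par // -(par _ vV).
  move: t0; rewrite (z _ vV) (z _ wV) /triple (_ : cross _ _ = 0) ?dot0l ?eqxx //.
  by apply: rV3P; rewrite !mxE /=; ring.
exists (Num.sqrt (q - h ^+ 2)); first by rewrite sqrtr_gt0.
by rewrite sqr_sqrtr ?ltW // subrK.
Qed.

Lemma layer_size_gt1 : (1 < size (layer h))%N.
Proof.
have [v vV] := hs_nonempty hV; have [w [x [wV xV t0]]] := hs_basis hV vV.
have : (2 < size V)%N.
  apply: (@uniq_leq_size _ [:: v; w; x]); last first.
    by move=> y; rewrite !inE => /or3P[]/eqP->.
  have nz (a b c : 'rV[R]_3) : triple a b c != 0 -> [/\ a != b, a != c & b != c].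
    rewrite /triple => t; split; apply: contraNneq t => ->.
    - by rewrite (_ : cross b b = 0) ?dot0l //; apply: dot_eq0; rewrite dot_cross subrr.
    - by rewrite dot_crossl.
    by rewrite dot_crossr.
  by have [vw vx wx] := nz _ _ _ t0; rewrite /= !inE !negb_or vw vx wx.
by rewrite layer_sizeD; case: (size _) => [|[|]].
Qed.

Lemma layer_swap s x y : x \in layer s -> y \in layer s ->
  exists g, [/\ is_sym V g, u *m g = u, x *m g = y & y *m g = x].
Proof.
move=> /layerP[xV xs] /layerP[yV ys]; have [g sg [xg yg]] := hs_swap hV xV yV.
by exists g; split=> //; apply: (height_fix sg xV); rewrite xg xs ys.
Qed.

Variable r : R.
Hypothesis r0 : 0 < r.
Hypothesis qE : q = r ^+ 2 + h ^+ 2.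
Hypothesis n3 : (2 < size (layer h))%N.
Let n := size (layer h).

Lemma dot_level x : x \in V -> dot x x = r ^+ 2 + dot x u ^+ 2.
Proof. by move=> xV; rewrite (hs_norm hV xV) qE; case: (hs xV) => ->; rewrite ?sqrrN. Qed.

Lemma layer_circle : exists e1 e2, frame e1 e2 u /\
  (let C := [seq pcoord r e1 e2 x | x <- layer h] in
    (forall z : R[i], (z \in C) = (z ^+ n == 1)) \/
    (exists y : R[i], [/\ y ^+ 2 != 1, y ^+ 2 != -1, n = 4 & C =i [:: 1; -1; y; - y]])).
Proof.
have [[x0 x0L] _] := layers_nonempty.
have lv : {in layer h, forall x, dot x u = h /\ dot x x = q}.
  by move=> x /layerP[xV xh]; rewrite (hs_norm hV xV).
have rr : r ^+ 2 = q - h ^+ 2 by rewrite qE addrK.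
have sw : {in layer h &, forall x y, exists g, [/\ g *m g^T = 1%:M, u *m g = u,
    {in layer h, forall z, z *m g \in layer h}, x *m g = y & y *m g = x]}.
  move=> x y xL yL; have [g [sg ug xg yg]] := layer_swap xL yL.
  by exists g; split=> //; [exact: sg.1|move=> z; apply: layer_fix].
have [e1 [e2 [f _ alt]]] := circle_level (layer_uniq h) x0L n3 uu lv r0 rr sw.
by exists e1, e2.
Qed.

Section WithFrame.
Variables e1 e2 : 'rV[R]_3.
Hypothesis f : frame e1 e2 u.
Let pc := pcoord r e1 e2.
Let C := [seq pc x | x <- layer h].
Let D := [seq pc x | x <- layer (- h)].

Lemma mem_layer s z : (z \in [seq pc x | x <- layer s]) =
  (level_point u e1 e2 s r z \in layer s).
Proof.
apply/mapP/idP => [[x /layerP[xV xs] ->]|zL].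
  by apply/layerP; rewrite -xs level_pcoord.
by exists (level_point u e1 e2 s r z); rewrite // /pc pcoord_level.
Qed.

Lemma layer_map_uniq s : uniq [seq pc x | x <- layer s].
Proof.
rewrite map_inj_in_uniq ?layer_uniq // => x y /layerP[_ xs] /layerP[_ ys].
by apply: (pcoord_inj r0 f); rewrite xs ys.
Qed.

(** A symmetry exchanging two points of one layer fixes u and therefore reflects the other layer
    too. *)
Lemma layer_reflect a b z s s' : a \in [seq pc x | x <- layer s] ->
  b \in [seq pc x | x <- layer s] -> b != a -> b != - a ->
  z \in [seq pc x | x <- layer s'] -> a * b / z \in [seq pc x | x <- layer s'].
Proof.
move=> /mapP[x xL ->] /mapP[y yL ->] ba bNa /mapP[p pL ->].
have [g [sg ug xg yg]] := layer_swap xL yL.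
have [xV _] := layerP xL; have [pV _] := layerP pL.
rewrite -(pcoord_reflect r0 f sg.1 ug xg yg (dot_level xV) (dot_level pV) ba bNa).
by apply: map_f; apply: layer_fix.
Qed.

Lemma mem_V x : (x \in V) = (x \in layer h) || (x \in layer (- h)).
Proof.
apply/idP/orP => [xV|[]/layerP[] //].
by case: (hs xV) => e; [left|right]; apply/layerP.
Qed.

Lemma size_D : size D = n.
Proof. by rewrite size_map layer_size. Qed.

Lemma cis_neq0 (a : R) : cis a != 0.
Proof.
apply/eqP => -[c0 s0]; have := cos2Dsin2 a; rewrite c0 s0 expr0n /= addr0.
by move/esym/eqP; rewrite oner_eq0.
Qed.

(** The rotations of the upper layer act on the lower one, so D is a coset z0 C. The reflection
    exchanging 1 and w sends z0 to w / z0, so z0^2 is an n-th root of unity and z0 is a power of cis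
    (pi / n); its parity decides between prism and antiprism. *)
Lemma regular_layers : (forall z : R[i], (z \in C) = (z ^+ n == 1)) ->
  (forall z, (z \in D) = (z \in C)) \/ (forall z, (z \in D) = (z / cis (pi / n%:R) \in C)).
Proof.
move=> CE; have n0 : (0 < n)%N by apply: leq_trans n3.
have nR : n%:R != 0 :> R by rewrite pnatr_eq0 -lt0n.
pose w : R[i] := cis (2 * pi / n%:R); have wp : n.-primitive_root w := cis_prim n0.
have wn := prim_expr_order wp.
have wC k : w ^+ k \in C by rewrite CE -exprM mulnC exprM wn expr1n.
have w1 : w != 1.
  apply/eqP => w1; have := prim_order_dvd wp 1; rewrite expr1 w1 eqxx.
  by rewrite dvdn1 => /eqP n1; move: n3; rewrite -/n n1.
have wN1 : w != -1.
  apply/eqP => w1'; have := prim_order_dvd wp 2; rewrite w1' sqrrN expr1n eqxx.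
  by move=> h2; have := dvdn_leq (isT : (0 < 2)%N) h2; rewrite leqNgt n3.
have w0 : w != 0 by exact: cis_neq0.
(* The pairs 1, w and w, w^2 of the upper layer are isometric; a symmetry between them is
   multiplication by w on both layers. *)
have mulw z : z \in D -> w * z \in D.
  move=> /mapP[p pL ->].
  have /mapP[x xL xE] := wC 0; have /mapP[y yL yE] := wC 1; have /mapP[y' y'L y'E] := wC 2.
  have [xV xs] := layerP xL; have [yV ys] := layerP yL.
  have [y'V y's] := layerP y'L; have [pV _] := layerP pL.
  have xy : dot x y = dot y y'.
    rewrite (dot_pcoord r0 f x (dot_level yV)) (dot_pcoord r0 f y (dot_level y'V)) xs ys y's.
    rewrite -/pc -xE -yE -y'E; congr (_ * Re _ + _).
    by field.
  have [g sg [xg yg]] := hs_pair hV xV yV yV y'V xy.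
  have ug : u *m g = u by apply: (height_fix sg xV); rewrite xg ys xs.
  rewrite -(pcoord_rotate r0 f sg.1 ug (dot_level xV) (dot_level yV) (dot_level pV)) ?xg ?yg.
  - by apply: map_f; apply: layer_fix.
  - by rewrite -/pc -xE -yE mulr1.
  - by rewrite -/pc -y'E -yE expr1 -expr2.
  - by rewrite -/pc -yE -xE.
  by rewrite -/pc -yE -xE.
have mulwk k z : z \in D -> w ^+ k * z \in D.
  by elim: k => [|k IH] zD; rewrite ?mul1r // exprS -mulrA mulw // IH.
have [z0 z0D] : exists z, z \in D.
  by have [_ [x xL]] := layers_nonempty; exists (pc x); apply: map_f.
have z00 : z0 != 0.
  have /mapP[x xL ->] := z0D; have [xV _] := layerP xL.
  exact: (pcoord_neq0 r0 f (dot_level xV)).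
have DE z : (z \in D) = (z / z0 \in C).
  have sub : {subset [seq w * z0 | w <- C] <= D}.
    move=> _ /mapP[a aC ->]; move: aC; rewrite CE => /eqP /(prim_rootP wp)[k ->].
    exact: mulwk.
  have uCz : uniq [seq a * z0 | a <- C].
    by rewrite map_inj_uniq ?layer_map_uniq //; apply: mulIf.
  have [] := uniq_min_size uCz sub; first by rewrite size_D 2!size_map.
  move=> _ <-; apply/mapP/idP => [[a aC ->]|zC]; first by rewrite mulfK.
  by exists (z / z0); rewrite // mulfVK.
have refl : w / z0 \in D.
  have := @layer_reflect 1 w z0 h (- h); rewrite mul1r; apply=> //.
  - by rewrite -[1](expr0 w) wC.
  - by rewrite -[w in w \in _]expr1 wC.
have z2n : z0 ^+ (n * 2) = 1.
  move: refl; rewrite DE CE !exprMn !exprVn wn mul1r -expr2 => /eqP h1.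
  by apply: invr_inj; rewrite invr1 -h1 exprM !exprVn.
have n20 : (0 < n * 2)%N by rewrite muln_gt0 n0.
have [j j2 zj] := unity_cis n20 z2n.
have zjE : z0 = cis (pi / n%:R) ^+ j.
  rewrite zj cisX; congr cis; rewrite natrM; field; exact: nR.
have c2 : cis (pi / n%:R) ^+ 2 = w by rewrite cisX; congr cis; field.
have jE := odd_double_half j; rewrite -jE exprD -muln2 mulnC exprM c2 in zjE.
have Cmul a : forall z, (z * (w ^+ a)^-1 \in C) = (z \in C).
  by move=> z; rewrite !CE exprMn exprVn -exprM mulnC exprM wn expr1n invr1 mulr1.
case: (odd j) zjE => /= zjE; [right|left] => z; rewrite DE zjE ?expr1 ?expr0 ?mul1r.
  by rewrite invfM mulrA Cmul.
by rewrite Cmul.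
Qed.

Lemma sqrN1_Re (z : R[i]) : z ^+ 2 = -1 -> Re z = 0.
Proof.
case: z => a b; rewrite expr2 => -[/= e1' e2'].
have /eqP : a * b = 0 by lra.
rewrite mulf_eq0 => /orP[/eqP//|/eqP b0]; rewrite b0 in e1'.
by have := sqr_ge0 a; lra.
Qed.

(** * Rectangular layers that are not squares *)

Section Rectangle.
Variable y : R[i].
Hypotheses (y1 : y ^+ 2 != 1) (yN1 : y ^+ 2 != -1) (n4 : n = 4).
Hypothesis CE : C =i [:: 1; -1; y; - y].

Let rect_opp s x : dot x u = s -> pc ((2 * s) *: u - x) = - pc x.
Proof.
have [e11 e22 _ [e12 e1u e2u]] := f.
by move=> xs; apply/eqP; rewrite eq_complex /= !dotE (dotC u e1) (dotC u e2) e1u e2u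
  !mulr0 !add0r !mulNr !eqxx.
Qed.

Let C_opp x : x \in layer h -> (2 * h) *: u - x \in layer h.
Proof.
move=> xL; have [xV xh] := layerP xL.
have : - pc x \in C by have := map_f pc xL; rewrite -/C !CE !inE => /or4P[]/eqP->; rewrite ?opprK eqxx ?orbT.
rewrite /C mem_layer -(rect_opp xh); set z := _ - x.
by have zh : dot z u = h; [rewrite /z !dotE uu xh; ring|rewrite -{1}zh level_pcoord].
Qed.

(** A symmetry exchanging the layers carries the half-turn of the upper one to the lower one. *)
Let D_opp z : z \in D -> - z \in D.
Proof.
have [g sg ug] := flip_exists; have sg' := sym_tr (hs_uniq hV) sg.
have ug' : u *m g^T = - u.
  have e : u = - u *m g by rewrite mulNmx ug opprK.
  by rewrite {1}e mulmx_orthK ?sg.1.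
move=> /mapP[p pL ->]; have [pV ph] := layerP pL.
have := layer_flip sg' ug' pL; rewrite opprK => /C_opp /(layer_flip sg ug).
rewrite mulmxBl -scalemxAl ug mulmx_orthVK ?sg.1 // => oL.
have := map_f pc oL; rewrite (_ : _ - p = (2 * - h) *: u - p) ?(rect_opp ph) //.
by rewrite scalerN mulrN scaleNr.
Qed.

Let unit_layer s z : z \in [seq pc x | x <- layer s] ->
  Re z ^+ 2 + Im z ^+ 2 = 1.
Proof.
move=> /mapP[p /layerP[pV _] ->]; exact: (pcoord_unit r0 f (dot_level pV)).
Qed.

Let y0 : y != 0.
Proof.
have : y \in C by rewrite CE !inE eqxx !orbT.
by move=> /mapP[p /layerP[pV _] ->]; exact: (pcoord_neq0 r0 f (dot_level pV)).
Qed.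

Let one_y : y != 1 /\ y != -1.
Proof. by split; apply: contra y1 => /eqP ->; rewrite ?sqrrN expr1n. Qed.

(** The upper point 1 is equidistant from z and - z. A symmetry fixing it and exchanging these sends
    y to y or to its inverse. In the first case y is real, hence 1 or -1; in the second the inverse
    lies in C, and y^2 is 1 or -1. *)
Let rect_noi z : z ^+ 2 = -1 -> z \in D -> False.
Proof.
move=> z2 zD; have zND := D_opp zD; have [ny1 nyN1] := one_y.
have zinv : z^-1 = - z.
  have z0 : z != 0 by apply/eqP => z0; move: z2; rewrite z0 expr0n /= => /esym/eqP; rewrite oppr_eq0 oner_eq0.
  by apply: (mulfI z0); rewrite mulfV // mulrN -expr2 z2 opprK.
have [/mapP[Z ZL ZE] /mapP[Z' Z'L Z'E]] := (zD, zND).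
have /mapP[X XL XE] : 1 \in C by rewrite CE !inE eqxx.
have /mapP[Y YL YE] : y \in C by rewrite CE !inE eqxx !orbT.
have [[ZV Zh] [Z'V Z'h]] := (layerP ZL, layerP Z'L).
have [[XV Xh] [YV Yh]] := (layerP XL, layerP YL).
have XZ : dot X Z = dot X Z'.
  rewrite (dot_pcoord r0 f X (dot_level ZV)) (dot_pcoord r0 f X (dot_level Z'V)).
  rewrite -/pc -XE -ZE -Z'E Zh Z'h !mul1r invrN zinv opprK.
  by have := sqrN1_Re z2; case: (z) => a b /= ->; rewrite oppr0.
have [g sg [Xg Zg Z'g]] := hs_fix_swap hV XV ZV Z'V XZ.
have ug : u *m g = u by apply: (height_fix sg XV); rewrite Xg.
have YgL := layer_fix sg ug YL; have [YgV Ygh] := layerP YgL.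
have rn2 : r ^+ 2 != 0 by rewrite sqrf_eq0 gt_eqF.
have e1' : Re (pc (Y *m g)) = Re y.
  have := dot_mulmx Y X sg.1; rewrite Xg (dot_pcoord r0 f Y (dot_level XV)).
  rewrite (dot_pcoord r0 f (Y *m g) (dot_level XV)) -/pc -XE -YE Ygh Yh !divr1.
  by move=> /addIr /(mulfI rn2).
have e2' : Re (- (pc (Y *m g) * z)) = Re (y * z).
  have := dot_mulmx Y Z' sg.1; rewrite Z'g (dot_pcoord r0 f Y (dot_level Z'V)).
  rewrite (dot_pcoord r0 f (Y *m g) (dot_level ZV)) -/pc -ZE -Z'E -YE Ygh Yh Zh Z'h.
  by rewrite invrN zinv opprK mulrN => /addIr /(mulfI rn2).
have [e|e] := unit_Re (unit_layer (map_f pc YL)) (unit_layer (map_f pc YgL)) (etrans e1' (congr1 _ YE)).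
  have : Re (y * z) = 0.
    have : - Re (y * z) = Re (y * z).
      by rewrite -[RHS]e2' e -YE; case: (y * z).
    by move=> h2; lra.
  move: z2 (sqrN1_Re z2) => z2' zr yz.
  have b0 : Im y = 0.
    move: zr z2' yz; case: (z) => p s; case: (y) => a b /= ->; rewrite expr2 => -[/= E1 _] E2.
    have bs : b * s = 0 by lra.
    have ss : s * s = 1 by lra.
    by rewrite -[b]mulr1 -ss mulrA bs mul0r.
  move: (unit_layer (map_f pc YL)); rewrite -YE b0 expr0n addr0 => /eqP.
  move: b0; rewrite sqrf_eq1; move: ny1 nyN1; case: (y) => a b /= n1 n2 b0.
  by rewrite b0 in n1 n2 *; case/orP => /eqP e'; [case/eqP: n1|case/eqP: n2]; rewrite e' //;
    apply/eqP; rewrite eq_complex /= oppr0 !eqxx.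
move: (map_f pc YgL); rewrite -/C e -YE CE !inE => /or4P[]/eqP e3.
- by case/eqP: ny1; apply: invr_inj; rewrite e3 invr1.
- by case/eqP: nyN1; apply: invr_inj; rewrite e3 invrN invr1.
- by case/eqP: y1; rewrite expr2 -[X in X * _]e3 mulVf ?y0.
by case/eqP: yN1; rewrite expr2 -[X in X * _]opprK -e3 mulNr mulVf ?y0.
Qed.

(** A symmetry exchanging the layers sends 1 and y to a and b with a / b equal to y or its inverse,
    and D consists of a, b and their negatives. The reflection z |-> y / z preserves D and gives y =
    a b or y = - a b. So a^2 or b^2 is 1 or -1; [rect_noi] excludes -1, and D contains 1 and then
    y. *)
Lemma rectangular_layers : forall z, (z \in D) = (z \in C).
Proof.
have [ny1 nyN1] := one_y.
have /mapP[X XL XE] : 1 \in C by rewrite CE !inE eqxx.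
have /mapP[Y YL YE] : y \in C by rewrite CE !inE eqxx !orbT.
have [[XV Xh] [YV Yh]] := (layerP XL, layerP YL).
have [g sg ug] := flip_exists.
have XgL := layer_flip sg ug XL; have YgL := layer_flip sg ug YL.
have [[XgV Xgh] [YgV Ygh]] := (layerP XgL, layerP YgL).
have aD := map_f pc XgL; have bD := map_f pc YgL.
have rn2 : r ^+ 2 != 0 by rewrite sqrf_eq0 gt_eqF.
have ReE : Re (pc (X *m g) / pc (Y *m g)) = Re (y^-1).
  have := dot_mulmx X Y sg.1; rewrite (dot_pcoord r0 f _ (dot_level YgV)).
  rewrite (dot_pcoord r0 f X (dot_level YV)) -/pc -XE -YE Xgh Ygh Xh Yh mulrNN.
  by move=> /addIr /(mulfI rn2) ->; rewrite div1r.
have ba : pc (Y *m g) != pc (X *m g).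
  apply: contra ny1 => /eqP e; have : Y *m g = X *m g.
    by apply: (pcoord_inj r0 f _ e); rewrite Xgh Ygh.
  by move=> /(orth_inj sg.1) e'; rewrite YE e' -XE.
have baN : pc (Y *m g) != - pc (X *m g).
  apply: contra nyN1 => /eqP e; have : Y *m g = ((2 * h) *: u - X) *m g.
    rewrite mulmxBl -scalemxAl ug scalerN -scaleNr -mulrN.
    apply: (pcoord_inj r0 f); last by rewrite -/pc (rect_opp Xgh).
    by rewrite !dotE uu Xgh Ygh; ring.
  by move=> /(orth_inj sg.1) e'; rewrite YE e' (rect_opp Xh) -XE.
set a := pc (X *m g) in aD ReE ba baN; set b := pc (Y *m g) in bD ReE ba baN.
have a0 : a != 0 by exact: (pcoord_neq0 r0 f (dot_level XgV)).
have b0 : b != 0 by exact: (pcoord_neq0 r0 f (dot_level YgV)).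
have Dab : D =i [:: a; - a; b; - b].
  have nN (z : R[i]) : z != 0 -> z != - z.
    by move=> z0; rewrite -subr_eq0 opprK -mulr2n mulrn_eq0.
  have e : (a == - b) = (b == - a) by rewrite -eqr_oppLR eq_sym.
  have uL : uniq [:: a; - a; b; - b].
    rewrite /= !inE !negb_or e eqr_opp (eq_sym a b) (eq_sym (- a) b) (negbTE ba) (negbTE baN).
    by rewrite !nN.
  have sL : {subset [:: a; - a; b; - b] <= D}.
    by move=> z; rewrite !inE => /or4P[]/eqP->; rewrite ?D_opp.
  have := uniq_min_size uL sL; rewrite size_D n4 => /(_ isT)[_ hh] z; exact/esym/hh.
have reflD z : z \in D -> y / z \in D.
  move=> zD; have := @layer_reflect 1 y z h (- h); rewrite mul1r; apply=> //.
  - by rewrite -/C CE !inE eqxx.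
  - by rewrite -/C CE !inE eqxx !orbT.
have Uy : Re y^-1 ^+ 2 + Im y^-1 ^+ 2 = 1.
  have yC : y \in C by rewrite CE !inE eqxx !orbT.
  have := unit_layer yC; case: (y) => p s U.
  by rewrite unit_inv //= sqrrN.
have Uab : Re (a / b) ^+ 2 + Im (a / b) ^+ 2 = 1.
  have := unit_layer aD; have := unit_layer bD; case: (a) => p s; case: (b) => p' s'.
  move=> U U'; rewrite /= in U U'; rewrite unit_inv //=.
  have -> : (p * p' - s * - s') ^+ 2 + (p * - s' + s * p') ^+ 2 =
    (p ^+ 2 + s ^+ 2) * (p' ^+ 2 + s' ^+ 2) by ring.
  by rewrite U U' mulr1.
have abE : a / b = y^-1 \/ a / b = y.
  by have [->|->] := unit_Re Uy Uab ReE; [left|right; rewrite invrK].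
(* Otherwise y is both a^2 and b^2 up to sign. Equal signs contradict that b differs from a and - a;
   opposite signs give (a / b)^2 = -1 and so y^2 = -1. *)
have prod : y = a * b \/ y = - (a * b).
  have yE (z w : R[i]) : z != 0 -> y / z = w -> y = w * z by move=> z0 <-; rewrite mulfVK.
  have := reflD _ aD; rewrite Dab !inE => /or4P[]/eqP /(yE _ _ a0) ya.
  - have := reflD _ bD; rewrite Dab !inE => /or4P[]/eqP /(yE _ _ b0) yb.
    + by left.
    + by right; rewrite yb mulNr.
    + have : b ^+ 2 = a ^+ 2 by rewrite !expr2 -ya -yb.
      by move/eqP; rewrite eqf_sqr (negbTE ba) (negbTE baN).
    + have e : (a / b) ^+ 2 = -1.
        rewrite exprMn exprVn; have -> : a ^+ 2 = - b ^+ 2 by rewrite !expr2 -ya yb mulNr.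
        by rewrite mulNr mulfV // sqrf_eq0.
      case/eqP: yN1; case: abE => e'; rewrite e' in e => //.
      by apply: invr_inj; rewrite -exprVn e invrN invr1.
  - have := reflD _ bD; rewrite Dab !inE => /or4P[]/eqP /(yE _ _ b0) yb.
    + by left.
    + by right; rewrite yb mulNr.
    + have e : (a / b) ^+ 2 = -1.
        rewrite exprMn exprVn; have -> : a ^+ 2 = - b ^+ 2 by rewrite !expr2 -yb ya mulNr opprK.
        by rewrite mulNr mulfV // sqrf_eq0.
      case/eqP: yN1; case: abE => e'; rewrite e' in e => //.
      by apply: invr_inj; rewrite -exprVn e invrN invr1.
    + have : b ^+ 2 = a ^+ 2 by apply: oppr_inj; rewrite !expr2 -!mulNr -ya -yb.
      by move/eqP; rewrite eqf_sqr (negbTE ba) (negbTE baN).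
  - by left; rewrite ya mulrC.
  by right; rewrite ya mulNr mulrC.
have sq1 : a ^+ 2 = 1 \/ b ^+ 2 = 1.
  have aE (z : R[i]) : a / b = z -> a = z * b by move=> <-; rewrite mulfVK.
  case: prod => yE; case: abE => /aE e.
  - by left; rewrite expr2 {2}e mulrCA -yE mulVf.
  - right; apply: (mulfI a0); rewrite mulr1 {2}e yE expr2; ring.
  - have : a ^+ 2 = -1 by rewrite expr2 {2}e mulrCA -[a * b]opprK -yE mulrN mulVf.
    by move/rect_noi/(_ aD).
  have : b ^+ 2 = -1 by apply: (mulfI a0); rewrite mulrN1 {2}e yE expr2; ring.
  by move/rect_noi/(_ bD).
have oneD : 1 \in D.
  have sq z : z \in D -> z ^+ 2 = 1 -> 1 \in D.
    move=> zD /eqP; rewrite sqrf_eq1 => /orP[]/eqP e; first by rewrite -e.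
    by rewrite -[1]opprK -e D_opp.
  by case: sq1; apply: sq.
have yD : y \in D by have := reflD _ oneD; rewrite divr1.
have sub : {subset C <= D}.
  by move=> z; rewrite CE !inE => /or4P[]/eqP->; rewrite ?D_opp.
have := uniq_min_size (layer_map_uniq h) sub; rewrite size_D size_map => /(_ (leqnn _))[_ hh] z.
exact/esym/hh.
Qed.

End Rectangle.

End WithFrame.
End Reducible.

(** * Vertex sets of prisms, antiprisms and boxes *)

Section Shape.
Context {R : realType}.
Implicit Types (u x y : 'rV[R]_3) (V : seq 'rV[R]_3).

Definition separated V u : Prop := forall x x' y y',
  x \in V -> x' \in V -> y \in V -> y' \in V ->
  dot x u = dot x' u -> dot y u != dot y' u -> dot x x' != dot y y'.

Definition prism_shape V u (h : R) : Prop := exists n e1 e2 (r : R),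
  [/\ (3 <= n)%N, frame e1 e2 u, 0 < r & forall x, x \in V <->
    exists k s, [/\ (k < n)%N, s = h \/ s = - h &
      x = level_point u e1 e2 s r (cis (2 * pi * k%:R / n%:R))]].

(** Antiprisms over a segment have four vertices and are treated as tetrahedra. *)
Definition antiprism_shape V u (h : R) : Prop := exists n e1 e2 (r : R),
  [/\ (3 <= n)%N, frame e1 e2 u, 0 < r & forall x, x \in V <->
    exists2 k, (k < n)%N &
      x = level_point u e1 e2 h r (cis (2 * pi * k%:R / n%:R)) \/
      x = level_point u e1 e2 (- h) r (cis (pi / n%:R + 2 * pi * k%:R / n%:R))].

(** The parallelepiped centered at 0 with half-edges a1, a2, a3. *)
Definition sign_sums V (a1 a2 a3 : 'rV[R]_3) : Prop := forall x, x \in V <->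
  exists s1 s2 s3 : R, [/\ `|s1| = 1, `|s2| = 1, `|s3| = 1 & x = s1 *: a1 + s2 *: a2 + s3 *: a3].

Definition box_shape V : Prop := exists a1 a2 a3 : 'rV[R]_3,
  [/\ a1 != 0, a2 != 0 & a3 != 0] /\ [/\ dot a1 a2 = 0, dot a1 a3 = 0 & dot a2 a3 = 0] /\
  sign_sums V a1 a2 a3.

Lemma reducible_shape V (q : R) : homset V q -> ~ irreducible V ->
  size V = 4%N \/ exists u h, [/\ dot u u = 1, 0 < h,
    {in V, forall x, dot x u = h \/ dot x u = - h},
    separated V u &
    [\/ prism_shape V u h, antiprism_shape V u h | box_shape V]].
Proof.
move=> hV /(invariant_line)[u uu ufix]; have [h h0 hs] := height_exists hV uu ufix.
have [r r0 qE] := radius_exists hV uu hs.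
have s1 := layer_size_gt1 hV ufix h0 hs; have sD := layer_sizeD hV ufix h0 hs.
have [n3|n2] := ltnP 2 (size (layer V u h)); last first.
  left; rewrite sD; have -> : size (layer V u h) = 2; last by [].
  by apply/eqP; rewrite eqn_leq n2.
right; exists u, h; split=> //.
  by move=> x x' y y' xV x'V yV y'V xx yy; apply: (height_separated hV ufix).
have [e1 [e2 [f alt]]] := layer_circle hV uu ufix h0 hs r0 qE n3.
have n0 : (0 < size (layer V u h))%N by apply: leq_trans n3.
have memV x : (x \in V) = (x \in layer V u h) || (x \in layer V u (- h)).
  exact: (mem_V hs).
have lev x s z : x \in layer V u s -> z = pcoord r e1 e2 x -> x = level_point u e1 e2 s r z.
  by move=> /layerP[_ <-] ->; rewrite level_pcoord.
have memL s z : (z \in [seq pcoord r e1 e2 x | x <- layer V u s]) =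
    (level_point u e1 e2 s r z \in layer V u s) by apply: mem_layer.
case: alt => [CE|[[p s] [y1 yN1 n4 CE]]].
  have := regular_layers hV ufix h0 hs r0 qE n3 f CE.
  set n := size (layer V u h) in CE n3 n0 *; case=> DE.
    constructor 1; exists n, e1, e2, r; split=> // x; rewrite memV; split.
      move=> xL; have [s ss xs] : exists2 s, s = h \/ s = - h & x \in layer V u s.
        by case/orP: xL => ?; [exists h; [left|]|exists (- h); [right|]].
      have zC : pcoord r e1 e2 x ^+ n == 1.
        by rewrite -CE; case: ss xs => -> xs; [|rewrite -DE]; apply: map_f.
      have [k kn kE] := unity_cis n0 (eqP zC).
      by exists k, s; split=> //; apply: lev.
    move=> [k [s [kn [] -> ->]]]; rewrite -!memL; apply/orP; [left|right].
      by rewrite CE cis_unity.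
    by rewrite DE CE cis_unity.
  constructor 2; exists n, e1, e2, r; split=> // x; rewrite memV; split.
    case/orP=> xL.
      have : pcoord r e1 e2 x ^+ n == 1 by rewrite -CE map_f.
      by move=> /eqP /(unity_cis n0)[k kn kE]; exists k => //; left; apply: lev.
    have : (pcoord r e1 e2 x / cis (pi / n%:R)) ^+ n == 1 by rewrite -CE -DE map_f.
    move=> /eqP /(unity_cis n0)[k kn kE]; exists k => //; right; apply: lev => //.
    by rewrite cisD -kE mulrC mulfVK // cis_neq0.
  move=> [k kn [->|->]]; rewrite -!memL; apply/orP; [left|right].
    by rewrite CE cis_unity.
  by rewrite DE cisD mulrAC mulfV ?cis_neq0 // mul1r CE cis_unity.
constructor 3; have DE := rectangular_layers hV uu ufix h0 hs r0 qE f y1 yN1 n4 CE.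
have [e11 e22 _ [e12 e1u e2u]] := f.
have Uy : p ^+ 2 + s ^+ 2 = 1.
  have /mapP[x /layerP[xV _] xE] : Complex p s \in [seq pcoord r e1 e2 x | x <- layer V u h].
    by rewrite CE !inE eqxx !orbT.
  by have := pcoord_unit r0 f (dot_level hV hs qE xV); rewrite -xE.
have [ny1 nyN1] : Complex p s != 1 /\ Complex p s != -1.
  by split; apply: contra y1 => /eqP ->; rewrite ?sqrrN expr1n.
(* The half-sum and half-difference of the horizontal positions of 1 and y; they are orthogonal
   because both positions have length r. *)
pose a1 := (r / 2) *: ((1 + p) *: e1 + s *: e2).
pose a2 := (r / 2) *: ((1 - p) *: e1 - s *: e2); pose a3 := h *: u.
have rn0 : r / 2 != 0 by rewrite gt_eqF // divr_gt0.
have lp0 (a b : R) : a *: e1 + b *: e2 = 0 -> a = 0 /\ b = 0.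
  move=> ab; have := congr1 (dot^~ e1) ab; have := congr1 (dot^~ e2) ab.
  by rewrite !dotE e11 e22 e12 (dotC e2) e12 !mulr0 !mulr1 addr0 add0r.
exists a1, a2, a3; split; [|split].
- split; rewrite scaler_eq0 negb_or ?rn0 /=.
  + apply/eqP => /lp0[h1 h2]; case/eqP: nyN1; apply/eqP; rewrite eq_complex /= h2 oppr0 eqxx andbT.
    by apply/eqP; move: h1; lra.
  + apply/eqP; rewrite -scaleNr => /lp0[h1 h2]; case/eqP: ny1; apply/eqP; rewrite eq_complex /=.
    by apply/andP; split; apply/eqP; lra.
  rewrite gt_eqF //=; apply/eqP => u0; move: uu; rewrite u0 dot0l => /esym/eqP.
  by rewrite oner_eq0.
- split; rewrite !dotE ?(dotC u e1) ?(dotC u e2) ?(dotC e2 e1) ?e11 ?e22 ?e12 ?e1u ?e2u; last 2 first.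
  + by ring.
  + by ring.
  transitivity ((r / 2) ^+ 2 * (1 - (p ^+ 2 + s ^+ 2))); first by ring.
  by rewrite Uy subrr mulr0.
have key (t t1 t2 a b : R) : a = (t1 * (1 + p) + t2 * (1 - p)) / 2 -> b = (t1 - t2) * s / 2 ->
    level_point u e1 e2 (t * h) r (Complex a b) = t1 *: a1 + t2 *: a2 + t *: a3.
  by move=> -> ->; rewrite /level_point /a1 /a2 /a3; apply/rowP => i; rewrite !mxE /=; field.
have [I1 N1] := (normr1 R, normrN1 R).
have one : (1 : R[i]) = Complex 1 0 by [].
have mone : (-1 : R[i]) = Complex (-1) 0 by apply/eqP; rewrite eq_complex /= oppr0 !eqxx.
have my : - Complex p s = Complex (- p) (- s) by [].
move=> x; rewrite memV; split.
  move=> xL; have [t [t1 xs]] : exists t, `|t| = 1 /\ x \in layer V u (t * h).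
    by case/orP: xL => ?; [exists 1; rewrite mul1r|exists (-1); rewrite mulN1r].
  have zC : pcoord r e1 e2 x \in [:: 1; -1; Complex p s; - Complex p s].
    rewrite -CE; case/norm_eq1: t1 => tt; move: xs; rewrite tt ?mul1r ?mulN1r => xs.
      exact: map_f.
    by rewrite -DE map_f.
  move: zC; rewrite !inE one mone my => /or4P[]/eqP/esym zE; rewrite (lev _ _ _ xs zE).
  - by exists 1, 1, t; split=> //; apply: key; field.
  - by exists (-1), (-1), t; split=> //; apply: key; field.
  - by exists 1, (-1), t; split=> //; apply: key; field.
  by exists (-1), 1, t; split=> //; apply: key; field.
move=> [t1 [t2 [t [/norm_eq1 t1E /norm_eq1 t2E /norm_eq1 tE ->]]]].
have [z zC <-] : exists2 z, z \in [:: 1; -1; Complex p s; - Complex p s] &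
    level_point u e1 e2 (t * h) r z = t1 *: a1 + t2 *: a2 + t *: a3.
  rewrite one mone my; case: t1E => ->; case: t2E => ->.
  - by exists (Complex 1 0); [rewrite !inE eqxx|apply: key; field].
  - by exists (Complex p s); [rewrite !inE eqxx !orbT|apply: key; field].
  - by exists (Complex (- p) (- s)); [rewrite !inE eqxx !orbT|apply: key; field].
  by exists (Complex (-1) 0); [rewrite !inE eqxx !orbT|apply: key; field].
apply/orP; case: tE => ->; rewrite ?mul1r ?mulN1r -?memL; [left|right].
  by rewrite CE.
by rewrite DE CE.
Qed.

End Shape.

(** * Convex hulls *)

Section Convex.
Context {R : realType} {n : nat}.
Implicit Types (x y z k : 'rV[R]_n) (S A : set 'rV[R]_n).

Definition convex_closed A : Prop := forall x y (t : R), A x -> A y -> 0 <= t <= 1 ->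
  A (t *: x + (1 - t) *: y).

Lemma convex_closedP A : convex_closed A <-> @convex_set R 'rV[R]_n A.
Proof.
split=> [cA x y l /set_mem Ax /set_mem Ay|cA x y t Ax Ay t01].
  by apply/mem_set; apply: (cA x y l%:num); rewrite // ge0 le1.
have := cA x y (Itv01 (andP t01).1 (andP t01).2) (mem_set Ax) (mem_set Ay).
by move/set_mem.
Qed.

Lemma sub_chull S : S `<=` chull S.
Proof. exact: sub_smallest. Qed.

Lemma chull_convex S : convex_closed (chull S).
Proof.
move=> x y t xS yS t01 A [cA SA].
by apply: ((convex_closedP A).2 cA) => //; [apply: xS|apply: yS].
Qed.

Lemma chull_min S A : convex_closed A -> S `<=` A -> chull S `<=` A.
Proof. by move=> cA; apply: smallest_sub; apply/convex_closedP. Qed.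

Lemma chull_mono S S' : S `<=` S' -> chull S `<=` chull S'.
Proof. by move=> SS'; apply: chull_min (@chull_convex _) _ => x /SS'; apply: sub_chull. Qed.

(** Removing an extreme point from the hull leaves a convex set; if the point is not in S, this
    smaller set still contains S. *)
Lemma vertices_chull S : vertices (chull S) `<=` S.
Proof.
move=> x [xS ext]; apply: contrapT => xnS.
suff : (chull S `\ x) x by case=> _; apply.
apply: (chull_min (A := chull S `\ x)) xS => [y z t [yS yx] [zS zx] /andP[t0 t1]|y Sy].
  split; first by apply: chull_convex; rewrite // t0 t1.
  move=> /= e; have [tt|tn] := boolP (0 < t < 1).
    have yz := ext y z t yS zS tt (esym e); apply: yx => /=.
    by rewrite -e -yz -scalerDl addrC subrK scale1r.
  have : t = 0 \/ t = 1.
    by move: tn; rewrite negb_and -!leNgt => /orP[h|h]; [left|right]; apply/le_anti; rewrite h ?t0 ?t1.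
  case=> tE; rewrite tE in e.
    by apply: zx => /=; rewrite -e scale0r add0r subr0 scale1r.
  by apply: yx => /=; rewrite -e subrr scale0r addr0 scale1r.
by split; [apply: sub_chull|move=> /= yx; apply: xnS; rewrite -yx].
Qed.

(** The union of the segments from x to K. For l = 1 nothing is required of k, so that x belongs to
    it even if K is empty. *)
Definition ray x (K : set 'rV[R]_n) y : Prop := exists (l : R) k,
  [/\ 0 <= l, l <= 1, l < 1 -> K k & y = l *: x + (1 - l) *: k].

(** The alternative is whether the total weight on K vanishes. One computation serves twice: for the
    convexity of [ray] and for the extremality of x outside K. *)
Lemma ray_comb x K y z (t : R) : convex_closed K -> ray x K y -> ray x K z -> 0 <= t <= 1 ->
  t *: y + (1 - t) *: z = x /\ (0 < t < 1 -> y = x /\ z = x) \/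
  exists (w : R) k, [/\ 0 < w, w <= 1, K k & t *: y + (1 - t) *: z = (1 - w) *: x + w *: k].
Proof.
move=> cK [l [k [l0 l1 Kk ->]]] [m [k' [m0 m1 Kk' ->]]] /andP[t0 t1].
pose a := t * (1 - l); pose b := (1 - t) * (1 - m).
have a0 : 0 <= a by apply: mulr_ge0; lra.
have b0 : 0 <= b by apply: mulr_ge0; lra.
have abE : t *: (l *: x + (1 - l) *: k) + (1 - t) *: (m *: x + (1 - m) *: k') =
    (1 - (a + b)) *: x + (a *: k + b *: k').
  by apply/rowP => i; rewrite !mxE /a /b; ring.
have [ab0|ab0] := eqVneq (a + b) 0.
  left; have [az bz] : a = 0 /\ b = 0 by split; lra.
  rewrite abE az bz addr0 subr0 !scale0r addr0 addr0 scale1r; split=> // /andP[tp tl].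
  have lE : l = 1.
    by apply/eqP; move/eqP: az; rewrite mulf_eq0 gt_eqF //= subr_eq0 eq_sym.
  have mE : m = 1.
    by apply/eqP; move/eqP: bz; rewrite mulf_eq0 gt_eqF ?subr_gt0 //= subr_eq0 eq_sym.
  by rewrite lE mE subrr !scale0r !addr0 !scale1r.
have w0 : 0 < a + b by rewrite lt_neqAle eq_sym ab0 addr_ge0.
right; exists (a + b), ((a / (a + b)) *: k + (1 - a / (a + b)) *: k'); split=> //.
- have : a <= t * 1 by apply: ler_wpM2l => //; lra.
  have : b <= (1 - t) * 1 by apply: ler_wpM2l; lra.
  by lra.
- have [az|an] := eqVneq a 0.
    rewrite az mul0r scale0r add0r subr0 scale1r; apply: Kk'.
    by rewrite lt_neqAle m1 andbT; apply: contraNneq ab0 => mE; rewrite az add0r /b mE subrr mulr0.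
  have lt1 : l < 1.
    by rewrite lt_neqAle l1 andbT; apply: contraNneq an => lE; rewrite /a lE subrr mulr0.
  have [bz|bn] := eqVneq b 0.
    rewrite bz addr0 mulfV // subrr scale0r addr0 scale1r; exact: Kk.
  have ml : m < 1.
    by rewrite lt_neqAle m1 andbT; apply: contraNneq bn => mE; rewrite /b mE subrr mulr0.
  apply: cK; [exact: Kk|exact: Kk'|].
  by rewrite divr_ge0 ?(ltW w0) //= ler_pdivrMr // mul1r lerDl.
rewrite abE; congr (_ + _); rewrite scalerDr !scalerA; congr (_ *: _ + _ *: _); field; lra.
Qed.

Lemma chull_setU1 x S : chull (x |` S) `<=` ray x (chull S).
Proof.
apply: chull_min => [y z t yr zr t01|y [->|Sy]].
- have [[-> _]|[w [k [w0 w1 Kk ->]]]] := ray_comb (@chull_convex S) yr zr t01.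
    by exists 1, x; rewrite ler01 lexx ltxx scale1r subrr scale0r addr0.
  by exists (1 - w), k; split; [lra|lra|by []|by row_ring].
- by exists 1, x; rewrite ler01 lexx ltxx scale1r subrr scale0r addr0.
by exists 0, y; rewrite lexx ler01 scale0r add0r subr0 scale1r; split=> // _; apply: sub_chull.
Qed.

Lemma irredundant_vertex x S : ~ chull S x -> vertices (chull (x |` S)) x.
Proof.
move=> xS; split; first by apply: sub_chull; left.
move=> y z t /chull_setU1 yr /chull_setU1 zr t01 xE.
have t01' : 0 <= t <= 1 by case/andP: t01 => *; rewrite !ltW.
have [[_ /(_ t01)[-> ->]//]|[w [k [w0 _ Kk e]]]] := ray_comb (@chull_convex S) yr zr t01'.
case: xS; suff -> : x = k by [].
apply: (scalerI (lt0r_neq0 w0)); apply/eqP; rewrite -subr_eq0; apply/eqP.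
move: e; rewrite -xE => e.
have -> : w *: x - w *: k = x - ((1 - w) *: x + w *: k).
  by row_ring.
by rewrite -e subrr.
Qed.

(** Redundant generators are discarded until none is left; then every generator is a vertex by
    [irredundant_vertex]. *)
Lemma polytope_vertices P : convex_polytope P ->
  exists vs : seq 'rV[R]_n, [/\ uniq vs, vertices P = [set` vs] & P = chull [set` vs]].
Proof.
move=> [S [/finite_seqP[s ->] ->]].
have [N] := ubnP (size s); elim: N s => // N IH s; rewrite ltnS => sN.
have [[x [xs xr]]|irr] := pselect (exists x, x \in s /\ chull [set` rem x (undup s)] x).
  have [|vs [uvs vE cE]] := IH (rem x (undup s)).
    have xs' : x \in undup s by rewrite mem_undup.
    rewrite (leq_trans _ sN) // size_rem // (leq_trans _ (size_undup s)) //.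
    by rewrite prednK //; case: (undup s) xs'.
  exists vs; suff -> : chull [set` s] = chull [set` rem x (undup s)] by [].
  apply/seteqP; split.
    apply: chull_min (@chull_convex _) _ => y /= ys.
    have [->//|yx] := eqVneq y x; apply: sub_chull => /=.
    by rewrite mem_rem_uniq ?undup_uniq // !inE yx mem_undup.
  by apply: chull_mono => y /= /mem_rem; rewrite mem_undup.
exists (undup s); rewrite undup_uniq.
have sE : [set` undup s] = [set` s] :> set 'rV[R]_n.
  by apply/seteqP; split=> y /=; rewrite mem_undup.
rewrite sE; split=> //; apply/seteqP; split; first exact: vertices_chull.
move=> x /= xs; have xr : ~ chull [set` rem x (undup s)] x by move=> ?; apply: irr; exists x.
have := irredundant_vertex xr; congr (vertices (chull _) x).
apply/seteqP; split=> y /=.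
  by case=> [->//|/mem_rem]; rewrite mem_undup.
move=> ys; have [->|yx] := eqVneq y x; [by left|right].
by rewrite mem_rem_uniq ?undup_uniq // !inE yx mem_undup.
Qed.

End Convex.

Section Affine.
Context {R : realType} {n m : nat}.

Definition affine_map (f : 'rV[R]_n -> 'rV[R]_m) : Prop := forall x y (t : R),
  f (t *: x + (1 - t) *: y) = t *: f x + (1 - t) *: f y.

Lemma chull_image (f : 'rV[R]_n -> 'rV[R]_m) S : affine_map f ->
  chull (f @` S) = f @` chull S.
Proof.
move=> fa; apply/seteqP; split.
  apply: chull_min => [_ _ t [x xS <-] [y yS <-] t01|_ [x Sx <-]].
    by exists (t *: x + (1 - t) *: y); [apply: chull_convex|rewrite fa].
  by exists x => //; apply: sub_chull.
move=> _ [x xS <-]; apply: (chull_min (A := f @^-1` chull (f @` S))) xS.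
  by move=> y z t fy fz t01 /=; rewrite fa; apply: chull_convex.
by move=> y Sy /=; apply: sub_chull; exists y.
Qed.

End Affine.

Lemma interior_plane (R : realType) (n : nat) (P : set 'rV[R]_n) (v : 'rV[R]_n) (c : R) :
  v != 0 -> (forall x, P x -> dot x v = c) -> ~ (interior P !=set0).
Proof.
move=> v0 Pc [p]; rewrite /interior /= => Pp.
have : \forall t \near (0 : R), P (p + t *: v).
  have : (fun t : R => p + t *: v) @ (0 : R) --> p.
    have -> : nbhs p = nbhs (p + 0 *: v) by rewrite scale0r addr0.
    by apply: cvgD; [exact: cvg_cst|apply: cvgZr_tmp; exact: cvg_id].
  by apply.
move=> /nbhs_ballP[e /= e0 eP].
have h1 := Pc _ (eP (e / 2) _); have h2 := Pc _ (eP 0 _).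
have d0 : dot p v = c by have := h2 (ballxx _ e0); rewrite scale0r addr0.
have : dot (p + (e / 2) *: v) v = c.
  by apply: h1; rewrite /ball /= sub0r normrN ger0_norm; lra.
rewrite dotDl dotZl d0 => /eqP; rewrite -subr_eq0 addrAC subrr add0r mulf_eq0.
by rewrite !gt_eqF ?dot_gt0 //; lra.
Qed.

(** * Centered vertex sets *)

Section Centered.
Context {R : realType}.
Implicit Types (x y z : 'rV[R]_3) (V : seq 'rV[R]_3) (g : 'M[R]_3).

Lemma isometry_linear V (phi : 'rV[R]_3 -> 'rV[R]_3) v :
  (forall n, {in V, forall x, dot x n = 0} -> n = 0) -> v \in V -> v != 0 ->
  {in V &, forall x y, dot (phi x) (phi y) = dot x y} ->
  exists2 g, g *m g^T = 1%:M & {in V, forall x, x *m g = phi x}.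
Proof.
move=> span vV v0 iso; have [w [x [wV xV t0]]] := span_basis span v0.
have [g og [vg wg xg]] := gram_orth t0 (esym (iso _ _ vV vV)) (esym (iso _ _ vV wV))
  (esym (iso _ _ vV xV)) (esym (iso _ _ wV wV)) (esym (iso _ _ wV xV)) (esym (iso _ _ xV xV)).
exists g => // y yV; apply: (triple_dot_inj (triple_orth og t0)).
- by rewrite dot_mulmx // vg iso.
- by rewrite dot_mulmx // wg iso.
by rewrite dot_mulmx // xg iso.
Qed.

Lemma subDD x y z : x + z - (y + z) = x - y.
Proof. by rewrite opprD addrA addrAC addrK. Qed.

Lemma subBB x y z : x - z - (y - z) = x - y.
Proof. by rewrite opprB addrA subrK. Qed.

Variable vs : seq 'rV[R]_3.
Hypothesis uvs : uniq vs.

Definition barycenter : 'rV[R]_3 := (size vs)%:R^-1 *: \sum_(x <- vs) x.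
Definition centered := [seq x - barycenter | x <- vs].
Local Notation o := barycenter.
Local Notation V := centered.

Lemma mem_centered x : (x - o \in V) = (x \in vs).
Proof. by rewrite /centered (mem_map (f := fun z => z - o)) //; exact: addIr. Qed.

Lemma centeredP y : reflect (exists2 x, x \in vs & y = x - o) (y \in V).
Proof. exact: mapP. Qed.

Lemma centered_sum : \sum_(x <- V) x = 0.
Proof.
rewrite big_map big_split /= big_const_seq count_predT iter_addr_0 /barycenter.
have [->|n0] := eqVneq vs [::]; first by rewrite !big_nil /= mulr0n addr0.
by rewrite mulNrn -scaler_nat scalerA mulfV ?scale1r ?subrr // pnatr_eq0 size_eq0.
Qed.

Hypothesis nonplanar : forall (n : 'rV[R]_3) (c : R), n != 0 -> ~ {in vs, forall x, dot x n = c}.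

Lemma centered_span n : {in V, forall x, dot x n = 0} -> n = 0.
Proof.
move=> h; apply/eqP; case: (boolP (n == 0)) => // n0; case: (@nonplanar n (dot o n) n0) => x xvs.
have := h (x - o); rewrite mem_centered => /(_ xvs).
by rewrite dotDl dotNl => /eqP; rewrite subr_eq0 => /eqP.
Qed.

Lemma set_bij_perm (f : 'rV[R]_3 -> 'rV[R]_3) : set_bij [set` vs] [set` vs] f ->
  perm_eq [seq f x | x <- vs] vs.
Proof.
move=> [ff fi _]; have uM : uniq [seq f x | x <- vs].
  by rewrite map_inj_in_uniq // => x y xV yV; apply: fi; rewrite inE.
apply: uniq_perm => //; have [] := uniq_min_size uM (s2 := vs); rewrite ?size_map //.
by move=> _ /mapP[x xV ->]; exact: ff.
Qed.

(** The squared distances from a point to all vertices sum to their number times its squared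
    distance from the barycenter plus a constant, and f only permutes these distances. *)
Lemma isometry_norm (f : 'rV[R]_3 -> 'rV[R]_3) x : set_bij [set` vs] [set` vs] f ->
  (forall x y, [set` vs] x -> [set` vs] y -> edist (f x) (f y) = edist x y) -> x \in vs ->
  dot (f x - o) (f x - o) = dot (x - o) (x - o).
Proof.
move=> bf df xvs.
have sumD y : \sum_(z <- vs) dot (y - z) (y - z) =
    (size vs)%:R * dot (y - o) (y - o) + \sum_(z <- vs) dot (z - o) (z - o).
  have e z : dot (y - z) (y - z) =
      dot (y - o) (y - o) + dot (z - o) (z - o) - 2 * dot (z - o) (y - o).
    by rewrite (dotC (z - o) (y - o)) -dot_subE; congr dot; rewrite subBB.
  rewrite (eq_bigr _ (fun z _ => e z)) !big_split /=.
  rewrite big_const_seq count_predT iter_addr_0 mulr_natl -!addrA; congr (_ + _).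
  rewrite -[RHS]addr0; congr (_ + _).
  have -> : \sum_(z <- vs) - (2 * dot (z - o) (y - o)) =
      - (2 * dot (\sum_(z <- vs) (z - o)) (y - o)).
    by rewrite dot_suml mulr_sumr -sumrN.
  by have := centered_sum; rewrite big_map => ->; rewrite dot0l mulr0 oppr0.
have vs0 : (size vs)%:R != 0 :> R by rewrite pnatr_eq0 size_eq0; case: (vs) xvs.
apply: (mulfI vs0); apply: (addIr (\sum_(z <- vs) dot (z - o) (z - o))).
rewrite -!sumD -[LHS](perm_big _ (set_bij_perm bf)) big_map /= big_seq [RHS]big_seq.
by apply: eq_bigr => z zvs; apply/edist_eqP; apply: df.
Qed.

Lemma centered_homset : point_homogeneous edist [set` vs] 3 -> exists q, homset V q.
Proof.
move=> hom; have [v vvs] : exists v, v \in vs.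
  case E: vs => [|v s]; last by exists v; rewrite mem_head.
  by case: (@nonplanar _ 0 vec3_neq0); rewrite E.
have hom3 a1 a2 a3 b1 b2 b3 : {subset [:: a1; a2; a3; b1; b2; b3] <= vs} ->
    edist a1 a2 = edist b1 b2 -> edist a1 a3 = edist b1 b3 -> edist a2 a3 = edist b2 b3 ->
    exists f, [/\ set_bij [set` vs] [set` vs] f,
      (forall x y, [set` vs] x -> [set` vs] y -> edist (f x) (f y) = edist x y),
      f a1 = b1, f a2 = b2 & f a3 = b3].
  move=> sub e12 e13 e23.
  have dC x y : edist x y = edist y x.
    by apply/edist_eqP; rewrite -(opprB y x) dotNl dotNr opprK.
  have d0 x : edist x x = edist v v by apply/edist_eqP; rewrite !subrr.
  pose A (i : 'I_3) := nth 0 [:: a1; a2; a3] i; pose B (i : 'I_3) := nth 0 [:: b1; b2; b3] i.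
  have [|||f [bf df fAB]] := hom A B.
  - by apply: ord3P; apply: sub; rewrite !inE eqxx ?orbT.
  - by apply: ord3P; apply: sub; rewrite !inE eqxx ?orbT.
  - by apply: ord3P; apply: ord3P; rewrite /A /B /= ?d0 //; rewrite dC ?e12 ?e13 ?e23 dC.
  by exists f; split=> //; [exact: (fAB 0)|exact: (fAB 1)|exact: (fAB 2)].
pose q := dot (v - o) (v - o).
have normV : {in V, forall x, dot x x = q}.
  move=> _ /centeredP[x xvs ->].
  (* A triple of equal points gives transitivity on the vertices. *)
  have sub : {subset [:: v; v; v; x; x; x] <= vs}.
    by move=> z; rewrite !inE => /or4P[|||/or3P[]]/eqP->.
  have d0 : edist v v = edist x x by apply/edist_eqP; rewrite !subrr.
  have [f [bf df fv _ _]] := hom3 _ _ _ _ _ _ sub d0 d0 d0.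
  by rewrite -fv (isometry_norm bf df vvs).
have v0 : v - o != 0.
  apply/eqP => v0; have /eqP[] := @vec3_neq0 R; apply: centered_span => x /normV; rewrite /q v0 dot0l => /dot_eq0 ->.
  by rewrite dot0l.
exists q; split=> //; [|exact: centered_sum|exact: centered_span|].
  by rewrite map_inj_uniq //; exact: addIr.
move=> a1 a2 a3 b1 b2 b3 sub e12 e13 e23.
have ed x y x' y' : x \in V -> y \in V -> x' \in V -> y' \in V -> dot x y = dot x' y' ->
    edist (x + o) (y + o) = edist (x' + o) (y' + o).
  move=> xV yV x'V y'V e; apply/edist_eqP.
  by rewrite !subDD !dot_subE e !normV.
have mem x : x \in [:: a1; a2; a3; b1; b2; b3] -> x + o \in vs.
  by move=> /sub; rewrite -mem_centered addrK.
have [f [bf df f1 f2 f3]] : exists f, [/\ set_bij [set` vs] [set` vs] f,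
      (forall x y, [set` vs] x -> [set` vs] y -> edist (f x) (f y) = edist x y),
      f (a1 + o) = b1 + o, f (a2 + o) = b2 + o & f (a3 + o) = b3 + o].
  apply: hom3.
  - move=> z; rewrite !inE => /or4P[|||/or3P[]]/eqP->; apply: mem; rewrite !inE eqxx ?orbT //.
  - by apply: ed => //; apply: sub; rewrite !inE eqxx ?orbT.
  - by apply: ed => //; apply: sub; rewrite !inE eqxx ?orbT.
  by apply: ed => //; apply: sub; rewrite !inE eqxx ?orbT.
pose phi x := f (x + o) - o.
have fvs x : x \in vs -> f x \in vs by case: bf => ff _ _; apply: ff.
have phiV x : x \in V -> phi x \in V.
  by move=> xV; rewrite /phi mem_centered fvs // -mem_centered addrK.
have phiD : {in V &, forall x y, dot (phi x) (phi y) = dot x y}.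
  move=> x y xV yV; have := df (x + o) (y + o).
  rewrite /= -!mem_centered !addrK => /(_ xV yV)/edist_eqP.
  have -> : f (x + o) - f (y + o) = phi x - phi y.
    by rewrite /phi subBB.
  rewrite (subDD x y o) (dot_subE (phi x) (phi y)) (dot_subE x y).
  by rewrite (normV _ (phiV _ xV)) (normV _ (phiV _ yV)) (normV _ xV) (normV _ yV); lra.
have vV : v - o \in V by rewrite mem_centered.
have [g og gE] := isometry_linear centered_span vV v0 phiD.
exists g; first by split=> // x xV; rewrite gE // phiV.
by split; rewrite gE ?/phi ?f1 ?f2 ?f3 ?addrK //; apply: sub; rewrite !inE eqxx ?orbT.
Qed.

(** The symmetry is chosen on at most three points of the tuple that span the rest. If they span
    only a plane or a line, the other points and their counterparts stay in it, as Gram determinants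
    agree, and are forced as well. *)
Lemma sym_point_homogeneous m q : homset V q -> (1 <= m)%N ->
  point_homogeneous edist [set` vs] m.
Proof.
move=> hV m1 A B AV BV AB; pose a i := A i - o; pose b i := B i - o.
have aV i : a i \in V by rewrite mem_centered; apply: AV.
have bV i : b i \in V by rewrite mem_centered; apply: BV.
have ab i j : dot (a i) (a j) = dot (b i) (b j).
  have := (edist_eqP _ _ _ _).1 (AB i j).
  have e (x y : 'rV[R]_3) : x - y = (x - o) - (y - o) by rewrite subBB.
  rewrite (e (A i)) (e (B i)) (dot_subE (a i) (a j)) (dot_subE (b i) (b j)).
  by rewrite (hs_norm hV (aV i)) (hs_norm hV (aV j)) (hs_norm hV (bV i)) (hs_norm hV (bV j)); lra.
suff [g sg gE] : exists2 g, is_sym V g & forall i, a i *m g = b i.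
  have [og gV] := sg; exists (fun x => (x - o) *m g + o); split.
  - have fV x : x \in vs -> (x - o) *m g + o \in vs.
      by move=> xvs; rewrite -mem_centered addrK gV // mem_centered.
    split; first by move=> x /= /fV.
      by move=> x y _ _ /addIr /(orth_inj og) /addIr.
    move=> y /= yvs; have [_ gV'] := sym_tr (hs_uniq hV) sg.
    exists ((y - o) *m g^T + o); first by rewrite /= -mem_centered addrK gV' // mem_centered.
    by rewrite addrK mulmx_orthVK // subrK.
  - move=> x y _ _; apply/edist_eqP.
    have -> : (x - o) *m g + o - ((y - o) *m g + o) = (x - y) *m g.
      by rewrite subDD -mulmxBl subBB.
    by rewrite dot_mulmx.
  by move=> i; rewrite -/(a i) gE /b subrK.
have forced g l i j k : is_sym V g -> a i *m g = b i -> a j *m g = b j ->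
    a k *m g = b k -> triple (a i) (a j) (a k) != 0 -> a l *m g = b l.
  move=> [og _] gi gj gk t0; have := triple_orth og t0; rewrite gi gj gk => t0'.
  apply: (triple_dot_inj t0').
  - by rewrite -{1}gi dot_mulmx.
  - by rewrite -{1}gj dot_mulmx.
  by rewrite -{1}gk dot_mulmx.
have [[i [j [k t0]]]|flat] := pselect (exists i j k, triple (a i) (a j) (a k) != 0).
  have [g sg [gi gj gk]] := hs_hom3 hV (aV i) (aV j) (aV k) (bV i) (bV j) (bV k)
    (ab i j) (ab i k) (ab j k).
  by exists g => // l; apply: (forced g l i j k sg gi gj gk t0).
have {}flat i j k : triple (a i) (a j) (a k) = 0.
  by apply/eqP/negPn/negP => t0; apply: flat; exists i, j, k.
have [[i [j c0]]|line] := pselect (exists i j, cross (a i) (a j) != 0).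
  have [g sg [gi gj]] := hs_pair hV (aV i) (aV j) (bV i) (bV j) (ab i j).
  exists g => // l; have og := sg.1.
  (* The squared triple product of b i, b j, z equals that of a i, a j, a l, which is zero. Used for
     both the image of a l and b l. *)
  have gram z : dot z z = q -> dot z (b i) = dot (a l) (a i) -> dot z (b j) = dot (a l) (a j) ->
      dot z (cross (b i) (b j)) = 0.
    move=> zz zi zj; apply/eqP; rewrite dotC -/(triple _ _ _) -sqrf_eq0 expr2 tripleM.
    rewrite (dotC (b i) z) (dotC (b j) z) zi zj zz -!ab -(hs_norm hV (aV l)).
    by rewrite (dotC (a l) (a i)) (dotC (a l) (a j)); have := tripleM (a i) (a j) (a l) (a i) (a j) (a l);
      rewrite flat mul0r (dotC (a l) (a i)) (dotC (a l) (a j)) => <-.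
  have c0' : cross (b i) (b j) != 0.
    apply: contraNneq c0 => e; apply/eqP/dot_eq0; rewrite dot_cross !ab -dot_cross.
    by rewrite e dot0l.
  have di : dot (a l *m g) (b i) = dot (a l) (a i) by rewrite -gi dot_mulmx.
  have dj : dot (a l *m g) (b j) = dot (a l) (a j) by rewrite -gj dot_mulmx.
  apply: (@triple_dot_inj _ (b i) (b j) (cross (b i) (b j))).
  - by rewrite /triple gt_eqF // dot_gt0.
  - by rewrite di ab.
  - by rewrite dj ab.
  rewrite gram ?dot_mulmx ?(hs_norm hV) // gram ?(hs_norm hV) ?ab //.
pose i0 : 'I_m := Ordinal m1.
have [g sg [g0 _]] := hs_pair hV (aV i0) (aV i0) (bV i0) (bV i0) (ab i0 i0).
exists g => // l; have og := sg.1; have q0 := hs_norm_gt0 hV.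
set d := dot (a l) (a i0).
have dd : d ^+ 2 = q ^+ 2.
  have c0 : cross (a l) (a i0) = 0.
    by apply/eqP/negPn/negP => ?; apply: line; exists l, i0.
  have := dot_cross (a l) (a i0) (a l) (a i0); rewrite c0 dot0l !(hs_norm hV) // (dotC (a i0)) -/d; lra.
have par z w : dot w w = q -> dot z z = q -> dot z w = d -> z = (d / q) *: w.
  move=> ww zz zd; apply/eqP; rewrite -subr_eq0; apply/eqP/dot_eq0.
  rewrite !dotE (dotC w z) zz zd ww.
  have qn0 : q != 0 by rewrite gt_eqF.
  transitivity ((q ^+ 2 - d ^+ 2) / q); first by field.
  by rewrite dd subrr mul0r.
have bb := hs_norm hV (bV i0).
rewrite (par (a l *m g) _ bb) ?dot_mulmx ?(hs_norm hV) //; last by rewrite -g0 dot_mulmx.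
by rewrite -(par (b l) _ bb) ?(hs_norm hV) // -ab.
Qed.

End Centered.

(** * Affine images and scaling *)

Section AffineIsometries.
Context {R : realType}.
Implicit Types (x y o : 'rV[R]_3) (V : seq 'rV[R]_3) (M g : 'M[R]_3).

Lemma affine_mulmx M o : affine_map (fun x : 'rV[R]_3 => x *m M + o).
Proof.
move=> x y t; rewrite mulmxDl -!scalemxAl !scalerDr addrACA; congr (_ + _).
by rewrite -scalerDl addrC subrK scale1r.
Qed.

Lemma isometry_mulmx M o : M *m M^T = 1%:M -> is_isometry (fun x : 'rV[R]_3 => x *m M + o).
Proof.
by move=> oM x y; apply/edist_eqP; rewrite subDD -mulmxBl dot_mulmx.
Qed.

Lemma similarity_mulmx M o (k : R) : 0 < k -> M *m M^T = k%:M ->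
  is_similarity (Num.sqrt k) (fun x : 'rV[R]_3 => x *m M + o).
Proof.
move=> k0 Mk; split; first by rewrite sqrtr_gt0.
move=> x y; rewrite /Defs.edist /enorm subDD -mulmxBl (dot_similar _ _ Mk).
by rewrite sqrtrM // ltW.
Qed.

Lemma affine_at_height (s : R) : affine_map (at_height s).
Proof.
by move=> x y t; apply: rV3P; rewrite !mxE /= ?mxE; ring.
Qed.

Lemma chull_setU (n : nat) (X Y : set 'rV[R]_n) :
  chull (chull X `|` chull Y) = chull (X `|` Y).
Proof.
apply/seteqP; split; last first.
  by apply: chull_mono => x [] xS; [left|right]; apply: sub_chull.
apply: chull_min (@chull_convex _ _ _) _ => x [].
  by apply: chull_mono => y ?; left.
by apply: chull_mono => y ?; right.
Qed.

Lemma chull_prism (S : set 'rV[R]_2) (c : R) : 0 < c ->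
  [set at_height h q | h in `[0, c] & q in chull S] =
  chull ((at_height 0 @` S) `|` (at_height c @` S)).
Proof.
move=> c0; apply/seteqP; split.
  move=> _ [h /= hc [q qS <-]]; move: hc; rewrite in_itv /= => /andP[h0 hc].
  have -> : at_height h q = (h / c) *: at_height c q + (1 - h / c) *: at_height 0 q.
    have cn0 : c != 0 by rewrite gt_eqF.
    by apply: rV3P; rewrite !mxE /=; field.
  apply: chull_convex; last by rewrite divr_ge0 ?(ltW c0) //= ler_pdivrMr // mul1r.
    have : (at_height c @` chull S) (at_height c q) by exists q.
    rewrite -chull_image; last exact: affine_at_height.
    by apply: chull_mono => y ?; right.
  have : (at_height 0 @` chull S) (at_height 0 q) by exists q.
  rewrite -chull_image; last exact: affine_at_height.
  by apply: chull_mono => y ?; left.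
apply: chull_min.
  move=> _ _ t [h /= hc [q qS <-]] [h' /= hc' [q' qS' <-]] /andP[t0 t1].
  exists (t * h + (1 - t) * h').
    move: hc hc'; rewrite /= !in_itv /= => /andP[h0 h1] /andP[h0' h1'].
    have k1 : 0 <= t * (c - h) by apply: mulr_ge0; lra.
    have k2 : 0 <= (1 - t) * (c - h') by apply: mulr_ge0; lra.
    have k3 : 0 <= t * h by apply: mulr_ge0.
    have k4 : 0 <= (1 - t) * h' by apply: mulr_ge0; lra.
    by apply/andP; split; lra.
  exists (t *: q + (1 - t) *: q'); first by apply: chull_convex; rewrite // t0 t1.
  by apply: rV3P; rewrite !mxE /= ?mxE; ring.
move=> _ [] [q Sq <-]; [exists 0|exists c]; rewrite /= ?in_itv /= ?lexx ?(ltW c0) //.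
  by exists q => //; apply: sub_chull.
by exists q => //; apply: sub_chull.
Qed.

(** A point of the box is reached from the corners by interpolating one coordinate at a time. *)
Lemma box_chull (a b c : R) : 0 < a -> 0 < b -> 0 < c ->
  box a b c = chull [set p : 'rV[R]_3 | [/\ p 0 0 = 0 \/ p 0 0 = a,
    p 0 1 = 0 \/ p 0 1 = b & p 0 2 = 0 \/ p 0 2 = c]].
Proof.
move=> a0 b0 c0; set S := [set p | _]; apply/seteqP; split; last first.
  apply: chull_min => [x y t [/andP[x0 xa] /andP[x1 xb] /andP[x2 xc]]
      [/andP[y0 ya] /andP[y1 yb] /andP[y2 yc]] /andP[t0 t1]|x [] h0 h1 h2].
    have key (p q m : R) : 0 <= p -> p <= m -> 0 <= q -> q <= m ->
        0 <= t * p + (1 - t) * q <= m.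
      move=> p0 pm q0 qm; have k1 : 0 <= t * (m - p) by apply: mulr_ge0; lra.
      have k2 : 0 <= (1 - t) * (m - q) by apply: mulr_ge0; lra.
      have k3 : 0 <= t * p by apply: mulr_ge0.
      have k4 : 0 <= (1 - t) * q by apply: mulr_ge0; lra.
      by apply/andP; split; lra.
    by split; rewrite !mxE; apply: key.
  by split; [case: h0|case: h1|case: h2] => ->; rewrite lexx ltW.
have edge (x y : 'rV[R]_3) (t m : R) : 0 < m -> 0 <= t <= m -> chull S x -> chull S y ->
    chull S ((t / m) *: x + (1 - t / m) *: y).
  move=> m0 /andP[t0 tm] xS yS; apply: chull_convex => //.
  by rewrite divr_ge0 ?(ltW m0) //= ler_pdivrMr // mul1r.
have [an bn cn] : [/\ a != 0, b != 0 & c != 0] by rewrite !gt_eqF.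
move=> p [pa pb pc]; rewrite -(vec3K p).
move: (p 0 0) (p 0 1) (p 0 2) pa pb pc => p0 p1 p2 pa pb pc.
have s2 q0 q1 : q0 = 0 \/ q0 = a -> q1 = 0 \/ q1 = b -> chull S (vec3 q0 q1 p2).
  move=> h0 h1; have -> : vec3 q0 q1 p2 = (p2 / c) *: vec3 q0 q1 c + (1 - p2 / c) *: vec3 q0 q1 0.
    by apply: rV3P; rewrite !mxE /=; field.
  by apply: edge => //; apply: sub_chull; split; rewrite vec3E //; [right|left].
have s1 q0 : q0 = 0 \/ q0 = a -> chull S (vec3 q0 p1 p2).
  move=> h0; have -> : vec3 q0 p1 p2 = (p1 / b) *: vec3 q0 b p2 + (1 - p1 / b) *: vec3 q0 0 p2.
    by apply: rV3P; rewrite !mxE /=; field.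
  by apply: edge => //; apply: s2 => //; [right|left].
have -> : vec3 p0 p1 p2 = (p0 / a) *: vec3 a p1 p2 + (1 - p0 / a) *: vec3 0 p1 p2.
  by apply: rV3P; rewrite !mxE /=; field.
by apply: edge => //; apply: s1; [right|left].
Qed.

End AffineIsometries.

Section Scaling.
Context {R : realType}.
Implicit Types (x y o : 'rV[R]_3) (V : seq 'rV[R]_3) (M g : 'M[R]_3).

Lemma scaled_sym V (s : R) g : s != 0 -> is_sym [seq s *: x | x <- V] g <-> is_sym V g.
Proof.
have inj : s != 0 -> injective (fun x : 'rV[R]_3 => s *: x) by move=> s0; apply: scalerI.
move=> s0; split=> -[og gV]; split=> // x xV.
  have := gV (s *: x); rewrite (mem_map (inj s0)) => /(_ xV).
  by rewrite -scalemxAl (mem_map (inj s0)).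
by move: xV => /mapP[y yV ->]; rewrite -scalemxAl map_f // gV.
Qed.

Lemma homset_scale V (q s : R) : s != 0 -> s ^+ 2 * q = 1 -> homset V q ->
  homset [seq s *: x | x <- V] 1.
Proof.
move=> s0 sq hV; split.
- by rewrite map_inj_uniq ?(hs_uniq hV) //; apply: scalerI.
- by move=> _ /mapP[x xV ->]; rewrite dotZl dotZr (hs_norm hV xV) -sq; ring.
- by rewrite big_map -scaler_sumr (hs_sum hV) scaler0.
- move=> n h; apply: (hs_span hV) => x xV; have := h (s *: x) (map_f _ xV).
  by rewrite dotZl => /eqP; rewrite mulf_eq0 (negbTE s0) => /eqP.
move=> a1 a2 a3 b1 b2 b3 sub e12 e13 e23.
have mem x : x \in [:: a1; a2; a3; b1; b2; b3] -> s^-1 *: x \in V.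
  by move=> /sub /mapP[y yV ->]; rewrite scalerA mulVf // scale1r.
have di x y : dot (s^-1 *: x) (s^-1 *: y) = s^-1 * (s^-1 * dot x y) by rewrite dotZl dotZr.
have [|||||||||g sg [g1 g2 g3]] := @hs_hom3 _ V q hV (s^-1 *: a1) (s^-1 *: a2) (s^-1 *: a3)
   (s^-1 *: b1) (s^-1 *: b2) (s^-1 *: b3); rewrite ?di ?e12 ?e13 ?e23 //;
   try by apply: mem; rewrite !inE eqxx ?orbT.
exists g; first exact/scaled_sym.
have ex x y : (s^-1 *: x) *m g = s^-1 *: y -> x *m g = y.
  by rewrite -scalemxAl; apply: scalerI; rewrite invr_eq0.
by split; apply: ex.
Qed.

Lemma irreducible_scale V (s : R) : s != 0 -> irreducible V -> irreducible [seq s *: x | x <- V].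
Proof. by move=> s0 irr M MC; apply: irr => g /(scaled_sym V g s0)/MC. Qed.

Lemma similar_copy_scale V (s : R) S : s != 0 -> similar_copy [seq s *: x | x <- V] S ->
  similar_copy V S.
Proof.
move=> s0 [k [M [k0 Mk VE]]]; exists (s ^- 2 * k), (s^-1 *: M); split.
- by rewrite mulr_gt0 // invr_gt0 exprn_even_gt0.
- rewrite linearZ /= -scalemxAl -scalemxAr scalerA Mk scale_scalar_mx; congr (_%:M).
  by field.
have inj : injective (fun x : 'rV[R]_3 => s *: x) by apply: scalerI.
have memE x : (x \in V) = (s *: x \in [seq s *: x | x <- V]) by rewrite (mem_map inj).
apply/seteqP; split=> x /=.
  rewrite memE => xV; have : [set` [seq s *: x | x <- V]] (s *: x) by [].
  rewrite VE => -[p Sp pE]; exists p => //.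
  by rewrite -scalemxAr pE scalerA mulVf // scale1r.
move=> [p Sp <-]; rewrite memE -scalemxAr scalerA mulfV // scale1r.
by have : [set` [seq s *: x | x <- V]] (p *m M) by rewrite VE; exists p.
Qed.

End Scaling.

(** * Polyhedra with given vertex sets *)

Section Polyhedron.
Context {R : realType}.
Implicit Types (x y z : 'rV[R]_3) (g M : 'M[R]_3).
Variables (P : set 'rV[R]_3) (vs : seq 'rV[R]_3).
Hypotheses (uvs : uniq vs) (VE : vertices P = [set` vs]) (PE : P = chull [set` vs]).
Variable q : R.
Hypothesis hV : homset (centered vs) q.
Local Notation o := (barycenter vs).
Local Notation V := (centered vs).

Lemma similar_polyhedron (S : set 'rV[R]_3) : similar_copy V S -> similar_sets P (chull S).
Proof.
move=> [k [M [k0 Mk VS]]]; exists (Num.sqrt k), (fun x => x *m M + o).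
split; first exact: similarity_mulmx.
rewrite PE -chull_image; last exact: affine_mulmx.
congr chull; apply/seteqP; split=> x /=.
  rewrite -mem_centered => xV; have : [set` V] (x - o) by [].
  by rewrite VS => -[p Sp pE]; exists p => //; rewrite pE subrK.
move=> [p Sp <-]; rewrite -mem_centered addrK.
by have : [set` V] (p *m M) by rewrite VS; exists p.
Qed.

Lemma separated_intro (u : 'rV[R]_3) (h : R) (B0 B1 : set 'rV[R]_3) : h != 0 -> separated V u ->
  (forall x, B0 x -> dot (x - o) u = - h) -> (forall x, B1 x -> dot (x - o) u = h) ->
  base_distances_separated P B0 B1.
Proof.
move=> h0 sep b0 b1; rewrite /base_distances_separated VE; apply/seteqP; split=> // d [dd].
move=> [z [/= zvs zB] [y [/= yvs yB] zy]].
have yz : dot (z - o) u != dot (y - o) u.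
  by rewrite b0 // b1 // eq_sym -subr_eq0 opprK -mulr2n mulrn_eq0.
have key x x' : x \in vs -> x' \in vs -> dot (x - o) u = dot (x' - o) u -> edist x x' = d -> False.
  move=> xvs x'vs xx' e; have : edist x x' = edist z y by rewrite e zy.
  move=> /edist_eqP; rewrite -(subBB x x' o) -(subBB z y o).
  have cV p : p \in vs -> p - o \in V by rewrite mem_centered.
  have := cV _ xvs; have := cV _ x'vs; have := cV _ zvs; have := cV _ yvs => yV zV x'V xV.
  rewrite (dot_subE (x - o)) (dot_subE (z - o)).
  rewrite (hs_norm hV xV) (hs_norm hV x'V) (hs_norm hV zV) (hs_norm hV yV) => e2.
  by have /eqP := sep _ _ _ _ xV x'V zV yV xx' yz; apply; lra.
case: dd => -[x [/= xvs xB] [x' [/= x'vs x'B] e]]; apply: (key x x') => //.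
  by rewrite !b0.
by rewrite !b1.
Qed.

Lemma at_height_rows3 (s : R) (p : 'rV[R]_2) (e1 e2 u : 'rV[R]_3) :
  at_height s p *m rows3 e1 e2 u = p 0 0 *: e1 + p 0 1 *: e2 + s *: u.
Proof. by rewrite mul_rows3E !vec3E. Qed.

Lemma at_height_polygon (n : nat) (s r t : R) k (e1 e2 u : 'rV[R]_3) :
  at_height s (polygon_vertex n 0 r t k) *m rows3 e1 e2 u =
  level_point u e1 e2 s r (cis (t + 2 * pi * k%:R / n%:R)).
Proof.
rewrite at_height_rows3 /polygon_vertex add0r !mxE /= /level_point.
by rewrite scalerDr !scalerA addrC.
Qed.

Lemma prism_polyhedron u h : dot u u = 1 -> 0 < h -> separated V u ->
  prism_shape V u h ->
  exists (n : nat) (B0 B1 : set 'rV[R]_3),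
    [/\ (3 <= n)%N, right_prism n P B0 B1 & base_distances_separated P B0 B1].
Proof.
move=> uu h0 sep [n [e1 [e2 [r [n3 f r0 VP]]]]].
pose A := [set polygon_vertex n 0 r 0 k | k in `I_n].
(* The heights 0 and 2h of the bases go to the levels -h and h around the barycenter. *)
pose F x := x *m rows3 e1 e2 u + (o - h *: u).
have FA : affine_map F by exact: affine_mulmx.
have FI : is_isometry F by apply: isometry_mulmx; apply: frame_orth.
have h2 : 0 < 2 * h by rewrite mulr_gt0.
have Fheight (s : R) p : dot (F (at_height s p) - o) u = s - h.
  have [_ _ _ [_ e1u e2u]] := f.
  rewrite /F addrA addrAC addrK at_height_rows3 !dotE uu e1u e2u; ring.
exists n, (F @` (at_height 0 @` chull A)), (F @` (at_height (2 * h) @` chull A)).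
split=> //; last first.
  apply: (separated_intro (lt0r_neq0 h0) sep) => _ [_ [p _ <-] <-]; rewrite Fheight; ring.
exists (chull A), (2 * h), F; split; split=> //.
  by exists 0, r, 0.
rewrite chull_prism // -chull_image // PE; congr chull; apply/seteqP; split=> x /=.
  rewrite -mem_centered => /VP[k [s [kn sE xE]]].
  have xF : F (at_height (h + s) (polygon_vertex n 0 r 0 k)) = x.
    rewrite /F at_height_polygon add0r -[RHS](subrK o) xE /level_point scalerDl.
    by row_ring.
  exists (at_height (h + s) (polygon_vertex n 0 r 0 k)) => //; case: sE => sE; rewrite sE.
    by right; exists (polygon_vertex n 0 r 0 k); [exists k|congr at_height; ring].
  by left; exists (polygon_vertex n 0 r 0 k); [exists k|congr at_height; ring].
move=> [_ [] [_ [k /= kn <-] <-] <-]; rewrite -mem_centered; apply/VP.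
  exists k, (- h); split=> //; first by right.
  rewrite /F at_height_polygon add0r /level_point.
  by row_ring.
exists k, h; split=> //; first by left.
rewrite /F at_height_polygon add0r /level_point.
by row_ring.
Qed.

Lemma antiprism_polyhedron u h : dot u u = 1 -> 0 < h -> separated V u ->
  antiprism_shape V u h ->
  exists (n : nat) (B0 B1 : set 'rV[R]_3),
    [/\ (2 <= n)%N, right_antiprism n P B0 B1 & base_distances_separated P B0 B1].
Proof.
move=> uu h0 sep [n [e1 [e2 [r [n3 f r0 VP]]]]].
pose A t := [set polygon_vertex n 0 r t k | k in `I_n].
(* The axis is reversed: the untwisted layer is the upper one, but the base at height 0 has to be
   untwisted. *)
pose F x := x *m rows3 e1 e2 (- u) + (o + h *: u).
have FA : affine_map F by exact: affine_mulmx.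
have f' : frame e1 e2 (- u).
  have [e11 e22 _ [e12 e1u e2u]] := f; split; rewrite ?dotE ?opprK //.
  by split; rewrite ?dotNr ?e1u ?e2u ?oppr0.
have FI : is_isometry F by apply: isometry_mulmx; apply: frame_orth.
have h2 : 0 < 2 * h by rewrite mulr_gt0.
have Fheight (s : R) p : dot (F (at_height s p) - o) u = h - s.
  have [_ _ _ [_ e1u e2u]] := f.
  rewrite /F addrA addrAC addrK at_height_rows3 !dotE uu e1u e2u; ring.
have hN : - h != 0 by rewrite oppr_eq0 gt_eqF.
exists n, (F @` (at_height 0 @` chull (A 0))), (F @` (at_height (2 * h) @` chull (A (0 + pi / n%:R)))).
split; first exact: ltnW; last first.
  apply: (separated_intro hN sep) => _ [_ [p _ <-] <-]; rewrite Fheight; ring.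
exists 0, r, 0, (2 * h), F; split=> //; split=> //.
have GA (s : R) : affine_map (F \o at_height s).
  by move=> x y t; rewrite /= affine_at_height FA.
rewrite /regular_polygon !image_comp -(chull_image _ (GA 0)) -(chull_image _ (GA (2 * h))) chull_setU PE; congr chull; apply/seteqP; split=> x /=.
  rewrite -mem_centered => /VP[k kn [] xE].
    left; exists (polygon_vertex n 0 r 0 k); first by exists k.
    rewrite /= /F at_height_polygon add0r -[RHS](subrK o) xE /level_point.
    by row_ring.
  right; exists (polygon_vertex n 0 r (0 + pi / n%:R) k); first by exists k.
  rewrite /= /F at_height_polygon add0r -[RHS](subrK o) xE /level_point.
  by row_ring.
case=> -[_ [k /= kn <-] <-]; rewrite -mem_centered; apply/VP; exists k => //.
  left; rewrite /= /F at_height_polygon add0r /level_point.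
  by row_ring.
right; rewrite /= /F at_height_polygon add0r /level_point.
by row_ring.
Qed.

Lemma box_sorted : box_shape V -> exists a1 a2 a3 : 'rV[R]_3,
  [/\ a1 != 0, a2 != 0 & a3 != 0] /\ [/\ dot a1 a2 = 0, dot a1 a3 = 0 & dot a2 a3 = 0] /\
  sign_sums V a1 a2 a3 /\
  enorm a1 <= enorm a2 /\ enorm a2 <= enorm a3.
Proof.
move=> [a1 [a2 [a3 [[a10 a20 a30] [[d12 d13 d23] VP]]]]].
have sw23 (b1 b2 b3 : 'rV[R]_3) : sign_sums V b1 b2 b3 -> sign_sums V b1 b3 b2.
  move=> VP' x; rewrite VP'; split=> -[s1 [s2 [s3 [h1 h2 h3 ->]]]];
    by exists s1, s3, s2; split=> //; rewrite addrAC.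
have sw12 (b1 b2 b3 : 'rV[R]_3) : sign_sums V b1 b2 b3 -> sign_sums V b2 b1 b3.
  move=> VP' x; rewrite VP'; split=> -[s1 [s2 [s3 [h1 h2 h3 ->]]]];
    by exists s2, s1, s3; split=> //; rewrite (addrC (s1 *: _)).
have [d21 d31 d32] : [/\ dot a2 a1 = 0, dot a3 a1 = 0 & dot a3 a2 = 0].
  by rewrite (dotC a2 a1) (dotC a3 a1) (dotC a3 a2).
have [VP23 VP12] := (sw23 _ _ _ VP, sw12 _ _ _ VP).
have [VP12' VP23'] := (sw12 _ _ _ VP23, sw23 _ _ _ VP12).
have VP321 := sw23 _ _ _ VP12'.
have [h12|/ltW h12] := leP (enorm a1) (enorm a2); have [h23|/ltW h23] := leP (enorm a2) (enorm a3);
  have [h13|/ltW h13] := leP (enorm a1) (enorm a3).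
- by exists a1, a2, a3.
- by exists a1, a2, a3.
- by exists a1, a3, a2.
- by exists a3, a1, a2.
- by exists a2, a1, a3.
- by exists a2, a3, a1.
- by exists a3, a2, a1.
by exists a3, a2, a1.
Qed.

Lemma box_polyhedron : box_shape V -> exists a b c : R,
  [/\ 0 < a, a <= b, b <= c, a ^+ 2 + b ^+ 2 <> c ^+ 2 & isometric_sets P (box a b c)].
Proof.
move=> /box_sorted[a1 [a2 [a3 [[a10 a20 a30] [[d12 d13 d23] [VP [h12 h23]]]]]]].
set l1 := enorm a1 in h12 *; set l2 := enorm a2 in h12 h23 *; set l3 := enorm a3 in h23 *.
have pos a : a != 0 -> 0 < enorm a :> R by move=> a0; rewrite sqrtr_gt0 dot_gt0.
have [p1 p2 p3] : [/\ 0 < l1, 0 < l2 & 0 < l3] by split; apply: pos.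
have [n1 n2 n3] : [/\ l1 ^+ 2 = dot a1 a1, l2 ^+ 2 = dot a2 a2 & l3 ^+ 2 = dot a3 a3].
  by rewrite !sqr_enorm.
exists (2 * l1), (2 * l2), (2 * l3); split; [by rewrite mulr_gt0|by rewrite ler_pM2l|by rewrite ler_pM2l| |].
  (* With equality, the face diagonal from v to w is as long as the edge from v to w'. The corner z
     of that face sees the diagonal at a right angle, but only v and w' lie on the sphere whose
     diameter is the edge, so a symmetry carrying one segment to the other has no image for z. *)
  move=> sq; have e3 : dot a3 a3 = dot a1 a1 + dot a2 a2 by rewrite -n1 -n2 -n3; lra.
  have [I1 N1] := (normr1 R, normrN1 R).
  have mem (s1 s2 s3 : R) : `|s1| = 1 -> `|s2| = 1 -> `|s3| = 1 ->
      s1 *: a1 + s2 *: a2 + s3 *: a3 \in V.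
    by move=> *; apply/VP; exists s1, s2, s3.
  have vV := mem _ _ _ N1 N1 N1; have wV := mem _ _ _ I1 I1 N1.
  have w'V := mem _ _ _ N1 N1 I1; have zV := mem _ _ _ I1 N1 N1.
  have dE (s1 s2 s3 t1 t2 t3 : R) : dot (s1 *: a1 + s2 *: a2 + s3 *: a3) (t1 *: a1 + t2 *: a2 + t3 *: a3) =
      s1 * t1 * dot a1 a1 + s2 * t2 * dot a2 a2 + s3 * t3 * dot a3 a3.
    by rewrite !dotE (dotC a2 a1) (dotC a3 a1) (dotC a3 a2) d12 d13 d23; ring.
  have [|g sg [vg wg]] := hs_pair hV vV wV vV w'V; first by rewrite !dE e3; ring.
  have /VP[s1 [s2 [s3 [/norm_eq1 s1E /norm_eq1 s2E /norm_eq1 s3E zg]]]] := sg.2 _ zV.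
  have := dot_mulmx (-1 *: a1 + -1 *: a2 + -1 *: a3) (1 *: a1 + -1 *: a2 + -1 *: a3) sg.1.
  have := dot_mulmx (1 *: a1 + 1 *: a2 + -1 *: a3) (1 *: a1 + -1 *: a2 + -1 *: a3) sg.1.
  rewrite vg wg zg !dE e3 -n1 -n2.
  have q1 : 0 < l1 ^+ 2 by rewrite exprn_gt0.
  have q2 : 0 < l2 ^+ 2 by rewrite exprn_gt0.
  by case: s1E => ->; case: s2E => ->; case: s3E => ->; lra.
pose M := rows3 (l1^-1 *: a1) (l2^-1 *: a2) (l3^-1 *: a3).
have [m1 m2 m3] : [/\ l1 != 0, l2 != 0 & l3 != 0] by rewrite !gt_eqF.
have MO : M *m M^T = 1%:M.
  by apply: rows3_similar; rewrite !dotZl !dotZr -?n1 -?n2 -?n3 ?d12 ?d13 ?d23 ?mulr0 //; field.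
pose t := o - a1 - a2 - a3; exists (fun x => x *m M + t); split; first exact: isometry_mulmx.
have PM x : x *m M = (x 0 0 / l1) *: a1 + (x 0 1 / l2) *: a2 + (x 0 2 / l3) *: a3.
  by rewrite mul_rows3E !scalerA.
rewrite box_chull ?mulr_gt0 // -chull_image; last exact: affine_mulmx.
rewrite PE; congr chull; apply/seteqP; split=> x /=.
  rewrite -mem_centered => /VP[s1 [s2 [s3 [/norm_eq1 s1E /norm_eq1 s2E /norm_eq1 s3E xE]]]].
  exists (vec3 ((1 + s1) * l1) ((1 + s2) * l2) ((1 + s3) * l3)).
    rewrite !vec3E; split; [case: s1E => ->|case: s2E => ->|case: s3E => ->];
      by [left; ring|right; ring].
  rewrite PM !vec3E !mulfK // -[RHS](subrK o) xE /t.
  by row_ring.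
move=> [p [c1 c2 c3] <-]; rewrite -mem_centered; apply/VP.
have sgn (a l : R) : l != 0 -> a = 0 \/ a = 2 * l -> `|a / l - 1| = 1.
  move=> l0 [->|->]; first by rewrite mul0r sub0r normrN1.
  by rewrite mulfK // (_ : 2 - 1 = 1) ?normr1 //; ring.
exists (p 0 0 / l1 - 1), (p 0 1 / l2 - 1), (p 0 2 / l3 - 1); split; try exact: sgn.
by rewrite PM /t; row_ring.
Qed.

End Polyhedron.

(** * Four vertices *)

Section Tetrahedron.
Context {R : realType}.
Implicit Types (a b c d x y z : 'rV[R]_3).

Lemma perm_rem3 (T : eqType) (V : seq T) (x y z : T) : uniq V -> size V = 4%N ->
  uniq [:: x; y; z] -> {subset [:: x; y; z] <= V} -> exists w, perm_eq V [:: x; y; z; w].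
Proof.
move=> uV sV; rewrite /= !inE negb_or andbT => /andP[/andP[xy xz] yz] sub.
have [xV yV zV] : [/\ x \in V, y \in V & z \in V].
  by split; apply: sub; rewrite !inE eqxx ?orbT.
have yV' : y \in rem x V by rewrite mem_rem_uniq // !inE eq_sym xy.
have zV' : z \in rem y (rem x V).
  by rewrite mem_rem_uniq ?rem_uniq // inE eq_sym yz mem_rem_uniq // inE eq_sym xz.
have : size (rem z (rem y (rem x V))) = 1 by rewrite !size_rem // sV.
case E: (rem z (rem y (rem x V))) => [|w []] // _; exists w.
rewrite (permPl (perm_to_rem xV)) perm_cons (permPl (perm_to_rem yV')) perm_cons.
by rewrite (permPl (perm_to_rem zV')) E.
Qed.

(** The Cauchy-Schwarz inequality, from Lagrange's identity for the cross product. *)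
Lemma dot_le_enorm x y : dot x y <= enorm x * enorm y.
Proof.
have h := dot_ge0 (cross x y); rewrite dot_cross (dotC y x) -!sqr_enorm -exprMn -expr2 in h.
have [h0|/ltW h0] := leP (dot x y) 0.
  by rewrite (le_trans h0) // mulr_ge0 ?enorm_ge0.
by rewrite -ler_sqr ?nnegrE ?mulr_ge0 ?enorm_ge0 // -subr_ge0.
Qed.

Lemma angle_lt_pihalf x y z : 0 < dot (x - y) (z - y) -> angle x y z < pi / 2.
Proof.
move=> h; rewrite /angle; set t := _ / _.
have e0 : 0 < enorm (x - y) * enorm (z - y) by exact: lt_le_trans (dot_le_enorm _ _).
have t0 : 0 < t by rewrite divr_gt0.
have t1 : t <= 1 by rewrite ler_pdivrMr // mul1r dot_le_enorm.
have [/andP[A0 Api] tE] := acos_def (introT andP (conj (le_trans (lerN10 R) (ltW t0)) t1)).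
rewrite -ltr_cos ?in_itv /= ?A0 ?Api //; last first.
  by rewrite divr_ge0 ?pi_ge0 // ler_pdivrMr // ler_peMr ?pi_ge0 // ler1n.
by rewrite cos_pihalf tE.
Qed.

Variables (V : seq 'rV[R]_3) (q : R).
Hypothesis hV : homset V q.
Variables a b c d : 'rV[R]_3.
Hypothesis pV : perm_eq V [:: a; b; c; d].

Lemma tetra_sum : a + b + c + d = 0.
Proof.
have := hs_sum hV; rewrite (perm_big _ pV) /= !big_cons big_nil addr0 => <-.
by rewrite !addrA.
Qed.

Lemma tetra_triple : triple a b c != 0.
Proof.
have dE : d = - (a + b + c) by apply/eqP; rewrite -addr_eq0 addrC tetra_sum.
have aV : a \in V by rewrite (perm_mem pV) mem_head.
have [w [x [wV xV]]] := hs_basis hV aV; apply: contraNneq => t0.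
move: wV xV; rewrite !(perm_mem pV) !inE dE => wV xV.
suff : triple a w x = 0 by move=> ->.
move: t0; rewrite /triple !dot3E !vec3E.
by case/or4P: wV => /eqP ->; case/or4P: xV => /eqP ->; rewrite ?mxE; lra.
Qed.

(** Since a + b + c + d = 0, this is -4 times [triple a b c]. *)
Lemma tetra_independent : triple (b - a) (c - a) (d - a) != 0.
Proof.
have dE : d = - (a + b + c) by apply/eqP; rewrite -addr_eq0 addrC tetra_sum.
apply: contraNneq tetra_triple => t0; apply/eqP; move: t0.
by rewrite dE /triple !dot3E !vec3E !mxE; lra.
Qed.

(** Equal norms and d = - (a + b + c) make the product equal to the squared norm of a + c. *)
Lemma tetra_acute : 0 < dot (a - b) (c - b).
Proof.
have nV x : x \in [:: a; b; c; d] -> dot x x = q.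
  by rewrite -(perm_mem pV) => /(hs_norm hV).
have [na nb nc nd] : [/\ dot a a = q, dot b b = q, dot c c = q & dot d d = q].
  by split; apply: nV; rewrite !inE eqxx ?orbT.
have dE : d = - (a + b + c) by apply/eqP; rewrite -addr_eq0 addrC tetra_sum.
have ac : 0 < dot (a + c) (a + c).
  apply: dot_gt0; apply: contraNneq tetra_triple => /eqP.
  by rewrite addr_eq0 => /eqP ->; rewrite /triple !dot3E !vec3E !mxE; apply/eqP; ring.
move: nd ac; rewrite dE !dotE (dotC b a) (dotC c a) (dotC c b) na nb nc; lra.
Qed.

End Tetrahedron.

Section TetrahedronCase.
Context {R : realType}.
Variables (P : set 'rV[R]_3) (vs : seq 'rV[R]_3).
Hypotheses (uvs : uniq vs) (VE : vertices P = [set` vs]) (PE : P = chull [set` vs]).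
Variable q : R.
Hypothesis hV : homset (centered vs) q.
Local Notation o := (barycenter vs).
Local Notation V := (centered vs).

Lemma tetrahedron_polyhedron : size V = 4%N -> exists v : 'I_4 -> 'rV[R]_3,
  [/\ tetrahedron_on v P, polytope_homogeneous P 1,
      (forall i j : 'I_4, isometric_sets (tetrahedron_face v i) (tetrahedron_face v j))
    & (forall i j k : 'I_4, uniq [:: i; j; k] -> acute_triangle (v i) (v j) (v k))].
Proof.
move=> V4; have vs4 : size vs = 4%N by rewrite -V4 size_map.
pose v (i : 'I_4) := nth 0 vs i.
have vvs i : v i \in vs by rewrite mem_nth // vs4.
have vV i : v i - o \in V by rewrite mem_centered.
have vi : injective v.
  by move=> i j /eqP; rewrite nth_uniq ?vs4 // => /eqP/val_inj.
have vP x : x \in vs -> exists i, x = v i.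
  move=> xvs; have ix : (index x vs < 4)%N by rewrite -vs4 index_mem.
  by exists (Ordinal ix); rewrite /v nth_index.
have list i j k : uniq [:: i; j; k] ->
    exists w, perm_eq V [:: v i - o; v j - o; v k - o; w].
  move=> u; apply: perm_rem3 => //; first exact: hs_uniq hV.
    have fi : injective (fun i => v i - o) by move=> x y /addIr/vi.
    by rewrite -[X in uniq X]/(map (fun i => v i - o) [:: i; j; k]) map_inj_uniq.
  by move=> x; rewrite !inE => /or3P[] /eqP ->.
exists v; split; last first.
- have ang i j k : uniq [:: i; j; k] -> angle (v i) (v j) (v k) < pi / 2.
    move=> /list[w pw]; apply: angle_lt_pihalf.
    by rewrite -(subBB (v i) _ o) -(subBB (v k) _ o); exact: (tetra_acute hV pw).
  move=> i j k /= u; split; apply: ang; move: u; rewrite /= !inE !negb_or !andbT;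
    by rewrite ?(eq_sym j i) ?(eq_sym k i) ?(eq_sym k j) => /andP[/andP[-> ->] ->].
(* A symmetry carrying vertex j to vertex i carries the face opposite to j to the face opposite to
   i. *)
- move=> i j; have [g sg [ji _]] := hs_swap hV (vV j) (vV i).
  have [og gV] := sg; exists (fun x => x *m g + (o - o *m g)); split; first exact: isometry_mulmx.
  have gE x : x *m g + (o - o *m g) = (x - o) *m g + o.
    by rewrite mulmxBl addrA addrAC.
  rewrite /tetrahedron_face -chull_image; last exact: affine_mulmx.
  congr chull; apply/seteqP; split=> [_ [k /= /eqP ki <-]|_ [_ [k /= /eqP kj <-] <-]].
    have : (v k - o) *m g^T \in V by apply: (sym_tr (hs_uniq hV) sg).2.
    move=> /centeredP[_ /vP[l ->] lE]; exists (v l).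
      exists l => //=; apply/eqP => lj; apply: ki; apply/vi/(addIr (- o)).
      by rewrite -ji -lj -lE mulmx_orthVK.
    by rewrite gE -lE mulmx_orthVK // subrK.
  rewrite gE.
  have /centeredP[_ /vP[l ->] lE] := gV _ (vV k).
  exists l; last by rewrite lE subrK.
  apply/eqP => li; apply: kj; apply/vi/(addIr (- o))/(orth_inj og) => /=.
  by rewrite ji -li.
- by rewrite /polytope_homogeneous VE; apply: sym_point_homogeneous hV _.
split.
  rewrite PE; congr chull; apply/seteqP; split=> x /=; first by move=> /vP[i ->]; exists i.
  by move=> [i _ <-].
have [w pw] := list 0 1 2 isT.
rewrite (_ : \matrix_(i < 3) _ = rows3 (v 1 - v 0) (v 2 - v 0) (v 3 - v 0)); last first.
  apply/row_matrixP => i; rewrite !rowK; by case: i => -[|[|[|//]]] lt3.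
rewrite row_free_unit; apply: rows3_unit.
have wE : w = v 3 - o.
  have := vV 3; rewrite (perm_mem pw) !inE !(inj_eq (addIr _)) !(inj_eq vi).
  by move=> /eqP.
move: pw; rewrite wE -!(subBB (v _) (v 0) o); exact: (tetra_independent hV).
Qed.
End TetrahedronCase.

Theorem theorem6 (R : realType) (P : set 'rV[R]_3)
    (P_polytope : convex_polytope P)
    (P_nondegenerate : interior P !=set0)
    (P_homogeneous3 : polytope_homogeneous P 3) :
  (forall m : nat, (1 <= m)%N -> polytope_homogeneous P m) /\
  ( 
    (similar_sets P regular_tetrahedron \/ similar_sets P cube \/
     similar_sets P regular_octahedron \/ similar_sets P regular_icosahedron)
  \/ 
    similar_sets P cuboctahedron
  \/ 
    (exists v : 'I_4 -> 'rV[R]_3,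
       [/\ tetrahedron_on v P,
           polytope_homogeneous P 1,
           (forall i j : 'I_4,
              isometric_sets (tetrahedron_face v i) (tetrahedron_face v j))
         & (forall i j k : 'I_4, uniq [:: i; j; k] ->
              acute_triangle (v i) (v j) (v k))])
  \/ 
    (exists (n : nat) (B0 B1 : set 'rV[R]_3),
       [/\ (3 <= n)%N, right_prism n P B0 B1
         & base_distances_separated P B0 B1])
  \/ 
    (exists (n : nat) (B0 B1 : set 'rV[R]_3),
       [/\ (2 <= n)%N, right_antiprism n P B0 B1
         & base_distances_separated P B0 B1])
  \/ 
    (exists a b c : R,
       [/\ 0 < a, a <= b, b <= c, a ^+ 2 + b ^+ 2 <> c ^+ 2
         & isometric_sets P (box a b c)])).
Proof.
have [vs [uvs VE PE]] := polytope_vertices P_polytope.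
have nonplanar (n : 'rV[R]_3) (c : R) : n != 0 -> ~ {in vs, forall x, dot x n = c}.
  move=> n0 nc; apply: (interior_plane (c := c) n0) P_nondegenerate; rewrite PE.
  apply: chull_min => [x y t xc yc _|x /nc //].
  by rewrite /= !dotE xc yc -mulrDl subrKC mul1r.
have [q hV] : exists q, homset (centered vs) q.
  by apply: centered_homset => //; rewrite -VE.
split=> [m m1|]; first by rewrite /polytope_homogeneous VE; apply: sym_point_homogeneous hV _.
have [irr|red] := pselect (irreducible (centered vs)).
  pose s := (Num.sqrt q)^-1.
  have q0 := hs_norm_gt0 hV.
  have s0 : s != 0 by rewrite invr_eq0 gt_eqF // sqrtr_gt0.
  have sq : s ^+ 2 * q = 1 by rewrite exprVn sqr_sqrtr ?ltW // mulVf // gt_eqF.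
  have sim S : similar_copy [seq s *: x | x <- centered vs] S -> similar_sets P (chull S).
    by move=> /(similar_copy_scale s0); apply: similar_polyhedron.
  case: (irreducible_copy (homset_scale s0 sq hV) (irreducible_scale s0 irr)) => [c|[c|[c|[c|c]]]].
  - by left; left; apply: sim.
  - by left; right; left; apply: sim.
  - by left; right; right; left; apply: sim.
  - by left; right; right; right; apply: sim.
  - by right; left; apply: sim.
right; right.
have [V4|[u [h [uu h0 _ sep shape]]]] := reducible_shape hV red.
  by left; exact: (tetrahedron_polyhedron uvs VE PE hV V4).
right; case: shape => shape.
- by left; exact: (prism_polyhedron VE PE hV uu h0 sep shape).
- by right; left; exact: (antiprism_polyhedron VE PE hV uu h0 sep shape).
by right; right; exact: (box_polyhedron PE hV shape).
Qed.
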